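(* Let $n \ge 26$ and let $G$ be a red-blue colouring of $K_n$ with $\mathrm{pack}(G) \le n(n-1)/4$. Then one of $G_R$ and $G_B$ is $(n/8)$-close to bipartite.
   Context: A red-blue colouring $G$ of $K_n$ assigns red or blue to each edge of the complete graph on the $n$-vertex set $V(G)$; $G_R$ and $G_B$ are the spanning subgraphs of red and blue edges. For a graph $F$, a fractional triangle packing is a function $\omega$ from the triangles of $F$ to $[0,1]$ with $\sum_{T \ni e}\omega(T) \le 1$ for every edge $e$; $\nu^*(F)$ is the maximum of $\sum_T \omega(T)$ over fractional triangle packings. $\mathrm{pack}(G) = 3(\nu^*(G_R)+\nu^*(G_B))$. A graph is $k$-close to bipartite if it can be made bipartite by removing at most $k$ edges. *)

(* Defs.v *)
From mathcomp Require Import all_boot all_order all_algebra.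
From mathcomp Require Import all_classical all_reals.
Set Implicit Arguments. Unset Strict Implicit. Unset Printing Implicit Defensive.
Import Order.TTheory GRing.Theory Num.Theory.
Local Open Scope ring_scope.


Section Defs.
Variable T : finType.

Definition simple_graph (F : rel T) : Prop :=
  irreflexive F /\ symmetric F.

(* A red-blue colouring of K_T: given by its red graph; blue = the rest. *)
Definition blue_of (red : rel T) : rel T := fun x y => (x != y) && ~~ red x y.

Definition edges (F : rel T) : {set {set T}} :=
  [set e : {set T} | [exists x, exists y, (x != y) && F x y && (e == [set x; y])]].

Definition triangles (F : rel T) : {set {set T}} :=
  [set t : {set T} | [exists x, exists y, exists z,
     [&& F x y, F y z, F x z & t == [set x; y; z]]]].

Definition frac_tri_packing (R : realType) (F : rel T) (w : {set T} -> R) : Prop :=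
  (forall t, t \in triangles F -> 0 <= w t <= 1) /\
  (forall e, e \in edges F -> \sum_(t in triangles F | e \subset t) w t <= 1).

Definition packing_value (R : realType) (F : rel T) (w : {set T} -> R) : R :=
  \sum_(t in triangles F) w t.

Definition nu_star (R : realType) (F : rel T) : R :=
  sup [set v : R | exists w, frac_tri_packing F w /\ v = packing_value F w]%classic.

Definition pack (R : realType) (red : rel T) : R :=
  3 * (nu_star R red + nu_star R (blue_of red)).

Definition bipartite (F : rel T) : Prop :=
  exists c : T -> bool, forall x y, F x y -> c x != c y.

Definition remove_edges (F : rel T) (S : {set {set T}}) : rel T :=
  fun x y => F x y && ([set x; y] \notin S).

Definition close_to_bipartite (R : realType) (k : R) (F : rel T) : Prop :=
  exists S : {set {set T}}, S \subset edges F /\ (#|S|%:R <= k) /\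
    bipartite (remove_edges F S).
End Defs.

(* Main.v *)
(** By linear programming duality the packing number is the minimum total weight
    of a weighting [y >= 0] of the pairs giving every monochromatic triangle
    weight at least 1, and by complementary slackness every pair with [y > 0] is
    saturated by an optimal packing; so at most [pack] pairs have positive weight.

    If no five-set weighs much more than 1, a lightest five-set receives weight
    about 1 from every other vertex (six vertices of degrees < 1 carry
    edge-disjoint monochromatic triangles, at least two by Goodman), and removing
    it shows by induction that [y] is too heavy.  If all five-sets are heavier but
    the pairs of weight 0 contain a triangle [Q], one removes lightest six-sets
    disjoint from [Q]: each receives weight at least 1 from every other vertex, and
    together with [Q] it weighs 433/75, more than the extremal value 5; again [y] is
    too heavy.  So the graph of weight-0 pairs is triangle-free with at least
    n(n-1)/4 edges, hence bipartite, with parts X and Y say.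

    Pairs inside a part are then saturated, while the pairs across have total load
    at most n/4.  If no triangle of one colour inside a part is used by the packing,
    all edges of that colour inside the parts are saturated by triangles with two
    edges across, so there are at most n/8 of them.  Otherwise a red and a blue used
    triangle inside the parts force too many inner pairs of weight at least 1. *)

(* The scale is n(n-2)/12, the value that saturation forces when the pairs of weight 0 are
   triangle-free. From n to n+6 vertices it grows by n+2 = 5+(n-3), and n-3 is the contribution of
   the vertices outside a six-set and a zero triangle: hence the extremal value 5. The bound to
   beat, n(n-1)/12, grows by n+5/2, so the two sets together must weigh more than 5+1/2. With 433/75
   the recursion is ahead for all n >= 26, at n = 27 by only 1/50.

   The threshold 79/75 for five-sets is pressed from both sides. Raising it strengthens the
   certificates, but weakens the removal of a five-set of weight between 1 and the threshold: at n =
   26 its excess over 1 has to stay below 13/240.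

   Two estimates are sharp at n = 26: removing a five-set of weight at most 1 beats n(n-1)/12 only
   for n > 25, and a clique of at least (n-1)/8 vertices has more than three.

   An optimal weighting need not stay optimal on a subset, and only optimal ones are known to be
   saturated. The induction therefore ranges over arbitrary covers and passes to an optimal one on
   each set. *)
Require Import Defs.
From mathcomp Require Import all_boot all_order all_algebra.
From mathcomp Require Import boolp.
From mathcomp Require Import ring lra zify.
Set Implicit Arguments. Unset Strict Implicit. Unset Printing Implicit Defensive.
Import Order.TTheory GRing.Theory Num.Theory.
Local Open Scope ring_scope.

(** * Linear programming duality *)

Section Duality.
Variable R : realFieldType.

Definition dot (X : finType) (a x : X -> R) : R := \sum_j a j * x j.

Lemma dotC (X : finType) (a x : X -> R) : dot a x = dot x a.
Proof. by apply: eq_bigr => j _; rewrite mulrC. Qed.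

Lemma dotDZr (X : finType) (a x u : X -> R) (k : R) :
  dot a (fun j => x j + k * u j) = dot a x + k * dot a u.
Proof.
rewrite /dot mulr_sumr -big_split /=; apply: eq_bigr => j _; ring.
Qed.

Lemma dotDZl (X : finType) (a x u : X -> R) (k : R) :
  dot (fun j => x j + k * u j) a = dot x a + k * dot u a.
Proof. by rewrite dotC dotDZr 2!(dotC a). Qed.

Lemma dotZr (X : finType) (a x : X -> R) (k : R) :
  dot a (fun j => k * x j) = k * dot a x.
Proof. by rewrite /dot mulr_sumr; apply: eq_bigr => j _; ring. Qed.

Lemma dot_delta (X : finType) (a : X -> R) (i : X) :
  dot a (fun j => (j == i)%:R) = a i.
Proof.
rewrite /dot (bigD1 i) //= eqxx mulr1 big1 ?addr0 // => j /negbTE ->.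
by rewrite mulr0.
Qed.

(* Induction on the number of rows (Bartl): if the last row is really needed,
   some x0 violates the conclusion for the other rows, and projecting along x0
   onto the kernel of the last row reduces to one row less. *)
Lemma farkas (X : finType) (m : nat) (a : nat -> X -> R) (c : X -> R) :
  (forall x : X -> R, (forall i, (i < m)%N -> dot (a i) x <= 0) -> dot c x <= 0) ->
  exists l : nat -> R,
    (forall i, 0 <= l i) /\ forall j, c j = \sum_(i < m) l i * a i j.
Proof.
elim: m a c => [|m IHm] a c Hc.
  exists (fun=> 0); split=> // j; rewrite big_ord0; apply/eqP.
  rewrite -(dot_delta c) eq_le; apply/andP; split; first exact: Hc.
  have := Hc (fun i => -1 * (i == j)%:R).
  by rewrite dotZr mulN1r oppr_le0; apply.
have [H|/existsNP[x0 /not_implyP[Hx0 /negP]]] :=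
    EM (forall x : X -> R, (forall i, (i < m)%N -> dot (a i) x <= 0) ->
          dot c x <= 0).
  have [l [l0 lE]] := IHm a c H.
  exists (fun i => if (i < m)%N then l i else 0); split=> [i|j].
    by case: ifP.
  rewrite big_ord_recr /= ltnn mul0r addr0 lE.
  by apply: eq_bigr => i _; rewrite ltn_ord.
rewrite -ltNge => cx0.
have am0 : 0 < dot (a m) x0.
  rewrite ltNge; apply/negP => am; have := cx0; rewrite ltNge => /negP; apply.
  apply: Hc => i; rewrite ltnS leq_eqVlt => /predU1P[->//|]; exact: Hx0.
set t := dot (a m) x0.
have t0 : t != 0 by rewrite gt_eqF.
pose proj (b : X -> R) j := b j + (- (dot b x0 / t)) * a m j.
have [|l [l0 lE]] := IHm (fun i => proj (a i)) (proj c).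
  move=> x Hx.
  pose z j := x j + (- (dot (a m) x / t)) * x0 j.
  have projE b : dot (proj b) x = dot b z.
    rewrite /proj /z dotDZl dotDZr; ring.
  rewrite projE; apply: Hc => i; rewrite ltnS leq_eqVlt => /predU1P[->|im].
    rewrite /z dotDZr -/t mulNr divfK // subrr //.
  by rewrite -projE; exact: Hx.
exists (fun i => if (i < m)%N then l i else
          (dot c x0 - \sum_(k < m) l k * dot (a k) x0) / t); split=> [i|j].
  case: ifP => // _; apply: divr_ge0; last exact: ltW.
  rewrite subr_ge0; apply: le_trans (ltW cx0); apply: sumr_le0 => k _.
  by apply: mulr_ge0_le0 => //; apply: Hx0.
rewrite big_ord_recr /= ltnn.
under eq_bigr => i _ do rewrite ltn_ord.
have := lE j; rewrite /proj => /eqP; rewrite mulNr subr_eq => /eqP ->.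
have -> : \sum_(i < m) l i * (a i j + - (dot (a i) x0 / t) * a m j) =
  \sum_(i < m) l i * a i j - (\sum_(k < m) l k * dot (a k) x0) / t * a m j.
  rewrite mulr_suml mulr_suml -sumrB; apply: eq_bigr => i _; ring.
ring.
Qed.

(** Homogenisation: the new coordinate [None] carries the right-hand sides, and one more row says
    [0 <= x None]. A homogeneous solution with [x None > 0] could be divided by it, so infeasibility
    means that [x None <= 0] follows from the rows, and [farkas] applies. *)
Lemma farkas_affine (X K : finType) (a : K -> X -> R) (b : K -> R) :
  (exists x : X -> R, forall k, dot (a k) x <= b k) \/
  (exists l : K -> R, [/\ forall k, 0 <= l k,
     forall j, \sum_k l k * a k j = 0 & \sum_k l k * b k < 0]).
Proof.
have [?|H] := EM (exists x : X -> R, forall k, dot (a k) x <= b k); [by left|right].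
(* Index [#|K|], where [insub] returns [None], is the sign row. *)
pose A (i : nat) (o : option X) : R :=
  match insub i : option 'I_#|K|, o with
  | Some i', Some j => a (enum_val i') j
  | Some i', None => - b (enum_val i')
  | None, Some _ => 0
  | None, None => -1 end.
pose C (o : option X) : R := (o == None)%:R.
have sumo (f : option X -> R) : \sum_o f o = f None + \sum_j f (Some j).
  rewrite (bigD1 None) //=; congr (_ + _).
  rewrite (reindex_omap Some id) /=; last by case.
  by apply: eq_bigl => j; rewrite eqxx.
have [|l [l0 lE]] := @farkas _ #|K|.+1 A C.
  move=> x Hx; rewrite /dot sumo /C /= mul1r big1 ?addr0 => [|j _]; last exact: mul0r.
  rewrite leNgt; apply/negP => x0; apply: H.
  exists (fun j => x (Some j) / x None) => k.
  have := Hx (enum_rank k); rewrite ltnS ltnW // => /(_ isT).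
  rewrite /dot sumo /A /=; have -> : insub (nat_of_ord (enum_rank k)) = Some (enum_rank k) by rewrite valK.
  rewrite enum_rankK mulNr addrC subr_le0 => Hk.
  rewrite -(ler_pM2r x0) /dot mulr_suml; apply: le_trans Hk.
  by apply: ler_sum => j _; rewrite mulrA divfK // gt_eqF.
have sumK (f : nat -> R) : \sum_(i < #|K|) f i = \sum_(k : K) f (enum_rank k).
  rewrite (reindex (@enum_rank K)) //=; apply: onW_bij; exact: enum_rank_bij.
have inr (k : K) : insub (nat_of_ord (enum_rank k)) = Some (enum_rank k) by rewrite valK.
have last : (insub #|K| : option 'I_#|K|) = None by rewrite insubN // ltnn.
exists (fun k => l (enum_rank k)); split=> // [j|].
  rewrite -[RHS](_ : C (Some j) = 0) // lE big_ord_recr /= {2}/A last mulr0 addr0.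
  rewrite (sumK (fun i => l i * A i (Some j))).
  by apply: eq_bigr => k _; rewrite /A inr enum_rankK.
have := lE None; rewrite /C eqxx big_ord_recr /= {2}/A last.
rewrite (sumK (fun i => l i * A i None)).
rewrite (eq_bigr (fun k => - (l (enum_rank k) * b k))) => [|k _]; last first.
  by rewrite /A inr enum_rankK mulrN.
rewrite sumrN => E; have := l0 #|K|.
move: E; set s := \sum_k _; set u := l #|K|; lra.
Qed.

(** Primal, dual and the reverse of weak duality form one affine system, so any solution is optimal
    on both sides. A certificate [p], [q], [s] of infeasibility scales, if [s > 0], to a feasible
    pair violating weak duality; if [s = 0], it contradicts the feasibility of [y0] and of the zero
    packing. *)
Lemma lp_duality (I J : finType) (a : I -> J -> R) (c : I -> R) (b : J -> R) :
  (forall j, 0 <= b j) ->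
  (exists2 y : J -> R, forall j, 0 <= y j & forall i, c i <= \sum_j a i j * y j) ->
  exists w : I -> R, exists y : J -> R,
    [/\ forall i, 0 <= w i, forall j, 0 <= y j,
        forall j, \sum_i a i j * w i <= b j,
        forall i, c i <= \sum_j a i j * y j &
        \sum_j b j * y j <= \sum_i c i * w i].
Proof.
move=> b0 [y0 y00 y0c].
(* rows: w >= 0, y >= 0, A^T w <= b, A y >= c, b y <= c w *)
pose K := ((I + J) + (J + I) + unit)%type.
pose M (k : K) (x : I + J) : R :=
  match k, x with
  | inl (inl (inl i)), inl i' => - (i' == i)%:R
  | inl (inl (inr j)), inr j' => - (j' == j)%:R
  | inl (inr (inl j)), inl i => a i j
  | inl (inr (inr i)), inr j => - a i j
  | inr _, inl i => - c i
  | inr _, inr j => b j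
  | _, _ => 0 end.
pose B (k : K) : R :=
  match k with
  | inl (inr (inl j)) => b j
  | inl (inr (inr i)) => - c i
  | _ => 0 end.
have sumX (f : I + J -> R) : \sum_x f x = \sum_i f (inl i) + \sum_j f (inr j).
  exact: big_sumType.
have [[x Hx]|[l [l0 lM lB]]] := farkas_affine M B.
  exists (x \o inl), (x \o inr); split=> /=.
  - move=> i; have := Hx (inl (inl (inl i))); rewrite /dot sumX /=.
    rewrite [X in _ + X]big1 ?addr0 => [|j _]; last exact: mul0r.
    rewrite (bigD1 i) //= eqxx big1 => [|k /negbTE->]; last by rewrite oppr0 mul0r.
    rewrite ?mulr1n.
    lra.
  - move=> j; have := Hx (inl (inl (inr j))); rewrite /dot sumX /=.
    rewrite big1 ?add0r => [|i _]; last exact: mul0r.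
    rewrite (bigD1 j) //= eqxx big1 => [|k /negbTE->]; last by rewrite oppr0 mul0r.
    rewrite ?mulr1n.
    lra.
  - move=> j; have := Hx (inl (inr (inl j))); rewrite /dot sumX /=.
    by rewrite [X in _ + X]big1 ?addr0 // => j' _; exact: mul0r.
  - move=> i; have := Hx (inl (inr (inr i))); rewrite /dot sumX /=.
    rewrite big1 ?add0r => [|? _]; last exact: mul0r.
    under eq_bigr => j _ do rewrite mulNr.
    by rewrite sumrN lerN2.
  - have := Hx (inr tt); rewrite /dot sumX /=.
    under eq_bigr => i _ do rewrite mulNr.
    by rewrite sumrN addrC subr_le0.
exfalso.
pose p j := l (inl (inr (inl j))).
pose q i := l (inl (inr (inr i))).
pose s := l (inr tt).
have sumK (f : K -> R) : \sum_k f k =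
   \sum_i f (inl (inl (inl i))) + \sum_j f (inl (inl (inr j))) +
   (\sum_j f (inl (inr (inl j))) + \sum_i f (inl (inr (inr i)))) + f (inr tt).
  rewrite big_sumType /= big_sumType /= !big_sumType /=; congr (_ + _).
  by rewrite (big_pred1 tt) //; case.
have p0 j : 0 <= p j by exact: l0.
have q0 i : 0 <= q i by exact: l0.
have s0 : 0 <= s by exact: l0.
have Hp i : s * c i <= \sum_j a i j * p j.
  have := lM (inl i); rewrite sumK /= (bigD1 i) //= eqxx big1 => [|k /negbTE ik]; last first.
    by rewrite eq_sym ik oppr0 mulr0.
  rewrite big1 => [|j _]; last exact: mulr0.
  rewrite [X in _ + (_ + X)]big1 => [|k _]; last exact: mulr0.
  have := l0 (inl (inl (inl i))); rewrite -/s.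
  rewrite (eq_bigr (fun j => a i j * p j)) => [|j _]; last by rewrite mulrC.
  rewrite ?mulr1n; lra.
have Hq j : \sum_i a i j * q i <= s * b j.
  have := lM (inr j); rewrite sumK /= big1 => [|i _]; last exact: mulr0.
  rewrite (bigD1 j) //= eqxx big1 => [|k /negbTE ik]; last first.
    by rewrite eq_sym ik oppr0 mulr0.
  rewrite [X in _ + (X + _)]big1 => [|k _]; last exact: mulr0.
  rewrite (eq_bigr (fun i => - (a i j * q i))) => [|i _]; last by rewrite mulrN mulrC.
  rewrite sumrN.
  have := l0 (inl (inl (inr j))); rewrite -/s ?mulr1n; lra.
have HB : \sum_j b j * p j < \sum_i c i * q i.
  move: lB; rewrite sumK /= big1 => [|i _]; last exact: mulr0.
  rewrite big1 => [|i _]; last exact: mulr0.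
  rewrite mulr0 !add0r addr0.
  under [X in _ + X]eq_bigr => i _ do rewrite mulrN.
  rewrite sumrN subr_lt0.
  under eq_bigr => j _ do rewrite mulrC.
  by under [X in _ < X -> _]eq_bigr => j _ do rewrite mulrC.
have exch (f : I -> R) (g : J -> R) :
   \sum_i f i * (\sum_j a i j * g j) = \sum_j g j * (\sum_i a i j * f i).
  under eq_bigr => i _ do rewrite mulr_sumr.
  rewrite exchange_big /=; apply: eq_bigr => j _; rewrite mulr_sumr.
  by apply: eq_bigr => i _; ring.
have [s_eq0|sN0] := eqVneq s 0.
  have : \sum_i c i * q i <= 0.
    apply: (@le_trans _ _ (\sum_i q i * (\sum_j a i j * y0 j))).
      by apply: ler_sum => i _; rewrite mulrC; apply: ler_wpM2l.
    rewrite exch; apply: sumr_le0 => j _; apply: mulr_ge0_le0 => //.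
    by apply: le_trans (Hq j) _; rewrite s_eq0 mul0r.
  have : 0 <= \sum_j b j * p j by apply: sumr_ge0 => j _; apply: mulr_ge0.
  move: HB; lra.
have sp : 0 < s by rewrite lt_def sN0.
have : s * (\sum_i c i * q i) <= s * (\sum_j b j * p j).
  rewrite !mulr_sumr.
  apply: (@le_trans _ _ (\sum_i q i * (\sum_j a i j * p j))).
    apply: ler_sum => i _; rewrite mulrA [leRHS]mulrC.
    by apply: ler_wpM2r.
  rewrite exch; apply: ler_sum => j _; rewrite mulrA [leRHS]mulrC.
  by apply: ler_wpM2l.
by rewrite ler_pM2l // leNgt HB.
Qed.

(** The bilinear form [m] lies between the two objective values. When these meet, two sums of
    nonnegative products vanish, and so does each term. *)
Lemma complementary_slackness (I J : finType) (a : I -> J -> R) (c : I -> R)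
    (b : J -> R) (w : I -> R) (y : J -> R) :
  (forall i, 0 <= w i) -> (forall j, 0 <= y j) ->
  (forall j, \sum_i a i j * w i <= b j) -> (forall i, c i <= \sum_j a i j * y j) ->
  \sum_j b j * y j <= \sum_i c i * w i ->
  [/\ \sum_j b j * y j = \sum_i c i * w i,
      forall i, 0 < w i -> \sum_j a i j * y j = c i &
      forall j, 0 < y j -> \sum_i a i j * w i = b j].
Proof.
move=> w0 y0 Hw Hy le.
pose m := \sum_i w i * (\sum_j a i j * y j).
have mE : m = \sum_j y j * (\sum_i a i j * w i).
  rewrite /m; under eq_bigr => i _ do rewrite mulr_sumr.
  rewrite exchange_big /=; apply: eq_bigr => j _; rewrite mulr_sumr.
  by apply: eq_bigr => i _; ring.
have m1 : \sum_i c i * w i <= m.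
  by apply: ler_sum => i _; rewrite mulrC; apply: ler_wpM2l.
have m2 : m <= \sum_j b j * y j.
  by rewrite mE; apply: ler_sum => j _; rewrite [leRHS]mulrC; apply: ler_wpM2l.
have e1 : \sum_i w i * (\sum_j a i j * y j - c i) = 0.
  under eq_bigr => i _ do rewrite mulrBr.
  rewrite sumrB -/m [X in _ - X](eq_bigr (fun i => c i * w i)) => [|i _]; last exact: mulrC.
  by move: m1 m2 le; lra.
have e2 : \sum_j y j * (b j - \sum_i a i j * w i) = 0.
  under eq_bigr => j _ do rewrite mulrBr.
  rewrite sumrB -mE (eq_bigr (fun j => b j * y j)) => [|j _]; last exact: mulrC.
  by move: m1 m2 le; lra.
split; first by move: m1 m2 le; lra.
- move=> i wi; have /psumr_eq0P : forall i, true -> 0 <= w i * (\sum_j a i j * y j - c i).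
    by move=> k _; rewrite mulr_ge0 // subr_ge0.
  move=> /(_ e1 i isT)/eqP; rewrite mulf_eq0 gt_eqF //= subr_eq0 => /eqP //.
- move=> j yj; have /psumr_eq0P : forall j, true -> 0 <= y j * (b j - \sum_i a i j * w i).
    by move=> k _; rewrite mulr_ge0 // subr_ge0.
  by move=> /(_ e2 j isT)/eqP; rewrite mulf_eq0 gt_eqF //= subr_eq0 => /eqP ->.
Qed.

End Duality.

(** * Weights on pairs and monochromatic triangles *)

Section Weights.
Variables (R : realFieldType) (T : finType).
Implicit Types (S K A B : {set T}) (y : T -> T -> R) (c : rel T).

Definition weighting y :=
  [/\ forall x z, y x z = y z x, forall x, y x x = 0 & forall x z, 0 <= y x z].

Definition wt y S : R := (\sum_(x in S) \sum_(z in S) y x z) / 2.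
Definition cost y K x : R := \sum_(k in K) y x k.

(** [c] is the red graph and its negation off the diagonal the blue one, so one predicate covers the
    triangles of both colours. *)
Definition tri c x u v :=
  [&& x != u, x != v, u != v, c x u == c x v & c x u == c u v].

Definition covers c y S := forall x u v, x \in S -> u \in S -> v \in S ->
  tri c x u v -> 1 <= y x u + y x v + y u v.

Lemma triCl c : symmetric c -> forall x u v, tri c x u v = tri c u x v.
Proof.
move=> cs x u v; rewrite /tri (cs u x) eq_sym.
by case: (c x u); case: (c x v); case: (c u v); case: (u == x); case: (x == v);
  case: (u == v).
Qed.

Lemma triCr c : symmetric c -> forall x u v, tri c x u v = tri c x v u.
Proof.
move=> cs x u v; rewrite /tri (cs v u) (eq_sym v u).
by case: (c x u); case: (c x v); case: (c u v); case: (x == u); case: (x == v);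
  case: (u == v).
Qed.

Lemma coversS c y S K : K \subset S -> covers c y S -> covers c y K.
Proof. by move=> /subsetP KS H x u v xK uK vK; apply: H; apply: KS. Qed.

Lemma sum_setU (F : T -> R) A B : [disjoint A & B] ->
  \sum_(x in A :|: B) F x = \sum_(x in A) F x + \sum_(x in B) F x.
Proof.
move=> dAB; rewrite -[RHS](@bigU _ _ _ T (mem A) (mem B) F dAB) /=.
by apply: eq_bigl => x; rewrite !inE.
Qed.

Section Fixed.
Variables (y : T -> T -> R) (yW : weighting y).
Let ysym := let: And3 h _ _ := yW in h.
Let ydiag := let: And3 _ h _ := yW in h.
Let yge0 := let: And3 _ _ h := yW in h.

Lemma cost_ge0 K x : 0 <= cost y K x.
Proof. by apply: sumr_ge0. Qed.

Lemma wt_ge0 S : 0 <= wt y S.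
Proof. by apply: divr_ge0 => //; apply: sumr_ge0 => x _; apply: cost_ge0. Qed.

Lemma sum_cost S : \sum_(x in S) cost y S x = 2 * wt y S.
Proof. by rewrite /wt mulrC divfK // pnatr_eq0. Qed.

Lemma cost_setU A B x : [disjoint A & B] ->
  cost y (A :|: B) x = cost y A x + cost y B x.
Proof. exact: sum_setU. Qed.

Lemma sum_costC A B : \sum_(x in A) cost y B x = \sum_(z in B) cost y A z.
Proof.
by rewrite /cost exchange_big /=; apply: eq_bigr => x _; apply: eq_bigr => z _.
Qed.

Lemma wt_setU A B : [disjoint A & B] ->
  wt y (A :|: B) = wt y A + wt y B + \sum_(x in A) cost y B x.
Proof.
move=> dAB; rewrite /wt [X in X / 2](_ : _ = (\sum_(x in A) cost y A x + \sum_(x in B) cost y B x)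
   + 2 * \sum_(x in A) cost y B x); first by field.
rewrite sum_setU //=.
rewrite (eq_bigr (fun x => cost y A x + cost y B x)) => [|x _]; last exact: cost_setU.
rewrite [X in _ + X](eq_bigr (fun x => cost y A x + cost y B x)) => [|x _]; last exact: cost_setU.
rewrite !big_split /= (sum_costC B A); ring.
Qed.

Lemma wt_set1 x : wt y [set x] = 0.
Proof. by rewrite /wt !big_set1 ydiag mul0r. Qed.

Lemma wt_setU1 K x : x \notin K -> wt y (x |: K) = wt y K + cost y K x.
Proof.
move=> xK; rewrite wt_setU ?disjoints1 // wt_set1 add0r big_set1 //.
Qed.

Lemma cost_setD1 S x : cost y (S :\ x) x = cost y S x.
Proof.
rewrite /cost [RHS](bigID (pred1 x)) /= [X in X + _]big1 ?add0r => [|k /andP[_ /eqP->]//].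
by apply: eq_bigl => k; rewrite !inE andbC.
Qed.

Lemma wt_setD1 S x : x \in S -> wt y S = wt y (S :\ x) + cost y S x.
Proof.
by move=> xS; rewrite -{1}(setD1K xS) wt_setU1 ?setD11 // cost_setD1.
Qed.

Lemma wt_setD S K : K \subset S ->
  wt y S = wt y (S :\: K) + wt y K + \sum_(x in S :\: K) cost y K x.
Proof.
move=> KS; rewrite -wt_setU; last by rewrite -setI_eq0 setIDAC setIC setDIl setDv set0I.
congr wt; apply/setP => x; rewrite !inE.
by case xK: (x \in K); rewrite ?orbF //= (subsetP KS).
Qed.

Lemma costS A B x : A \subset B -> cost y A x <= cost y B x.
Proof.
move=> AB; rewrite /cost [leRHS](big_setID A) /= (setIidPr AB) lerDl.
by apply: sumr_ge0.
Qed.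

Lemma cost_ge_seq S x (s : seq T) : uniq s -> {subset s <= S} ->
  \sum_(z <- s) y x z <= cost y S x.
Proof.
move=> us sS; rewrite (big_uniq _ us) /=.
rewrite /cost [leRHS](bigID (mem s)) /=.
rewrite [X in _ <= X + _](eq_bigl (mem s)) => [|k /=]; last first.
  by apply/andb_idl => /sS.
by rewrite lerDl; apply: sumr_ge0.
Qed.

Lemma min_set S m : (m <= #|S|)%N -> exists K : {set T},
  [/\ K \subset S, #|K| = m & forall K' : {set T}, K' \subset S -> #|K'| = m -> wt y K <= wt y K'].
Proof.
move=> mS.
have [K0 /andP[K0S K0m]] : exists K0 : {set T}, (K0 \subset S) && (#|K0| == m).
  have : (0 < #|[set A : {set T} | A \subset S & #|A| == m]|)%N.
    by rewrite cards_draws bin_gt0.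
  by case/card_gt0P => K0; rewrite inE => H; exists K0.
pose P (K : {set T}) := (K \subset S) && (#|K| == m).
have PK0 : P K0 by apply/andP.
case: (arg_minP (wt y) PK0) => K /andP[KS /eqP Km] H; exists K; split=> // K' KS' Km'.
by apply: H; rewrite /P KS' Km' eqxx.
Qed.

Section Coloured.
Variables (c : rel T) (cs : symmetric c).

Definition ntri S : nat :=
  (\sum_(x in S) \sum_(u in S) \sum_(v in S) tri c x u v)%N.

(** The two covering inequalities together count the common pair twice, as do the two costs. Hence
    monochromatic triangles are edge-disjoint wherever all costs are below 1. *)
Lemma two_tri_share_edge S x u v v' : covers c y S ->
  x \in S -> u \in S -> v \in S -> v' \in S -> v != v' ->
  tri c x u v -> tri c x u v' -> 2 <= cost y S x + cost y S u.
Proof.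
move=> Hc xS uS vS v'S vv' t1 t2.
have h1 := Hc _ _ _ xS uS vS t1; have h2 := Hc _ _ _ xS uS v'S t2.
move: (t1) (t2) => /and5P[xu xv uv _ _] /and5P[_ xv' uv' _ _].
have : \sum_(z <- [:: u; v; v']) y x z <= cost y S x.
  apply: cost_ge_seq; first by rewrite /= !inE negb_or uv uv' vv'.
  by move=> z; rewrite !inE => /or3P[] /eqP->.
have : \sum_(z <- [:: x; v; v']) y u z <= cost y S u.
  apply: cost_ge_seq; first by rewrite /= !inE negb_or xv xv' vv'.
  by move=> z; rewrite !inE => /or3P[] /eqP->.
rewrite !big_cons !big_nil (ysym u x); lra.
Qed.

(** The monochromatic triangles are edge-disjoint, so their weights add up to at most [wt y S]. The
    factor 6 appears because [ntri] counts ordered triples. *)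
Lemma ntri_le_wt S : covers c y S -> (forall x, x \in S -> cost y S x < 1) ->
  (ntri S)%:R <= 6 * wt y S.
Proof.
move=> Hc Hd.
have uniq_tri x u : x \in S -> u \in S ->
    (\sum_(v in S) (tri c x u v)%:R : R) <= 1.
  move=> xS uS; have [[v vS tv]|H] := @exists_inP _ (fun v => v \in S) (tri c x u).
    rewrite (bigD1 v) //= tv big1 ?addr0 // => v' /andP[v'S v'v].
    case tv': (tri c x u v') => //.
    have := two_tri_share_edge Hc xS uS v'S vS v'v tv' tv.
    move: (Hd _ xS) (Hd _ uS); lra.
  rewrite big1 // => v vS; case tv: (tri _ _ _ _) => //; case: H; by exists v.
have E : (ntri S)%:R <= \sum_(x in S) \sum_(u in S) \sum_(v in S)
   ((tri c x u v)%:R * y x u + (tri c x u v)%:R * y x v + (tri c x u v)%:R * y u v).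
  rewrite /ntri natr_sum; apply: ler_sum => x xS.
  rewrite natr_sum; apply: ler_sum => u uS.
  rewrite natr_sum; apply: ler_sum => v vS.
  case t: (tri c x u v); last by rewrite !mul0r !addr0.
  by rewrite !mul1r; apply: Hc.
apply: le_trans E _.
have A : \sum_(x in S) \sum_(u in S) \sum_(v in S) (tri c x u v)%:R * y x u <= 2 * wt y S.
  rewrite -sum_cost; apply: ler_sum => x xS; apply: ler_sum => u uS.
  by rewrite -mulr_suml -[leRHS]mul1r; apply: ler_wpM2r => //; apply: uniq_tri.
under eq_bigr => x _ do under eq_bigr => u _ do rewrite big_split /= big_split /=.
under eq_bigr => x _ do rewrite big_split /= big_split /=.
rewrite big_split /= big_split /=.
have -> : \sum_(x in S) \sum_(u in S) \sum_(v in S) (tri c x u v)%:R * y x v =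
   \sum_(x in S) \sum_(u in S) \sum_(v in S) (tri c x u v)%:R * y x u.
  apply: eq_bigr => x _; rewrite exchange_big /=.
  by apply: eq_bigr => u _; apply: eq_bigr => v _; rewrite triCr.
have -> : \sum_(x in S) \sum_(u in S) \sum_(v in S) (tri c x u v)%:R * y u v =
   \sum_(x in S) \sum_(u in S) \sum_(v in S) (tri c x u v)%:R * y x u.
  rewrite exchange_big /=; apply: eq_bigr => u _; rewrite exchange_big /=.
  by apply: eq_bigr => v _; apply: eq_bigr => x _; rewrite triCl // triCr.
lra.
Qed.

End Coloured.
End Fixed.

Section Goodman.
Variables (c : rel T) (cs : symmetric c).

Lemma sum_distinct S (n := #|S|) :
  (\sum_(x in S) \sum_(u in S) \sum_(v in S) [&& x != u, x != v & u != v] = n * (n.-1 * n.-2))%N.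
Proof.
rewrite -sum_nat_const; apply: eq_bigr => x xS.
rewrite (bigD1 x) //= big1 ?add0n => [|v _]; last by rewrite eqxx.
have nx : #|S :\ x| = n.-1 by rewrite /n (cardsD1 x S) xS.
rewrite -nx -sum_nat_const.
rewrite [RHS](eq_bigl (fun u => (u \in S) && (u != x))) => [|u]; last by rewrite !inE andbC.
apply: eq_bigr => u /andP[uS ux].
have -> : #|S :\ x|.-1 = #|S :\ x :\ u|.
  by rewrite (cardsD1 u (S :\ x)) !inE ux uS.
rewrite -sum1_card big_mkcond [RHS]big_mkcond /=; apply: eq_bigr => v _.
rewrite !inE (eq_sym x u) ux (eq_sym x v) (eq_sym u v) /=.
by case: (v \in S); case: (v == x); case: (v == u).
Qed.

(* Goodman: every non-monochromatic triple has exactly two bichromatic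
   cherries, and x is the centre of at most floor((n-1)^2/4) of them. *)
Lemma goodman S (n := #|S|) :
  (n * (n.-1 * n.-2) <= ntri c S + 3 * (n * ((n.-1 * n.-1) %/ 4)))%N.
Proof.
pose d (x u v : T) : bool := [&& x != u, x != v & u != v].
pose b (x u v : T) : nat := d x u v && (c x u != c x v).
have cherry x : x \in S -> (\sum_(u in S) \sum_(v in S) b x u v <= 2 * ((n.-1 * n.-1) %/ 4))%N.
  move=> xS.
  pose A := [set u in S | (u != x) && c x u].
  pose B := [set u in S | (u != x) && ~~ c x u].
  have AB : (#|A| + #|B| = n.-1)%N.
    have -> : n.-1 = #|S :\ x| by rewrite /n (cardsD1 x S) xS.
    rewrite -(cardsID [set u | c x u] (S :\ x)); congr (_ + _)%N; apply: eq_card => u.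
      by rewrite !inE andbA [(u \in S) && _]andbC.
    by rewrite !inE; case: (u \in S); case: (u == x); case: (c x u).
  have -> : (\sum_(u in S) \sum_(v in S) b x u v = #|A| * #|B| + #|B| * #|A|)%N.
    transitivity (\sum_(u in S) \sum_(v in S)
        ((u \in A) * (v \in B) + (u \in B) * (v \in A)))%N.
      apply: eq_bigr => u uS; apply: eq_bigr => v vS; rewrite /b /d !inE uS vS /=.
      rewrite (eq_sym x u) (eq_sym x v).
      have [->|] := eqVneq u v; last by case: (u == x); case: (v == x); case: (c x u); case: (c x v).
      by case: (v == x); case: (c x v).
    have AS : A \subset S by apply/subsetP => u; rewrite inE => /andP[].
    have BS : B \subset S by apply/subsetP => u; rewrite inE => /andP[].
    have cnt (X : {set T}) : X \subset S -> (\sum_(u in S) (u \in X) = #|X|)%N.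
      move=> XS; rewrite -sum1_card big_mkcond [RHS]big_mkcond /=; apply: eq_bigr => u _.
      case uX: (u \in X); last by case: ifP.
      by rewrite (subsetP XS).
    under eq_bigr => u _ do rewrite big_split /= -!big_distrr /=.
    by rewrite big_split /= -!big_distrl /= !cnt.
  have : (4 * (#|A| * #|B|) <= n.-1 * n.-1)%N by rewrite -AB mulnn (nat_AGM2 #|A| #|B|).
  by move: (n.-1 * n.-1)%N (#|A| * #|B|)%N (#|B| * #|A|)%N (mulnC #|A| #|B|) => p q r; lia.
have key : (2 * (\sum_(x in S) \sum_(u in S) \sum_(v in S) d x u v) =
  2 * ntri c S + 3 * \sum_(x in S) \sum_(u in S) \sum_(v in S) b x u v)%N.
  have -> : (3 * \sum_(x in S) \sum_(u in S) \sum_(v in S) b x u v =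
     \sum_(x in S) \sum_(u in S) \sum_(v in S) (b x u v + b u x v + b v x u))%N.
    under [RHS]eq_bigr => x _ do under eq_bigr => u _ do rewrite big_split /= big_split /=.
    under [RHS]eq_bigr => x _ do rewrite big_split /= big_split /=.
    rewrite big_split /= big_split /= mulSn mulSn mul1n addnA; congr (_ + _ + _)%N.
      by rewrite exchange_big.
    rewrite [RHS]exchange_big /= [RHS](eq_bigr (fun u => \sum_(v in S) \sum_(x in S) b v x u)%N); last first.
      by move=> u _; rewrite exchange_big.
    rewrite [RHS]exchange_big /=; apply: eq_bigr => v _; rewrite exchange_big /=.
    by apply: eq_bigr => x _; apply: eq_bigr => u _.
  rewrite /ntri !big_distrr /= -big_split; apply: eq_bigr => x _.
  rewrite !big_distrr /= -big_split; apply: eq_bigr => u _.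
  rewrite !big_distrr /= -big_split; apply: eq_bigr => v _.
  rewrite /tri /b /d (eq_sym u x) (eq_sym v x) (eq_sym v u) (cs u x) (cs v x) (cs v u).
  by case: (x == u); case: (x == v); case: (u == v); case: (c x u); case: (c x v); case: (c u v).
have := sum_distinct S; rewrite -/n => sd.
have sb : (\sum_(x in S) \sum_(u in S) \sum_(v in S) b x u v <= n * (2 * ((n.-1 * n.-1) %/ 4)))%N.
  rewrite -sum_nat_const; apply: leq_sum => x xS; exact: cherry.
move: key; rewrite [X in (2 * X)%N](_ : _ = n * (n.-1 * n.-2))%N //.
move: sb; move: (n * (n.-1 * n.-2))%N ((n.-1 * n.-1) %/ 4)%N (\sum_(x in S) _)%N => p q r.
rewrite mulnCA; move: (n * q)%N => s; lia.
Qed.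

End Goodman.
End Weights.

(** * Weights of sets of five to eight vertices *)

Section Local.
Variables (R : realFieldType) (T : finType).
Variables (y : T -> T -> R) (yW : weighting y) (c : rel T) (cs : symmetric c).
Implicit Types S K : {set T}.

(** Goodman's bound leaves 120 - 108 = 12 ordered triples, that is, two triangles, and these are
    edge-disjoint. *)
Lemma six_low_degree K : covers c y K -> #|K| = 6%N ->
  (forall x, x \in K -> cost y K x < 1) -> 2 <= wt y K.
Proof.
move=> Hc K6 Hd; have := ntri_le_wt yW cs Hc Hd.
have := goodman cs K; rewrite K6 /=.
have -> : (3 * (6 * ((5 * 5) %/ 4)) = 108)%N by [].
have -> : (6 * (5 * 4) = 120)%N by [].
move=> H; have : (12 <= ntri c K)%N by move: (ntri c K) H => m; lia.
by rewrite -(ler_nat R); lra.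
Qed.

(** If all costs were below 1, the weight would be below 7/2; but Goodman's bound gives 210 - 189 =
    21 ordered triples, hence weight at least 21/6. *)
Lemma seven_high_degree K : covers c y K -> #|K| = 7%N ->
  exists2 x, x \in K & 1 <= cost y K x.
Proof.
move=> Hc K7; apply/exists_inP; apply: contraT; rewrite negb_exists_in => /forall_inP Hd'.
have Hd x : x \in K -> cost y K x < 1 by move=> /Hd'; rewrite -ltNge.
have := ntri_le_wt yW cs Hc Hd.
have := goodman cs K; rewrite K7 /=.
have -> : (3 * (7 * ((6 * 6) %/ 4)) = 189)%N by [].
have -> : (7 * (6 * 5) = 210)%N by [].
move=> H; have : (21 <= ntri c K)%N by move: (ntri c K) H => m; lia.
rewrite -(ler_nat R).
have : \sum_(x in K) cost y K x < \sum_(x in K) 1.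
  apply: ltr_sum => //; have : (0 < #|K|)%N by rewrite K7.
  by case/card_gt0P => x xK; apply/hasP; exists x => //; rewrite mem_index_enum.
rewrite sum_cost // sumr_const K7; lra.
Qed.

Definition min_wt S K := forall K' : {set T}, K' \subset S -> #|K'| = #|K| ->
  wt y K <= wt y K'.

(** Exchanging [v] for [x] must not make a lightest set lighter. So if [x] has cost below 1, every
    vertex of [x |: K] has. *)
Lemma cost_swap S K x v : min_wt S K -> K \subset S -> x \in S -> x \notin K ->
  v \in K -> cost y (x |: K) v <= cost y K x.
Proof.
move=> Hmin KS xS xK vK.
have xKS : x |: K \subset S by rewrite subUset sub1set xS.
have vxK : v \in x |: K by rewrite !inE vK orbT.
have : wt y K <= wt y ((x |: K) :\ v).
  apply: Hmin; first exact: subset_trans (subsetDl _ _) xKS.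
  have := cardsD1 v (x |: K); rewrite vxK cardsU1 xK => /eqP.
  by rewrite eqn_add2l => /eqP.
have := wt_setD1 yW vxK; rewrite (wt_setU1 yW xK); lra.
Qed.

(** If [x] had cost below 1, [cost_swap] would make all costs in the six-set [x |: K] smaller than
    1. That set would weigh at least 2 by [six_low_degree], yet its weight is [wt y K] plus the cost
    of [x]. *)
Lemma min_five_cost S K x : covers c y S -> min_wt S K -> K \subset S -> #|K| = 5%N ->
  wt y K <= 1 -> x \in S -> x \notin K -> 1 <= cost y K x.
Proof.
move=> Hc Hmin KS K5 K1 xS xK; rewrite leNgt; apply/negP => lt1.
have xKS : x |: K \subset S by rewrite subUset sub1set xS.
have cE : cost y (x |: K) x = cost y K x.
  by rewrite -(cost_setD1 yW) setU1K.
have : 2 <= wt y (x |: K).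
  apply: six_low_degree; [exact: (coversS xKS Hc)|by rewrite cardsU1 xK K5|].
  move=> v; rewrite !inE => /predU1P[->|vK]; first by rewrite cE.
  by apply: le_lt_trans lt1; exact: (cost_swap Hmin KS xS xK vK).
rewrite (wt_setU1 yW xK); lra.
Qed.

(** The vertex of cost at least 1 in the seven-set [x |: K] is [x] itself or passes its bound on to
    [x] by [cost_swap]. *)
Lemma min_six_cost S K x : covers c y S -> min_wt S K -> K \subset S -> #|K| = 6%N ->
  x \in S -> x \notin K -> 1 <= cost y K x.
Proof.
move=> Hc Hmin KS K6 xS xK.
have xKS : x |: K \subset S by rewrite subUset sub1set xS.
have [||v] := @seven_high_degree (x |: K).
- exact: (coversS xKS Hc).
- by rewrite cardsU1 xK K6.
rewrite !inE => /predU1P[->|vK]; first by rewrite -(cost_setD1 yW) setU1K.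
by move=> /le_trans; apply; exact: (cost_swap Hmin KS xS xK vK).
Qed.

Definition fives S (a : R) := forall K, K \subset S -> #|K| = 5%N -> a <= wt y K.

Lemma fivesS S K a : K \subset S -> fives S a -> fives K a.
Proof. by move=> KS H L LK; apply: H; apply: subset_trans KS. Qed.

(** Deleting a vertex of cost at least 1 leaves a five-set of weight at least 1; without such a
    vertex the two triangles of [six_low_degree] give 2. *)
Lemma six_ge2 K : covers c y K -> fives K 1 -> #|K| = 6%N -> 2 <= wt y K.
Proof.
move=> Hc H5 K6.
have [/exists_inP[x xK x1]|] := boolP [exists x in K, 1 <= cost y K x].
  have := wt_setD1 yW xK; have : 1 <= wt y (K :\ x).
    by apply: H5; rewrite ?subsetDl // (cardsD1 x) xK in K6 *; case: K6.
  lra.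
rewrite negb_exists_in => /forall_inP Hd; apply: six_low_degree => // x /Hd.
by rewrite -ltNge.
Qed.

Lemma seven_ge3 K : covers c y K -> fives K 1 -> #|K| = 7%N -> 3 <= wt y K.
Proof.
move=> Hc H5 K7; have [x xK x1] := seven_high_degree Hc K7.
have := wt_setD1 yW xK; have : 2 <= wt y (K :\ x).
  apply: six_ge2.
  - exact: coversS (subsetDl _ _) Hc.
  - exact: fivesS (subsetDl _ _) H5.
  - by rewrite (cardsD1 x) xK in K7 *; case: K7.
lra.
Qed.

(** A vertex of cost at least 1 inside a seven-subset costs at least as much in all of [K]. *)
Lemma eight_ge4 K : covers c y K -> fives K 1 -> #|K| = 8%N -> 4 <= wt y K.
Proof.
move=> Hc H5 K8.
have /card_gt0P[z zK] : (0 < #|K|)%N by rewrite K8.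
have K7 : #|K :\ z| = 7%N by rewrite (cardsD1 z) zK in K8 *; case: K8.
have [x] := seven_high_degree (coversS (subsetDl _ [set z]) Hc) K7.
rewrite !inE => /andP[_ xK] /le_trans/(_ (costS yW x (subsetDl K [set z]))) x1.
have := wt_setD1 yW xK; have : 3 <= wt y (K :\ x).
  apply: seven_ge3.
  - exact: coversS (subsetDl _ _) Hc.
  - exact: fivesS (subsetDl _ _) H5.
  - by rewrite (cardsD1 x) xK in K8 *; case: K8.
lra.
Qed.

End Local.

(** * Certificates for a zero triangle beside a sparse six-set *)

(* Vertices 0..5 form the six-set and 6, 7, 8 a triangle of weight 0 whose edges
   67 and 78 are red and 68 blue.  A state is a list of 15 colours of the pairs of
   the six-set in lexicographic order (0 blue, 1 red, 2 unknown) and a list of six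
   patterns: 0 unknown; 1 the vertex sends weight at least 1 to the triangle;
   2 its edge to 7 is blue and its edges to 6 and 8 are not both blue, the only
   way not to form a monochromatic triangle with two of 6, 7, 8; 3, 4, 5 its
   edges to 6, 7, 8 are red-blue-red, red-blue-blue, blue-blue-red.

   An entry proves that its state forces total weight at least 433/75, either by
   nonnegative integer multipliers of valid inequalities (a set [vs] weighs at
   least [rhs vs / 75]) that load every pair at most [q] times, or by branching to
   earlier entries up to a relabelling of the vertices.  The tables come from a
   branch and bound search with an LP solver. *)
Definition ref := (nat * seq nat)%type.
(** [Contra] exhibits a monochromatic triangle other than the known ones. [BrU] decides between
    patterns 1 and 2, [BrF] splits 2 into 3, 4, 5, [BrE] colours a pair, and [Same] refers to one
    entry without branching. *)
Inductive step :=
  | Leaf of nat & seq (nat * seq nat)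
  | Contra of nat & nat & nat
  | BrU of nat & ref & ref
  | BrF of nat & ref & ref & ref
  | BrE of nat & nat & ref & ref
  | Same of ref.
Record entry := Entry { kcol : seq nat; pats : seq nat; how : step }.

(** The rows of the list start at 0, 5, 9, 12, 14. The offsets are smaller by [i], because the first
    [j] in row [i] has [j.-1 = i]. *)
Definition kidx (i j : nat) : nat := (nth 0 [:: 0; 4; 7; 9; 10] i + j.-1)%N.

Definition qcol (p j : nat) : nat :=
  match p with
  | 2 => if j == 7%N then 0 else 2
  | 3 => if j == 7%N then 0 else 1
  | 4 => if j == 6%N then 1 else 0
  | 5 => if j == 8%N then 1 else 0
  | _ => 2
  end%N.

Definition ecol_lt (kc pt : seq nat) (i j : nat) : nat :=
  if (j < 6)%N then nth 2%N kc (kidx i j)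
  else if (i < 6)%N then qcol (nth 0%N pt i) j else 2%N.

Definition ecol kc pt i j := if (i < j)%N then ecol_lt kc pt i j else ecol_lt kc pt j i.

(** The size of [vs] determines the inequality: three vertices are a monochromatic triangle; four
    are a vertex of pattern 1 with the zero triangle; five to eight are arbitrary and weigh at least
    79/75, 2, 3, 4 respectively. *)
Definition okc kc pt (vs : seq nat) : bool :=
  [&& uniq vs, all (fun i => (i < 9)%N) vs &
  match vs with
  | [:: i; j; k] => [&& (ecol kc pt i j < 2)%N, ecol kc pt i j == ecol kc pt i k
                      & ecol kc pt i j == ecol kc pt j k]
  | [:: k; a; b; d] => [&& (k < 6)%N, nth 0%N pt k == 1%N, a == 6%N, b == 7%N & d == 8%N]
  | _ => (4 < size vs < 9)%N
  end].

Definition rhs (vs : seq nat) : nat :=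
  nth 0%N [:: 0; 0; 0; 75; 75; 79; 150; 225; 300]%N (size vs).

Definition load (l : seq (nat * seq nat)) (i j : nat) : nat :=
  (sumn [seq (if (i \in p.2) && (j \in p.2) then p.1 else 0) | p <- l])%N.

(** Pairs inside the zero triangle have weight 0 and may be loaded without limit. *)
Definition check_leaf kc pt q l : bool :=
  [&& (0 < q)%N, all (fun p => okc kc pt p.2) l,
      all (fun i => all (fun j => [|| i == j, (5 < i)%N && (5 < j)%N |
                          (load l i j <= q)%N]) (iota 0 9)) (iota 0 9)
    & (433 * q <= sumn [seq p.1 * rhs p.2 | p <- l])%N].

(** [ts] lists the monochromatic triangles of the six-set. A sparse six-set has exactly two, which
    is what makes [Contra] a refutation. *)
Definition istri (ts : seq (seq nat)) i j k :=
  has (fun t => [&& i \in t, j \in t & k \in t]) ts.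

Definition e0 := Entry [::] [::] (Same (0%N, [::])).

(** Vertex [i] of entry [m] is played by vertex [pn i] of the present state, and the entry may
    assume no more than the state knows. Vertex 7, the meeting point of the two red edges, stays in
    place; exchanging 6 and 8 is a symmetry. Patterns 3 to 5 are compared only through their
    colours. *)
Definition check_ref (ts : seq (seq nat)) (es : seq entry) (n : nat) (r : ref) kc pt : bool :=
  let: (m, p) := r in
  let e := nth e0 es m in
  let pn := nth 0%N p in
  [&& (m < n)%N, perm_eq p (iota 0 9), all (fun i => (pn i < 6)%N) (iota 0 6),
   pn 7 == 7%N, 
   all (fun t => has (fun t' => all (fun i => (pn i \in t) ==> (i \in t')) (iota 0 6)) ts) ts,
   all (fun i => all (fun j => (i < j)%N ==>
     ((ecol (kcol e) (pats e) i j == 2%N) ||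
     (ecol (kcol e) (pats e) i j == ecol kc pt (pn i) (pn j)))) (iota 0 9)) (iota 0 9)
   & all (fun k => ((nth 0%N (pats e) k == 1%N) ==> (nth 0%N pt (pn k) == 1%N)) &&
                   ((nth 0%N (pats e) k == 2%N) ==> (nth 0%N pt (pn k) == 2%N))) (iota 0 6)].

Definition check_entry (ts : seq (seq nat)) es n : bool :=
  let e := nth e0 es n in
  let kc := kcol e in let pt := pats e in
  let ck r kc pt := check_ref ts es n r kc pt in
  match how e with
  | Leaf q l => check_leaf kc pt q l
  | Contra i j k => [&& (i < j)%N, (j < k)%N, (k < 6)%N, (ecol kc pt i j < 2)%N,
      ecol kc pt i j == ecol kc pt i k, ecol kc pt i j == ecol kc pt j k & ~~ istri ts i j k]
  | BrU k r1 r2 => [&& (k < 6)%N, nth 0%N pt k == 0%N,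
      ck r1 kc (set_nth 0%N pt k 1%N) & ck r2 kc (set_nth 0%N pt k 2%N)]
  | BrF k r1 r2 r3 => [&& (k < 6)%N, nth 0%N pt k == 2%N,
      ck r1 kc (set_nth 0%N pt k 3%N), ck r2 kc (set_nth 0%N pt k 4%N) &
      ck r3 kc (set_nth 0%N pt k 5%N)]
  | BrE i j r1 r2 => [&& (i < j)%N, (j < 6)%N,
      ck r1 (set_nth 2%N kc (kidx i j) 0%N) pt & ck r2 (set_nth 2%N kc (kidx i j) 1%N) pt]
  | Same r => ck r kc pt
  end.

Definition check_table ts es := all (check_entry ts es) (iota 0 (size es)).

(** The two triangles of the six-set are disjoint: 012 and 345. The last four entries are the roots,
    one for each pair of colours. *)
Definition table_D : seq entry := [::
Entry [::0;0;2;2;2;0;2;2;2;2;2;2;0;0;0] [::1;0;0;0;1;0] (Leaf 1 [::(1,[::0;1;2]);(1,[::3;4;5]);(1,[::0;6;7;8]);(1,[::4;6;7;8]);(1,[::2;3;6;7;8]);(1,[::1;5;6;7;8])]);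
Entry [::0;0;2;2;2;0;2;2;2;2;2;2;0;0;0] [::2;0;1;0;1;0] (Leaf 1 [::(1,[::0;1;2]);(1,[::3;4;5]);(1,[::2;6;7;8]);(1,[::4;6;7;8]);(1,[::1;3;6;7;8]);(1,[::0;5;6;7;8])]);
Entry [::0;0;2;2;2;0;2;2;2;2;2;2;0;0;0] [::2;1;2;0;1;0] (Leaf 1 [::(1,[::0;1;2]);(1,[::3;4;5]);(1,[::1;6;7;8]);(1,[::4;6;7;8]);(1,[::0;3;6;7;8]);(1,[::2;5;6;7;8])]);
Entry [::0;0;2;2;2;0;2;2;2;2;2;2;0;0;0] [::2;2;2;1;1;0] (Leaf 3 [::(2,[::0;1;2]);(3,[::3;4;5]);(3,[::3;6;7;8]);(3,[::4;6;7;8]);(1,[::0;1;6;7;8]);(1,[::0;2;6;7;8]);(1,[::1;2;6;7;8]);(1,[::0;5;6;7;8]);(1,[::1;5;6;7;8]);(1,[::2;5;6;7;8])]);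
Entry [::0;0;2;2;2;0;2;2;2;2;2;2;0;0;0] [::2;2;2;2;1;1] (Leaf 3 [::(2,[::0;1;2]);(3,[::3;4;5]);(3,[::4;6;7;8]);(3,[::5;6;7;8]);(1,[::0;1;6;7;8]);(1,[::0;2;6;7;8]);(1,[::1;2;6;7;8]);(1,[::0;3;6;7;8]);(1,[::1;3;6;7;8]);(1,[::2;3;6;7;8])]);
Entry [::0;0;0;2;2;0;2;2;2;2;2;2;0;0;0] [::2;2;2;2;1;2] (Leaf 6 [::(3,[::0;1;2]);(3,[::0;3;7]);(2,[::1;2;7]);(6,[::3;4;5]);(6,[::4;6;7;8]);(3,[::1;3;6;7;8]);(1,[::0;5;6;7;8]);(3,[::2;5;6;7;8]);(1,[::0;1;3;6;8]);(1,[::0;2;3;6;8]);(1,[::0;1;2;3;6;8]);(1,[::0;1;5;6;7;8]);(1,[::0;2;5;6;7;8])]);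
Entry [::0;0;1;2;0;0;2;2;2;2;2;2;0;0;0] [::2;2;2;2;1;2] (Leaf 6 [::(3,[::0;1;2]);(3,[::0;5;7]);(2,[::1;2;7]);(6,[::3;4;5]);(6,[::4;6;7;8]);(1,[::0;3;6;7;8]);(3,[::1;3;6;7;8]);(3,[::2;5;6;7;8]);(1,[::0;1;5;6;8]);(1,[::0;2;5;6;8]);(1,[::0;1;2;5;6;8]);(1,[::0;1;3;6;7;8]);(1,[::0;2;3;6;7;8])]);
Entry [::0;0;1;2;1;0;0;2;2;2;2;2;0;0;0] [::2;2;2;2;1;2] (Leaf 6 [::(3,[::0;1;2]);(2,[::0;2;7]);(3,[::1;3;7]);(6,[::3;4;5]);(6,[::4;6;7;8]);(3,[::0;3;6;7;8]);(1,[::1;5;6;7;8]);(3,[::2;5;6;7;8]);(1,[::0;1;3;6;8]);(1,[::1;2;3;6;8]);(1,[::0;1;2;3;6;8]);(1,[::0;1;5;6;7;8]);(1,[::1;2;5;6;7;8])]);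
Entry [::0;0;1;2;1;0;1;2;0;2;2;2;0;0;0] [::2;2;2;2;1;2] (Leaf 12 [::(7,[::0;1;2]);(3,[::0;2;7]);(6,[::1;5;7]);(12,[::3;4;5]);(12,[::4;6;7;8]);(2,[::1;3;6;7;8]);(5,[::2;3;6;7;8]);(5,[::0;5;6;7;8]);(3,[::0;1;5;6;8]);(3,[::1;2;5;6;8]);(2,[::0;1;3;6;7;8]);(1,[::0;2;3;6;7;8]);(2,[::1;2;3;6;7;8]);(1,[::0;2;5;6;7;8])]);
Entry [::0;0;1;2;1;0;1;2;1;0;2;2;0;0;0] [::2;2;2;2;1;2] (Leaf 6 [::(3,[::0;1;2]);(2,[::0;1;7]);(3,[::2;3;7]);(6,[::3;4;5]);(6,[::4;6;7;8]);(3,[::1;3;6;7;8]);(3,[::0;5;6;7;8]);(1,[::2;5;6;7;8]);(1,[::0;2;3;6;8]);(1,[::1;2;3;6;8]);(1,[::0;1;2;3;6;8]);(1,[::0;2;5;6;7;8]);(1,[::1;2;5;6;7;8])]);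
Entry [::0;0;1;2;1;0;1;2;1;1;2;0;0;0;0] [::2;2;2;2;1;2] (Leaf 6 [::(3,[::0;1;2]);(2,[::0;1;7]);(3,[::2;5;7]);(6,[::3;4;5]);(6,[::4;6;7;8]);(3,[::1;3;6;7;8]);(1,[::2;3;6;7;8]);(3,[::0;5;6;7;8]);(1,[::0;2;5;6;8]);(1,[::1;2;5;6;8]);(1,[::0;1;2;5;6;8]);(1,[::0;2;3;6;7;8]);(1,[::1;2;3;6;7;8])]);
Entry [::0;0;1;0;1;0;1;0;1;1;2;1;0;0;0] [::2;2;2;2;1;2] (Contra 0 1 4);
Entry [::0;0;1;0;1;0;1;1;1;1;0;1;0;0;0] [::2;2;2;2;1;2] (Contra 0 2 4);
Entry [::0;0;1;0;1;0;1;1;1;1;1;1;0;0;0] [::3;2;2;3;1;2] (Leaf 4 [::(3,[::0;1;2]);(1,[::0;1;7]);(1,[::0;2;7]);(2,[::0;3;6]);(2,[::0;3;8]);(4,[::3;4;5]);(4,[::4;6;7;8]);(1,[::1;2;6;7;8]);(2,[::1;3;6;7;8]);(2,[::0;5;6;7;8]);(2,[::2;5;6;7;8])]);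
Entry [::0;0;1;0;1;0;1;1;1;1;1;1;0;0;0] [::3;2;2;4;1;2] (Leaf 8 [::(2,[::0;1;7]);(2,[::0;2;7]);(5,[::0;3;6]);(6,[::3;4;5]);(2,[::3;5;7]);(8,[::4;6;7;8]);(1,[::2;3;6;7;8]);(2,[::1;5;6;7;8]);(1,[::2;5;6;7;8]);(2,[::0;1;2;3;4]);(2,[::0;1;2;4;5]);(2,[::1;2;5;6;8]);(1,[::0;1;3;7;8]);(2,[::1;2;3;6;7;8]);(1,[::0;1;5;6;7;8]);(2,[::0;2;5;6;7;8])]);
Entry [::0;0;1;0;1;0;1;1;1;1;1;1;0;0;0] [::3;2;2;2;1;2] (BrF 3 (13,[::0;1;2;3;4;5;6;7;8]) (14,[::0;1;2;3;4;5;6;7;8]) (14,[::0;1;2;3;4;5;8;7;6]));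
Entry [::0;0;1;0;1;0;1;1;1;1;1;1;0;0;0] [::4;2;2;3;1;2] (Leaf 8 [::(2,[::0;1;7]);(2,[::0;2;7]);(5,[::0;3;6]);(6,[::3;4;5]);(2,[::3;5;7]);(8,[::4;6;7;8]);(1,[::2;3;6;7;8]);(2,[::1;5;6;7;8]);(1,[::2;5;6;7;8]);(2,[::0;1;2;3;4]);(2,[::0;1;2;4;5]);(2,[::1;2;5;6;8]);(1,[::0;1;3;7;8]);(2,[::1;2;3;6;7;8]);(1,[::0;1;5;6;7;8]);(2,[::0;2;5;6;7;8])]);
Entry [::0;0;1;0;1;0;1;1;1;1;1;1;0;0;0] [::4;2;2;4;1;2] (Leaf 8 [::(2,[::0;1;7]);(2,[::0;2;7]);(5,[::0;3;6]);(6,[::3;4;5]);(2,[::3;5;7]);(8,[::4;6;7;8]);(1,[::2;3;6;7;8]);(2,[::1;5;6;7;8]);(1,[::2;5;6;7;8]);(2,[::0;1;2;3;4]);(2,[::0;1;2;4;5]);(2,[::1;2;5;6;8]);(1,[::0;1;3;7;8]);(2,[::1;2;3;6;7;8]);(1,[::0;1;5;6;7;8]);(2,[::0;2;5;6;7;8])]);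
Entry [::0;0;1;0;1;0;1;1;1;1;1;1;0;0;0] [::4;3;2;5;1;2] (Leaf 8 [::(2,[::0;1;7]);(2,[::1;2;7]);(5,[::1;3;8]);(6,[::3;4;5]);(2,[::3;5;7]);(8,[::4;6;7;8]);(2,[::0;3;6;7;8]);(2,[::2;5;6;7;8]);(2,[::0;1;2;3;4]);(2,[::0;1;2;4;5]);(1,[::1;2;3;6;7]);(2,[::0;2;5;6;8]);(1,[::0;2;3;6;7;8]);(2,[::0;1;5;6;7;8]);(1,[::0;2;5;6;7;8]);(1,[::1;2;5;6;7;8])]);
Entry [::0;0;1;0;1;0;1;1;1;1;1;1;0;0;0] [::4;4;3;5;1;2] (Leaf 2 [::(1,[::0;1;2]);(1,[::0;1;8]);(1,[::0;2;7]);(1,[::1;2;7]);(2,[::2;3;8]);(2,[::3;4;5]);(2,[::4;6;7;8]);(1,[::0;5;6;7;8]);(1,[::1;5;6;7;8])]);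
Entry [::0;0;1;0;1;0;1;1;1;1;1;1;0;0;0] [::4;4;4;5;1;2] (Leaf 6 [::(4,[::0;1;2]);(1,[::0;1;7]);(1,[::0;1;8]);(1,[::0;2;7]);(1,[::0;2;8]);(1,[::1;2;7]);(1,[::1;2;8]);(6,[::3;4;5]);(6,[::4;6;7;8]);(4,[::0;3;6;7;8]);(2,[::1;3;6;7;8]);(2,[::1;5;6;7;8]);(4,[::2;5;6;7;8])]);
Entry [::0;0;1;0;1;0;1;1;1;1;1;1;0;0;0] [::4;4;5;5;1;2] (Leaf 2 [::(1,[::0;1;2]);(1,[::0;1;8]);(1,[::0;2;7]);(1,[::1;2;7]);(2,[::2;3;8]);(2,[::3;4;5]);(2,[::4;6;7;8]);(1,[::0;5;6;7;8]);(1,[::1;5;6;7;8])]);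
Entry [::0;0;1;0;1;0;1;1;1;1;1;1;0;0;0] [::4;4;2;5;1;2] (BrF 2 (19,[::0;1;2;3;4;5;6;7;8]) (20,[::0;1;2;3;4;5;6;7;8]) (21,[::0;1;2;3;4;5;6;7;8]));
Entry [::0;0;1;0;1;0;1;1;1;1;1;1;0;0;0] [::4;5;2;5;1;2] (Leaf 8 [::(2,[::0;1;7]);(2,[::1;2;7]);(5,[::1;3;8]);(6,[::3;4;5]);(2,[::3;5;7]);(8,[::4;6;7;8]);(2,[::0;3;6;7;8]);(2,[::2;5;6;7;8]);(2,[::0;1;2;3;4]);(2,[::0;1;2;4;5]);(1,[::1;2;3;6;7]);(2,[::0;2;5;6;8]);(1,[::0;2;3;6;7;8]);(2,[::0;1;5;6;7;8]);(1,[::0;2;5;6;7;8]);(1,[::1;2;5;6;7;8])]);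
Entry [::0;0;1;0;1;0;1;1;1;1;1;1;0;0;0] [::4;2;2;5;1;2] (BrF 1 (18,[::0;1;2;3;4;5;6;7;8]) (22,[::0;1;2;3;4;5;6;7;8]) (23,[::0;1;2;3;4;5;6;7;8]));
Entry [::0;0;1;0;1;0;1;1;1;1;1;1;0;0;0] [::4;2;2;2;1;2] (BrF 3 (16,[::0;1;2;3;4;5;6;7;8]) (17,[::0;1;2;3;4;5;6;7;8]) (24,[::0;1;2;3;4;5;6;7;8]));
Entry [::0;0;1;0;1;0;1;1;1;1;1;1;0;0;0] [::2;2;2;2;1;2] (BrF 0 (15,[::0;1;2;3;4;5;6;7;8]) (25,[::0;1;2;3;4;5;6;7;8]) (25,[::0;1;2;3;4;5;8;7;6]));
Entry [::0;0;1;0;1;0;1;1;1;1;2;1;0;0;0] [::2;2;2;2;1;2] (BrE 2 4 (12,[::0;1;2;3;4;5;6;7;8]) (26,[::0;1;2;3;4;5;6;7;8]));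
Entry [::0;0;1;0;1;0;1;2;1;1;2;1;0;0;0] [::2;2;2;2;1;2] (BrE 1 4 (11,[::0;1;2;3;4;5;6;7;8]) (27,[::0;1;2;3;4;5;6;7;8]));
Entry [::0;0;1;1;1;0;1;1;1;1;1;1;0;0;0] [::3;2;2;3;1;2] (Leaf 4 [::(3,[::0;1;2]);(1,[::0;1;7]);(1,[::0;2;7]);(2,[::0;3;6]);(2,[::0;3;8]);(4,[::3;4;5]);(4,[::4;6;7;8]);(1,[::1;2;6;7;8]);(2,[::1;3;6;7;8]);(2,[::0;5;6;7;8]);(2,[::2;5;6;7;8])]);
Entry [::0;0;1;1;1;0;1;1;1;1;1;1;0;0;0] [::3;2;2;4;1;2] (Leaf 8 [::(2,[::0;1;7]);(2,[::0;2;7]);(5,[::0;3;6]);(6,[::3;4;5]);(2,[::3;5;7]);(8,[::4;6;7;8]);(1,[::2;3;6;7;8]);(2,[::1;5;6;7;8]);(1,[::2;5;6;7;8]);(2,[::0;1;2;3;4]);(2,[::0;1;2;4;5]);(2,[::1;2;5;6;8]);(1,[::0;1;3;7;8]);(2,[::1;2;3;6;7;8]);(1,[::0;1;5;6;7;8]);(2,[::0;2;5;6;7;8])]);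
Entry [::0;0;1;1;1;0;1;1;1;1;1;1;0;0;0] [::3;2;2;2;1;2] (BrF 3 (29,[::0;1;2;3;4;5;6;7;8]) (30,[::0;1;2;3;4;5;6;7;8]) (30,[::0;1;2;3;4;5;8;7;6]));
Entry [::0;0;1;1;1;0;1;1;1;1;1;1;0;0;0] [::4;2;2;3;1;2] (Leaf 8 [::(2,[::0;1;7]);(2,[::0;2;7]);(5,[::0;3;6]);(6,[::3;4;5]);(2,[::3;5;7]);(8,[::4;6;7;8]);(1,[::2;3;6;7;8]);(2,[::1;5;6;7;8]);(1,[::2;5;6;7;8]);(2,[::0;1;2;3;4]);(2,[::0;1;2;4;5]);(2,[::1;2;5;6;8]);(1,[::0;1;3;7;8]);(2,[::1;2;3;6;7;8]);(1,[::0;1;5;6;7;8]);(2,[::0;2;5;6;7;8])]);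
Entry [::0;0;1;1;1;0;1;1;1;1;1;1;0;0;0] [::4;2;2;4;1;2] (Leaf 8 [::(2,[::0;1;7]);(2,[::0;2;7]);(5,[::0;3;6]);(6,[::3;4;5]);(2,[::3;5;7]);(8,[::4;6;7;8]);(1,[::2;3;6;7;8]);(2,[::1;5;6;7;8]);(1,[::2;5;6;7;8]);(2,[::0;1;2;3;4]);(2,[::0;1;2;4;5]);(2,[::1;2;5;6;8]);(1,[::0;1;3;7;8]);(2,[::1;2;3;6;7;8]);(1,[::0;1;5;6;7;8]);(2,[::0;2;5;6;7;8])]);
Entry [::0;0;1;1;1;0;1;1;1;1;1;1;0;0;0] [::4;3;2;5;1;2] (Leaf 8 [::(2,[::0;1;7]);(2,[::1;2;7]);(5,[::1;3;8]);(6,[::3;4;5]);(2,[::3;5;7]);(8,[::4;6;7;8]);(2,[::0;3;6;7;8]);(2,[::2;5;6;7;8]);(2,[::0;1;2;3;4]);(2,[::0;1;2;4;5]);(1,[::1;2;3;6;7]);(2,[::0;2;5;6;8]);(1,[::0;2;3;6;7;8]);(2,[::0;1;5;6;7;8]);(1,[::0;2;5;6;7;8]);(1,[::1;2;5;6;7;8])]);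
Entry [::0;0;1;1;1;0;1;1;1;1;1;1;0;0;0] [::4;4;3;5;1;2] (Leaf 2 [::(1,[::0;1;2]);(1,[::0;1;8]);(1,[::0;2;7]);(1,[::1;2;7]);(2,[::2;3;8]);(2,[::3;4;5]);(2,[::4;6;7;8]);(1,[::0;5;6;7;8]);(1,[::1;5;6;7;8])]);
Entry [::0;0;1;1;1;0;1;1;1;1;1;1;0;0;0] [::4;4;4;5;1;2] (Leaf 6 [::(4,[::0;1;2]);(1,[::0;1;7]);(1,[::0;1;8]);(1,[::0;2;7]);(1,[::0;2;8]);(1,[::1;2;7]);(1,[::1;2;8]);(6,[::3;4;5]);(6,[::4;6;7;8]);(4,[::0;3;6;7;8]);(2,[::1;3;6;7;8]);(2,[::1;5;6;7;8]);(4,[::2;5;6;7;8])]);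
Entry [::0;0;1;1;1;0;1;1;1;1;1;1;0;0;0] [::4;4;5;5;1;2] (Leaf 2 [::(1,[::0;1;2]);(1,[::0;1;8]);(1,[::0;2;7]);(1,[::1;2;7]);(2,[::2;3;8]);(2,[::3;4;5]);(2,[::4;6;7;8]);(1,[::0;5;6;7;8]);(1,[::1;5;6;7;8])]);
Entry [::0;0;1;1;1;0;1;1;1;1;1;1;0;0;0] [::4;4;2;5;1;2] (BrF 2 (35,[::0;1;2;3;4;5;6;7;8]) (36,[::0;1;2;3;4;5;6;7;8]) (37,[::0;1;2;3;4;5;6;7;8]));
Entry [::0;0;1;1;1;0;1;1;1;1;1;1;0;0;0] [::4;5;2;5;1;2] (Leaf 8 [::(2,[::0;1;7]);(2,[::1;2;7]);(5,[::1;3;8]);(6,[::3;4;5]);(2,[::3;5;7]);(8,[::4;6;7;8]);(2,[::0;3;6;7;8]);(2,[::2;5;6;7;8]);(2,[::0;1;2;3;4]);(2,[::0;1;2;4;5]);(1,[::1;2;3;6;7]);(2,[::0;2;5;6;8]);(1,[::0;2;3;6;7;8]);(2,[::0;1;5;6;7;8]);(1,[::0;2;5;6;7;8]);(1,[::1;2;5;6;7;8])]);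
Entry [::0;0;1;1;1;0;1;1;1;1;1;1;0;0;0] [::4;2;2;5;1;2] (BrF 1 (34,[::0;1;2;3;4;5;6;7;8]) (38,[::0;1;2;3;4;5;6;7;8]) (39,[::0;1;2;3;4;5;6;7;8]));
Entry [::0;0;1;1;1;0;1;1;1;1;1;1;0;0;0] [::4;2;2;2;1;2] (BrF 3 (32,[::0;1;2;3;4;5;6;7;8]) (33,[::0;1;2;3;4;5;6;7;8]) (40,[::0;1;2;3;4;5;6;7;8]));
Entry [::0;0;1;1;1;0;1;1;1;1;1;1;0;0;0] [::2;2;2;2;1;2] (BrF 0 (31,[::0;1;2;3;4;5;6;7;8]) (41,[::0;1;2;3;4;5;6;7;8]) (41,[::0;1;2;3;4;5;8;7;6]));
Entry [::0;0;1;1;1;0;1;1;1;1;2;1;0;0;0] [::2;2;2;2;1;2] (BrE 2 4 (26,[::2;0;1;3;4;5;6;7;8]) (42,[::0;1;2;3;4;5;6;7;8]));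
Entry [::0;0;1;1;1;0;1;2;1;1;2;1;0;0;0] [::2;2;2;2;1;2] (BrE 1 4 (27,[::1;0;2;3;4;5;6;7;8]) (43,[::0;1;2;3;4;5;6;7;8]));
Entry [::0;0;1;2;1;0;1;2;1;1;2;1;0;0;0] [::2;2;2;2;1;2] (BrE 0 4 (28,[::0;1;2;3;4;5;6;7;8]) (44,[::0;1;2;3;4;5;6;7;8]));
Entry [::0;0;1;2;1;0;1;2;1;1;2;2;0;0;0] [::2;2;2;2;1;2] (BrE 2 5 (10,[::0;1;2;3;4;5;6;7;8]) (45,[::0;1;2;3;4;5;6;7;8]));
Entry [::0;0;1;2;1;0;1;2;1;2;2;2;0;0;0] [::2;2;2;2;1;2] (BrE 2 3 (9,[::0;1;2;3;4;5;6;7;8]) (46,[::0;1;2;3;4;5;6;7;8]));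
Entry [::0;0;1;2;1;0;1;2;2;2;2;2;0;0;0] [::2;2;2;2;1;2] (BrE 1 5 (8,[::0;1;2;3;4;5;6;7;8]) (47,[::0;1;2;3;4;5;6;7;8]));
Entry [::0;0;1;2;1;0;2;2;2;2;2;2;0;0;0] [::2;2;2;2;1;2] (BrE 1 3 (7,[::0;1;2;3;4;5;6;7;8]) (48,[::0;1;2;3;4;5;6;7;8]));
Entry [::0;0;1;2;2;0;2;2;2;2;2;2;0;0;0] [::2;2;2;2;1;2] (BrE 0 5 (6,[::0;1;2;3;4;5;6;7;8]) (49,[::0;1;2;3;4;5;6;7;8]));
Entry [::0;0;2;2;2;0;2;2;2;2;2;2;0;0;0] [::2;2;2;2;1;2] (BrE 0 3 (5,[::0;1;2;3;4;5;6;7;8]) (50,[::0;1;2;3;4;5;6;7;8]));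
Entry [::0;0;2;2;2;0;2;2;2;2;2;2;0;0;0] [::2;2;2;2;1;0] (BrU 5 (4,[::0;1;2;3;4;5;6;7;8]) (51,[::0;1;2;3;4;5;6;7;8]));
Entry [::0;0;2;2;2;0;2;2;2;2;2;2;0;0;0] [::2;2;2;0;1;0] (BrU 3 (3,[::0;1;2;3;4;5;6;7;8]) (52,[::0;1;2;3;4;5;6;7;8]));
Entry [::0;0;2;2;2;0;2;2;2;2;2;2;0;0;0] [::2;0;2;0;1;0] (BrU 1 (2,[::0;1;2;3;4;5;6;7;8]) (53,[::0;1;2;3;4;5;6;7;8]));
Entry [::0;0;2;2;2;0;2;2;2;2;2;2;0;0;0] [::2;0;0;0;1;0] (BrU 2 (1,[::0;1;2;3;4;5;6;7;8]) (54,[::0;1;2;3;4;5;6;7;8]));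
Entry [::0;0;2;2;2;0;2;2;2;2;2;2;0;0;0] [::0;0;0;0;1;0] (BrU 0 (0,[::0;1;2;3;4;5;6;7;8]) (55,[::0;1;2;3;4;5;6;7;8]));
Entry [::0;0;2;2;2;0;2;2;2;2;2;2;0;0;0] [::1;2;0;1;2;0] (Leaf 1 [::(1,[::0;1;2]);(1,[::3;4;5]);(1,[::0;6;7;8]);(1,[::3;6;7;8]);(1,[::2;4;6;7;8]);(1,[::1;5;6;7;8])]);
Entry [::0;0;2;2;2;0;2;2;2;2;2;2;0;0;0] [::1;2;0;2;2;1] (Leaf 1 [::(1,[::0;1;2]);(1,[::3;4;5]);(1,[::0;6;7;8]);(1,[::5;6;7;8]);(1,[::2;3;6;7;8]);(1,[::1;4;6;7;8])]);
Entry [::0;0;2;2;2;0;2;2;2;2;2;2;0;0;0] [::1;2;0;2;2;0] (BrU 5 (58,[::0;1;2;3;4;5;6;7;8]) (52,[::3;4;5;1;0;2;6;7;8]));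
Entry [::0;0;2;2;2;0;2;2;2;2;2;2;0;0;0] [::1;2;0;0;2;0] (BrU 3 (57,[::0;1;2;3;4;5;6;7;8]) (59,[::0;1;2;3;4;5;6;7;8]));
Entry [::0;0;2;2;2;0;2;2;2;2;2;2;0;0;0] [::2;2;1;2;2;1] (Leaf 1 [::(1,[::0;1;2]);(1,[::3;4;5]);(1,[::2;6;7;8]);(1,[::5;6;7;8]);(1,[::1;3;6;7;8]);(1,[::0;4;6;7;8])]);
Entry [::0;0;2;2;2;0;2;2;2;2;2;2;0;0;0] [::2;2;0;2;2;1] (BrU 2 (61,[::0;1;2;3;4;5;6;7;8]) (51,[::0;1;2;3;5;4;6;7;8]));
Entry [::0;0;2;2;2;0;2;2;2;2;2;2;0;0;0] [::2;2;2;2;2;2] (Leaf 2 [::(1,[::0;1;7]);(1,[::0;2;7]);(1,[::1;2;7]);(1,[::3;4;7]);(1,[::3;5;7]);(1,[::4;5;7]);(1,[::0;1;3;4;6;8]);(1,[::0;2;3;5;6;8]);(1,[::1;2;4;5;6;8])]);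
Entry [::0;0;2;2;2;0;2;2;2;2;2;2;0;0;0] [::2;2;0;2;2;2] (BrU 2 (51,[::3;4;5;0;2;1;6;7;8]) (63,[::0;1;2;3;4;5;6;7;8]));
Entry [::0;0;2;2;2;0;2;2;2;2;2;2;0;0;0] [::2;2;0;2;2;0] (BrU 5 (62,[::0;1;2;3;4;5;6;7;8]) (64,[::0;1;2;3;4;5;6;7;8]));
Entry [::0;0;2;2;2;0;2;2;2;2;2;2;0;0;0] [::2;2;0;0;2;0] (BrU 3 (59,[::3;4;5;0;1;2;6;7;8]) (65,[::0;1;2;3;4;5;6;7;8]));
Entry [::0;0;2;2;2;0;2;2;2;2;2;2;0;0;0] [::0;2;0;0;2;0] (BrU 0 (60,[::0;1;2;3;4;5;6;7;8]) (66,[::0;1;2;3;4;5;6;7;8]));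
Entry [::0;0;2;2;2;0;2;2;2;2;2;2;0;0;0] [::0;0;0;0;2;0] (BrU 1 (55,[::4;3;5;0;1;2;6;7;8]) (67,[::0;1;2;3;4;5;6;7;8]));
Entry [::0;0;2;2;2;0;2;2;2;2;2;2;0;0;0] [::0;0;0;0;0;0] (BrU 4 (56,[::0;1;2;3;4;5;6;7;8]) (68,[::0;1;2;3;4;5;6;7;8]));
Entry [::0;0;2;2;2;0;2;2;2;2;2;2;1;1;1] [::1;0;0;0;1;0] (Leaf 1 [::(1,[::0;1;2]);(1,[::3;4;5]);(1,[::0;6;7;8]);(1,[::4;6;7;8]);(1,[::2;3;6;7;8]);(1,[::1;5;6;7;8])]);
Entry [::0;0;2;2;2;0;2;2;2;2;2;2;1;1;1] [::2;0;1;0;1;0] (Leaf 1 [::(1,[::0;1;2]);(1,[::3;4;5]);(1,[::2;6;7;8]);(1,[::4;6;7;8]);(1,[::1;3;6;7;8]);(1,[::0;5;6;7;8])]);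
Entry [::0;0;2;2;2;0;2;2;2;2;2;2;1;1;1] [::2;1;2;0;1;0] (Leaf 1 [::(1,[::0;1;2]);(1,[::3;4;5]);(1,[::1;6;7;8]);(1,[::4;6;7;8]);(1,[::0;3;6;7;8]);(1,[::2;5;6;7;8])]);
Entry [::0;0;2;2;2;0;2;2;2;2;2;2;1;1;1] [::2;2;2;1;1;0] (Leaf 3 [::(2,[::0;1;2]);(3,[::3;4;5]);(3,[::3;6;7;8]);(3,[::4;6;7;8]);(1,[::0;1;6;7;8]);(1,[::0;2;6;7;8]);(1,[::1;2;6;7;8]);(1,[::0;5;6;7;8]);(1,[::1;5;6;7;8]);(1,[::2;5;6;7;8])]);
Entry [::0;0;2;2;2;0;2;2;2;2;2;2;1;1;1] [::2;2;2;2;1;1] (Leaf 3 [::(2,[::0;1;2]);(3,[::3;4;5]);(3,[::4;6;7;8]);(3,[::5;6;7;8]);(1,[::0;1;6;7;8]);(1,[::0;2;6;7;8]);(1,[::1;2;6;7;8]);(1,[::0;3;6;7;8]);(1,[::1;3;6;7;8]);(1,[::2;3;6;7;8])]);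
Entry [::0;0;0;2;2;0;2;2;2;2;2;2;1;1;1] [::2;2;2;2;1;2] (Leaf 12 [::(7,[::0;1;2]);(6,[::0;3;7]);(3,[::1;2;7]);(12,[::3;4;5]);(12,[::4;6;7;8]);(5,[::1;3;6;7;8]);(2,[::0;5;6;7;8]);(5,[::2;5;6;7;8]);(3,[::0;1;3;6;8]);(3,[::0;2;3;6;8]);(1,[::1;2;3;6;7;8]);(2,[::0;1;5;6;7;8]);(2,[::0;2;5;6;7;8]);(1,[::1;2;5;6;7;8])]);
Entry [::0;0;1;2;0;0;2;2;2;2;2;2;1;1;1] [::2;2;2;2;1;2] (Leaf 6 [::(3,[::0;1;2]);(3,[::0;5;7]);(2,[::1;2;7]);(6,[::3;4;5]);(6,[::4;6;7;8]);(1,[::0;3;6;7;8]);(3,[::2;3;6;7;8]);(3,[::1;5;6;7;8]);(1,[::0;1;5;6;8]);(1,[::0;2;5;6;8]);(1,[::0;1;2;5;6;8]);(1,[::0;1;3;6;7;8]);(1,[::0;2;3;6;7;8])]);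
Entry [::0;0;1;2;1;0;2;2;2;2;2;2;1;1;1] [::2;2;2;2;1;2] (Contra 0 3 5);
Entry [::0;0;1;2;2;0;2;2;2;2;2;2;1;1;1] [::2;2;2;2;1;2] (BrE 0 5 (76,[::0;1;2;3;4;5;6;7;8]) (77,[::0;1;2;3;4;5;6;7;8]));
Entry [::0;0;2;2;2;0;2;2;2;2;2;2;1;1;1] [::2;2;2;2;1;2] (BrE 0 3 (75,[::0;1;2;3;4;5;6;7;8]) (78,[::0;1;2;3;4;5;6;7;8]));
Entry [::0;0;2;2;2;0;2;2;2;2;2;2;1;1;1] [::2;2;2;2;1;0] (BrU 5 (74,[::0;1;2;3;4;5;6;7;8]) (79,[::0;1;2;3;4;5;6;7;8]));
Entry [::0;0;2;2;2;0;2;2;2;2;2;2;1;1;1] [::2;2;2;0;1;0] (BrU 3 (73,[::0;1;2;3;4;5;6;7;8]) (80,[::0;1;2;3;4;5;6;7;8]));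
Entry [::0;0;2;2;2;0;2;2;2;2;2;2;1;1;1] [::2;0;2;0;1;0] (BrU 1 (72,[::0;1;2;3;4;5;6;7;8]) (81,[::0;1;2;3;4;5;6;7;8]));
Entry [::0;0;2;2;2;0;2;2;2;2;2;2;1;1;1] [::2;0;0;0;1;0] (BrU 2 (71,[::0;1;2;3;4;5;6;7;8]) (82,[::0;1;2;3;4;5;6;7;8]));
Entry [::0;0;2;2;2;0;2;2;2;2;2;2;1;1;1] [::0;0;0;0;1;0] (BrU 0 (70,[::0;1;2;3;4;5;6;7;8]) (83,[::0;1;2;3;4;5;6;7;8]));
Entry [::0;0;2;2;2;0;2;2;2;2;2;2;1;1;1] [::1;1;0;0;2;0] (Leaf 3 [::(3,[::0;1;2]);(2,[::3;4;5]);(3,[::0;6;7;8]);(3,[::1;6;7;8]);(1,[::2;3;6;7;8]);(1,[::2;4;6;7;8]);(1,[::3;4;6;7;8]);(1,[::2;5;6;7;8]);(1,[::3;5;6;7;8]);(1,[::4;5;6;7;8])]);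
Entry [::0;0;2;2;2;0;2;2;2;2;2;2;1;1;1] [::2;1;1;0;2;0] (Leaf 3 [::(3,[::0;1;2]);(2,[::3;4;5]);(3,[::1;6;7;8]);(3,[::2;6;7;8]);(1,[::0;3;6;7;8]);(1,[::0;4;6;7;8]);(1,[::3;4;6;7;8]);(1,[::0;5;6;7;8]);(1,[::3;5;6;7;8]);(1,[::4;5;6;7;8])]);
Entry [::0;0;2;2;2;0;2;2;2;2;2;2;1;1;1] [::2;1;2;1;2;0] (Leaf 1 [::(1,[::0;1;2]);(1,[::3;4;5]);(1,[::1;6;7;8]);(1,[::3;6;7;8]);(1,[::0;4;6;7;8]);(1,[::2;5;6;7;8])]);
Entry [::0;0;2;2;2;0;2;2;2;2;2;2;1;1;1] [::2;1;2;2;2;1] (Leaf 1 [::(1,[::0;1;2]);(1,[::3;4;5]);(1,[::1;6;7;8]);(1,[::5;6;7;8]);(1,[::2;3;6;7;8]);(1,[::0;4;6;7;8])]);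
Entry [::0;0;0;2;2;0;2;2;2;2;2;2;1;1;1] [::2;1;2;2;2;2] (Leaf 4 [::(3,[::0;1;2]);(2,[::0;3;7]);(2,[::3;4;5]);(3,[::1;6;7;8]);(1,[::0;4;6;7;8]);(1,[::0;5;6;7;8]);(1,[::1;2;4;5;7]);(1,[::0;2;3;4;6;8]);(1,[::0;1;3;5;6;8]);(1,[::2;3;4;6;7;8]);(1,[::2;3;5;6;7;8]);(1,[::2;4;5;6;7;8])]);
Entry [::0;0;1;0;2;0;2;2;2;2;2;2;1;1;1] [::2;1;2;2;2;2] (Leaf 4 [::(3,[::0;1;2]);(2,[::0;4;7]);(2,[::3;4;5]);(3,[::1;6;7;8]);(1,[::2;3;6;7;8]);(1,[::0;5;6;7;8]);(1,[::1;2;3;5;7]);(1,[::0;1;3;4;6;8]);(1,[::0;2;4;5;6;8]);(1,[::2;3;4;6;7;8]);(1,[::0;3;5;6;7;8]);(1,[::2;4;5;6;7;8])]);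
Entry [::0;0;1;1;2;0;2;2;2;2;2;2;1;1;1] [::2;1;2;2;2;2] (Contra 0 3 4);
Entry [::0;0;1;2;2;0;2;2;2;2;2;2;1;1;1] [::2;1;2;2;2;2] (BrE 0 4 (90,[::0;1;2;3;4;5;6;7;8]) (91,[::0;1;2;3;4;5;6;7;8]));
Entry [::0;0;2;2;2;0;2;2;2;2;2;2;1;1;1] [::2;1;2;2;2;2] (BrE 0 3 (89,[::0;1;2;3;4;5;6;7;8]) (92,[::0;1;2;3;4;5;6;7;8]));
Entry [::0;0;2;2;2;0;2;2;2;2;2;2;1;1;1] [::2;1;2;2;2;0] (BrU 5 (88,[::0;1;2;3;4;5;6;7;8]) (93,[::0;1;2;3;4;5;6;7;8]));
Entry [::0;0;2;2;2;0;2;2;2;2;2;2;1;1;1] [::2;1;2;0;2;0] (BrU 3 (87,[::0;1;2;3;4;5;6;7;8]) (94,[::0;1;2;3;4;5;6;7;8]));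
Entry [::0;0;2;2;2;0;2;2;2;2;2;2;1;1;1] [::2;1;0;0;2;0] (BrU 2 (86,[::0;1;2;3;4;5;6;7;8]) (95,[::0;1;2;3;4;5;6;7;8]));
Entry [::0;0;2;2;2;0;2;2;2;2;2;2;1;1;1] [::0;1;0;0;2;0] (BrU 0 (85,[::0;1;2;3;4;5;6;7;8]) (96,[::0;1;2;3;4;5;6;7;8]));
Entry [::0;0;2;2;2;0;2;2;2;2;2;2;1;1;1] [::2;2;0;0;2;1] (BrU 2 (87,[::0;2;1;5;4;3;6;7;8]) (80,[::0;1;2;4;5;3;6;7;8]));
Entry [::0;0;2;2;0;0;2;2;2;2;2;0;1;1;1] [::2;2;2;2;2;2] (Contra 0 2 5);
Entry [::0;0;0;2;1;0;2;2;2;2;2;0;1;1;1] [::2;2;2;2;2;2] (Leaf 2 [::(1,[::0;1;2]);(1,[::0;3;7]);(1,[::2;5;7]);(1,[::3;4;5]);(1,[::0;2;3;5;6;8]);(1,[::1;2;3;4;6;7;8]);(1,[::0;1;4;5;6;7;8])]);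
Entry [::0;0;1;2;1;0;2;2;2;2;2;0;1;1;1] [::2;2;2;2;2;2] (Contra 0 3 5);
Entry [::0;0;2;2;1;0;2;2;2;2;2;0;1;1;1] [::2;2;2;2;2;2] (BrE 0 3 (100,[::0;1;2;3;4;5;6;7;8]) (101,[::0;1;2;3;4;5;6;7;8]));
Entry [::0;0;2;2;2;0;2;2;2;2;2;0;1;1;1] [::2;2;2;2;2;2] (BrE 0 5 (99,[::0;1;2;3;4;5;6;7;8]) (102,[::0;1;2;3;4;5;6;7;8]));
Entry [::0;0;0;2;2;0;2;2;2;0;0;1;1;1;1] [::2;2;2;2;2;2] (Contra 0 2 3);
Entry [::0;0;1;0;2;0;2;2;2;0;0;1;1;1;1] [::2;2;2;2;2;2] (Contra 0 2 4);
Entry [::0;0;1;1;2;0;2;2;2;0;0;1;1;1;1] [::2;2;2;2;2;2] (Contra 0 3 4);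
Entry [::0;0;1;2;2;0;2;2;2;0;0;1;1;1;1] [::2;2;2;2;2;2] (BrE 0 4 (105,[::0;1;2;3;4;5;6;7;8]) (106,[::0;1;2;3;4;5;6;7;8]));
Entry [::0;0;2;2;2;0;2;2;2;0;0;1;1;1;1] [::2;2;2;2;2;2] (BrE 0 3 (104,[::0;1;2;3;4;5;6;7;8]) (107,[::0;1;2;3;4;5;6;7;8]));
Entry [::0;0;2;2;2;0;2;2;2;0;1;1;1;1;1] [::2;2;2;2;2;2] (Contra 2 4 5);
Entry [::0;0;2;2;2;0;2;2;2;0;2;1;1;1;1] [::2;2;2;2;2;2] (BrE 2 4 (108,[::0;1;2;3;4;5;6;7;8]) (109,[::0;1;2;3;4;5;6;7;8]));
Entry [::0;0;2;2;2;0;2;2;2;1;2;1;1;1;1] [::2;2;2;2;2;2] (Contra 2 3 5);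
Entry [::0;0;2;2;2;0;2;2;2;2;2;1;1;1;1] [::2;2;2;2;2;2] (BrE 2 3 (110,[::0;1;2;3;4;5;6;7;8]) (111,[::0;1;2;3;4;5;6;7;8]));
Entry [::0;0;2;2;2;0;2;2;2;2;2;2;1;1;1] [::2;2;2;2;2;2] (BrE 2 5 (103,[::0;1;2;3;4;5;6;7;8]) (112,[::0;1;2;3;4;5;6;7;8]));
Entry [::0;0;2;2;2;0;2;2;2;2;2;2;1;1;1] [::2;2;2;0;2;2] (BrU 3 (79,[::0;1;2;4;3;5;6;7;8]) (113,[::0;1;2;3;4;5;6;7;8]));
Entry [::0;0;2;2;2;0;2;2;2;2;2;2;1;1;1] [::2;2;0;0;2;2] (BrU 2 (94,[::0;2;1;4;5;3;6;7;8]) (114,[::0;1;2;3;4;5;6;7;8]));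
Entry [::0;0;2;2;2;0;2;2;2;2;2;2;1;1;1] [::2;2;0;0;2;0] (BrU 5 (98,[::0;1;2;3;4;5;6;7;8]) (115,[::0;1;2;3;4;5;6;7;8]));
Entry [::0;0;2;2;2;0;2;2;2;2;2;2;1;1;1] [::0;2;0;0;2;0] (BrU 0 (96,[::1;0;2;3;4;5;6;7;8]) (116,[::0;1;2;3;4;5;6;7;8]));
Entry [::0;0;2;2;2;0;2;2;2;2;2;2;1;1;1] [::0;0;0;0;2;0] (BrU 1 (97,[::0;1;2;3;4;5;6;7;8]) (117,[::0;1;2;3;4;5;6;7;8]));
Entry [::0;0;2;2;2;0;2;2;2;2;2;2;1;1;1] [::0;0;0;0;0;0] (BrU 4 (84,[::0;1;2;3;4;5;6;7;8]) (118,[::0;1;2;3;4;5;6;7;8]));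
Entry [::1;1;2;2;2;1;2;2;2;2;2;2;1;1;1] [::1;0;0;0;1;0] (Leaf 1 [::(1,[::0;1;2]);(1,[::3;4;5]);(1,[::0;6;7;8]);(1,[::4;6;7;8]);(1,[::2;3;6;7;8]);(1,[::1;5;6;7;8])]);
Entry [::1;1;2;2;2;1;2;2;2;2;2;2;1;1;1] [::2;1;0;0;1;0] (Leaf 1 [::(1,[::0;1;2]);(1,[::3;4;5]);(1,[::1;6;7;8]);(1,[::4;6;7;8]);(1,[::2;3;6;7;8]);(1,[::0;5;6;7;8])]);
Entry [::1;1;2;2;2;1;2;2;2;2;2;2;1;1;1] [::2;2;1;0;1;0] (Leaf 1 [::(1,[::0;1;2]);(1,[::3;4;5]);(1,[::2;6;7;8]);(1,[::4;6;7;8]);(1,[::1;3;6;7;8]);(1,[::0;5;6;7;8])]);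
Entry [::1;1;2;2;2;1;2;2;2;2;2;2;1;1;1] [::2;2;2;1;1;0] (Leaf 3 [::(2,[::0;1;2]);(3,[::3;4;5]);(3,[::3;6;7;8]);(3,[::4;6;7;8]);(1,[::0;1;6;7;8]);(1,[::0;2;6;7;8]);(1,[::1;2;6;7;8]);(1,[::0;5;6;7;8]);(1,[::1;5;6;7;8]);(1,[::2;5;6;7;8])]);
Entry [::1;1;2;2;2;1;2;2;2;2;2;2;1;1;1] [::2;2;2;2;1;1] (Leaf 3 [::(2,[::0;1;2]);(3,[::3;4;5]);(3,[::4;6;7;8]);(3,[::5;6;7;8]);(1,[::0;1;6;7;8]);(1,[::0;2;6;7;8]);(1,[::1;2;6;7;8]);(1,[::0;3;6;7;8]);(1,[::1;3;6;7;8]);(1,[::2;3;6;7;8])]);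
Entry [::1;1;0;2;2;1;2;2;2;2;2;2;1;1;1] [::2;2;2;2;1;2] (Leaf 4 [::(2,[::0;1;2]);(2,[::0;3;7]);(3,[::3;4;5]);(3,[::4;6;7;8]);(1,[::2;3;6;7;8]);(1,[::1;5;6;7;8]);(1,[::1;2;4;5;7]);(1,[::0;2;3;4;6;8]);(1,[::0;1;3;5;6;8]);(1,[::1;2;3;6;7;8]);(1,[::0;1;5;6;7;8]);(1,[::0;2;5;6;7;8])]);
Entry [::1;1;1;2;0;1;2;2;2;2;2;2;1;1;1] [::2;2;2;2;1;2] (Leaf 4 [::(2,[::0;1;2]);(2,[::0;5;7]);(3,[::3;4;5]);(3,[::4;6;7;8]);(1,[::1;5;6;7;8]);(1,[::2;5;6;7;8]);(1,[::1;2;3;4;7]);(1,[::0;2;3;5;6;8]);(1,[::0;1;4;5;6;8]);(1,[::0;1;3;6;7;8]);(1,[::0;2;3;6;7;8]);(1,[::1;2;3;6;7;8])]);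
Entry [::1;1;1;2;1;1;2;2;2;2;2;2;1;1;1] [::2;2;2;2;1;2] (Contra 0 3 5);
Entry [::1;1;1;2;2;1;2;2;2;2;2;2;1;1;1] [::2;2;2;2;1;2] (BrE 0 5 (126,[::0;1;2;3;4;5;6;7;8]) (127,[::0;1;2;3;4;5;6;7;8]));
Entry [::1;1;2;2;2;1;2;2;2;2;2;2;1;1;1] [::2;2;2;2;1;2] (BrE 0 3 (125,[::0;1;2;3;4;5;6;7;8]) (128,[::0;1;2;3;4;5;6;7;8]));
Entry [::1;1;2;2;2;1;2;2;2;2;2;2;1;1;1] [::2;2;2;2;1;0] (BrU 5 (124,[::0;1;2;3;4;5;6;7;8]) (129,[::0;1;2;3;4;5;6;7;8]));
Entry [::1;1;2;2;2;1;2;2;2;2;2;2;1;1;1] [::2;2;2;0;1;0] (BrU 3 (123,[::0;1;2;3;4;5;6;7;8]) (130,[::0;1;2;3;4;5;6;7;8]));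
Entry [::1;1;2;2;2;1;2;2;2;2;2;2;1;1;1] [::2;2;0;0;1;0] (BrU 2 (122,[::0;1;2;3;4;5;6;7;8]) (131,[::0;1;2;3;4;5;6;7;8]));
Entry [::1;1;2;2;2;1;2;2;2;2;2;2;1;1;1] [::2;0;0;0;1;0] (BrU 1 (121,[::0;1;2;3;4;5;6;7;8]) (132,[::0;1;2;3;4;5;6;7;8]));
Entry [::1;1;2;2;2;1;2;2;2;2;2;2;1;1;1] [::0;0;0;0;1;0] (BrU 0 (120,[::0;1;2;3;4;5;6;7;8]) (133,[::0;1;2;3;4;5;6;7;8]));
Entry [::1;1;2;2;2;1;2;2;2;2;2;2;1;1;1] [::1;2;1;0;2;0] (Leaf 3 [::(3,[::0;1;2]);(2,[::3;4;5]);(3,[::0;6;7;8]);(3,[::2;6;7;8]);(1,[::1;3;6;7;8]);(1,[::1;4;6;7;8]);(1,[::3;4;6;7;8]);(1,[::1;5;6;7;8]);(1,[::3;5;6;7;8]);(1,[::4;5;6;7;8])]);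
Entry [::1;1;2;2;2;1;2;2;2;2;2;2;1;1;1] [::1;2;2;1;2;0] (Leaf 1 [::(1,[::0;1;2]);(1,[::3;4;5]);(1,[::0;6;7;8]);(1,[::3;6;7;8]);(1,[::2;4;6;7;8]);(1,[::1;5;6;7;8])]);
Entry [::1;1;2;2;2;1;2;2;2;2;2;2;1;1;1] [::1;2;2;2;2;1] (Leaf 1 [::(1,[::0;1;2]);(1,[::3;4;5]);(1,[::0;6;7;8]);(1,[::5;6;7;8]);(1,[::2;3;6;7;8]);(1,[::1;4;6;7;8])]);
Entry [::1;1;2;2;2;1;2;2;2;2;2;2;1;1;1] [::1;2;2;2;2;0] (BrU 5 (137,[::0;1;2;3;4;5;6;7;8]) (129,[::3;4;5;1;0;2;6;7;8]));
Entry [::1;1;2;2;2;1;2;2;2;2;2;2;1;1;1] [::1;2;2;0;2;0] (BrU 3 (136,[::0;1;2;3;4;5;6;7;8]) (138,[::0;1;2;3;4;5;6;7;8]));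
Entry [::1;1;2;2;2;1;2;2;2;2;2;2;1;1;1] [::1;2;0;0;2;0] (BrU 2 (135,[::0;1;2;3;4;5;6;7;8]) (139,[::0;1;2;3;4;5;6;7;8]));
Entry [::1;1;2;2;2;1;2;2;2;2;2;2;1;1;1] [::2;2;0;0;2;1] (BrU 2 (136,[::2;0;1;5;4;3;6;7;8]) (130,[::0;1;2;4;5;3;6;7;8]));
Entry [::1;1;2;0;2;1;2;2;2;0;2;2;1;1;1] [::2;2;2;2;2;2] (Leaf 2 [::(1,[::0;1;2]);(1,[::0;4;7]);(1,[::2;3;7]);(1,[::3;4;5]);(1,[::0;2;3;4;6;8]);(1,[::0;1;3;5;6;7;8]);(1,[::1;2;4;5;6;7;8])]);
Entry [::1;1;2;1;0;1;2;2;2;0;2;2;1;1;1] [::2;2;2;2;2;2] (Leaf 2 [::(1,[::0;1;2]);(1,[::0;5;7]);(1,[::2;3;7]);(1,[::3;4;5]);(1,[::0;2;3;5;6;8]);(1,[::0;1;3;4;6;7;8]);(1,[::1;2;4;5;6;7;8])]);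
Entry [::1;1;2;1;1;1;2;2;2;0;2;2;1;1;1] [::2;2;2;2;2;2] (Contra 0 4 5);
Entry [::1;1;2;1;2;1;2;2;2;0;2;2;1;1;1] [::2;2;2;2;2;2] (BrE 0 5 (143,[::0;1;2;3;4;5;6;7;8]) (144,[::0;1;2;3;4;5;6;7;8]));
Entry [::1;1;2;2;2;1;2;2;2;0;2;2;1;1;1] [::2;2;2;2;2;2] (BrE 0 4 (142,[::0;1;2;3;4;5;6;7;8]) (145,[::0;1;2;3;4;5;6;7;8]));
Entry [::1;1;0;2;2;1;2;2;2;1;0;2;1;1;1] [::2;2;2;2;2;2] (Leaf 2 [::(1,[::0;1;2]);(1,[::0;3;7]);(1,[::2;4;7]);(1,[::3;4;5]);(1,[::0;2;3;4;6;8]);(1,[::1;2;3;5;6;7;8]);(1,[::0;1;4;5;6;7;8])]);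
Entry [::1;1;0;2;2;1;2;2;2;1;1;2;1;1;1] [::2;2;2;2;2;2] (Contra 2 3 4);
Entry [::1;1;0;2;2;1;2;2;2;1;2;2;1;1;1] [::2;2;2;2;2;2] (BrE 2 4 (147,[::0;1;2;3;4;5;6;7;8]) (148,[::0;1;2;3;4;5;6;7;8]));
Entry [::1;1;1;2;2;1;2;2;2;1;2;2;1;1;1] [::2;2;2;2;2;2] (Contra 0 2 3);
Entry [::1;1;2;2;2;1;2;2;2;1;2;2;1;1;1] [::2;2;2;2;2;2] (BrE 0 3 (149,[::0;1;2;3;4;5;6;7;8]) (150,[::0;1;2;3;4;5;6;7;8]));
Entry [::1;1;2;2;2;1;2;2;2;2;2;2;1;1;1] [::2;2;2;2;2;2] (BrE 2 3 (146,[::0;1;2;3;4;5;6;7;8]) (151,[::0;1;2;3;4;5;6;7;8]));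
Entry [::1;1;2;2;2;1;2;2;2;2;2;2;1;1;1] [::2;2;0;2;2;2] (BrU 2 (129,[::3;4;5;0;2;1;6;7;8]) (152,[::0;1;2;3;4;5;6;7;8]));
Entry [::1;1;2;2;2;1;2;2;2;2;2;2;1;1;1] [::2;2;0;0;2;2] (BrU 3 (138,[::3;4;5;0;1;2;6;7;8]) (153,[::0;1;2;3;4;5;6;7;8]));
Entry [::1;1;2;2;2;1;2;2;2;2;2;2;1;1;1] [::2;2;0;0;2;0] (BrU 5 (141,[::0;1;2;3;4;5;6;7;8]) (154,[::0;1;2;3;4;5;6;7;8]));
Entry [::1;1;2;2;2;1;2;2;2;2;2;2;1;1;1] [::0;2;0;0;2;0] (BrU 0 (140,[::0;1;2;3;4;5;6;7;8]) (155,[::0;1;2;3;4;5;6;7;8]));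
Entry [::1;1;2;2;2;1;2;2;2;2;2;2;1;1;1] [::0;0;0;0;2;0] (BrU 1 (133,[::4;3;5;0;1;2;6;7;8]) (156,[::0;1;2;3;4;5;6;7;8]));
Entry [::1;1;2;2;2;1;2;2;2;2;2;2;1;1;1] [::0;0;0;0;0;0] (BrU 4 (134,[::0;1;2;3;4;5;6;7;8]) (157,[::0;1;2;3;4;5;6;7;8]));
Entry [::0;0;2;2;2;0;2;2;2;2;2;2;0;0;0] [::0;0;0;0;0;0] (Same (69,[::0;1;2;3;4;5;6;7;8]));
Entry [::0;0;2;2;2;0;2;2;2;2;2;2;1;1;1] [::0;0;0;0;0;0] (Same (119,[::0;1;2;3;4;5;6;7;8]));
Entry [::1;1;2;2;2;1;2;2;2;2;2;2;0;0;0] [::0;0;0;0;0;0] (Same (119,[::3;4;5;0;1;2;6;7;8]));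
Entry [::1;1;2;2;2;1;2;2;2;2;2;2;1;1;1] [::0;0;0;0;0;0] (Same (158,[::0;1;2;3;4;5;6;7;8]))]%N.
(** The two triangles 015 and 345 share vertex 5, and vertex 2 lies in neither. Again the last four
    entries are the roots. *)
Definition table_S : seq entry := [::
Entry [::0;2;2;2;0;2;2;2;0;2;2;2;0;0;0] [::1;0;0;0;0;0] (Leaf 4 [::(3,[::0;1;5]);(2,[::3;4;5]);(4,[::0;6;7;8]);(1,[::1;3;6;7;8]);(1,[::3;5;6;7;8]);(1,[::4;5;6;7;8]);(1,[::0;1;2;3;4]);(1,[::1;2;4;6;7;8]);(1,[::2;3;5;6;7;8]);(1,[::1;2;3;4;6;7;8]);(1,[::1;2;4;5;6;7;8])]);
Entry [::0;2;2;2;0;2;2;2;0;2;2;2;0;0;0] [::2;0;0;0;0;1] (Leaf 2 [::(1,[::0;1;5]);(1,[::3;4;5]);(2,[::5;6;7;8]);(1,[::1;3;6;7;8]);(1,[::0;4;6;7;8]);(1,[::0;1;2;3;4;5]);(1,[::0;2;3;6;7;8]);(1,[::1;2;4;6;7;8])]);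
Entry [::0;2;2;2;0;2;2;2;0;2;2;2;0;0;0] [::2;0;0;1;0;2] (Leaf 8 [::(3,[::0;1;5]);(6,[::3;4;5]);(7,[::3;6;7;8]);(2,[::0;4;6;7;8]);(1,[::0;5;6;7;8]);(3,[::1;5;6;7;8]);(2,[::0;1;2;3;4]);(1,[::0;1;2;3;5]);(2,[::1;2;4;6;7;8]);(1,[::0;2;5;6;7;8]);(2,[::0;1;2;4;6;7;8]);(1,[::1;2;3;5;6;7;8]);(2,[::0;2;4;5;6;7;8])]);
Entry [::0;2;2;2;0;2;2;2;0;2;2;2;0;0;0] [::2;1;0;2;0;2] (Leaf 8 [::(6,[::0;1;5]);(1,[::0;5;7]);(3,[::3;4;5]);(1,[::3;5;7]);(7,[::1;6;7;8]);(2,[::0;3;6;7;8]);(2,[::0;4;6;7;8]);(1,[::4;5;6;7;8]);(2,[::0;1;2;3;4]);(1,[::1;2;3;4;5]);(1,[::0;3;5;6;8]);(1,[::0;2;3;6;7;8]);(1,[::2;3;5;6;7;8]);(3,[::2;4;5;6;7;8]);(2,[::0;2;3;4;6;7;8]);(1,[::1;2;3;5;6;7;8])]);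
Entry [::0;2;2;2;0;2;2;2;0;2;2;2;0;0;0] [::2;2;0;2;1;2] (Leaf 17 [::(5,[::0;1;5]);(2,[::0;5;7]);(2,[::1;5;7]);(14,[::3;4;5]);(2,[::3;5;7]);(17,[::4;6;7;8]);(2,[::0;3;6;7;8]);(3,[::0;5;6;7;8]);(5,[::1;5;6;7;8]);(3,[::0;1;2;3;4]);(3,[::0;1;2;4;5]);(1,[::0;1;3;6;8]);(3,[::0;2;3;6;7;8]);(6,[::1;2;3;6;7;8]);(3,[::0;2;5;6;7;8]);(1,[::0;1;2;3;5;6;8]);(4,[::0;1;2;3;6;7;8])]);
Entry [::0;2;0;2;0;2;2;2;0;2;2;2;0;0;0] [::2;2;1;2;2;2] (Contra 0 3 5);
Entry [::0;2;1;0;0;2;2;2;0;2;2;2;0;0;0] [::2;2;1;2;2;2] (Contra 0 4 5);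
Entry [::0;2;1;1;0;2;0;2;0;2;2;2;0;0;0] [::2;2;1;2;2;2] (Contra 1 3 5);
Entry [::0;2;1;1;0;2;1;0;0;2;2;2;0;0;0] [::2;2;1;2;2;2] (Contra 1 4 5);
Entry [::0;0;1;1;0;0;1;1;0;2;2;2;0;0;0] [::2;2;1;2;2;2] (Contra 0 1 2);
Entry [::0;0;1;1;0;1;1;1;0;0;0;2;0;0;0] [::2;2;1;2;2;2] (Contra 2 3 4);
Entry [::0;0;1;1;0;1;1;1;0;0;1;2;0;0;0] [::2;2;1;2;2;2] (Contra 1 2 4);
Entry [::0;0;1;1;0;1;1;1;0;0;2;2;0;0;0] [::2;2;1;2;2;2] (BrE 2 4 (10,[::0;1;2;3;4;5;6;7;8]) (11,[::0;1;2;3;4;5;6;7;8]));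
Entry [::0;0;1;1;0;1;1;1;0;1;2;2;0;0;0] [::2;2;1;2;2;2] (Contra 1 2 3);
Entry [::0;0;1;1;0;1;1;1;0;2;2;2;0;0;0] [::2;2;1;2;2;2] (BrE 2 3 (12,[::0;1;2;3;4;5;6;7;8]) (13,[::0;1;2;3;4;5;6;7;8]));
Entry [::0;0;1;1;0;2;1;1;0;2;2;2;0;0;0] [::2;2;1;2;2;2] (BrE 1 2 (9,[::0;1;2;3;4;5;6;7;8]) (14,[::0;1;2;3;4;5;6;7;8]));
Entry [::0;1;1;1;0;2;1;1;0;0;0;2;0;0;0] [::2;2;1;2;2;2] (Contra 2 3 4);
Entry [::0;1;1;1;0;2;1;1;0;0;2;2;0;0;0] [::2;2;1;2;2;2] (BrE 2 4 (16,[::0;1;2;3;4;5;6;7;8]) (13,[::3;4;2;0;1;5;6;7;8]));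
Entry [::0;1;1;1;0;2;1;1;0;1;2;2;0;0;0] [::2;2;1;2;2;2] (Contra 0 2 3);
Entry [::0;1;1;1;0;2;1;1;0;2;2;2;0;0;0] [::2;2;1;2;2;2] (BrE 2 3 (17,[::0;1;2;3;4;5;6;7;8]) (18,[::0;1;2;3;4;5;6;7;8]));
Entry [::0;2;1;1;0;2;1;1;0;2;2;2;0;0;0] [::2;2;1;2;2;2] (BrE 0 2 (15,[::0;1;2;3;4;5;6;7;8]) (19,[::0;1;2;3;4;5;6;7;8]));
Entry [::0;2;1;1;0;2;1;2;0;2;2;2;0;0;0] [::2;2;1;2;2;2] (BrE 1 4 (8,[::0;1;2;3;4;5;6;7;8]) (20,[::0;1;2;3;4;5;6;7;8]));
Entry [::0;2;1;1;0;2;2;2;0;2;2;2;0;0;0] [::2;2;1;2;2;2] (BrE 1 3 (7,[::0;1;2;3;4;5;6;7;8]) (21,[::0;1;2;3;4;5;6;7;8]));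
Entry [::0;2;1;2;0;2;2;2;0;2;2;2;0;0;0] [::2;2;1;2;2;2] (BrE 0 4 (6,[::0;1;2;3;4;5;6;7;8]) (22,[::0;1;2;3;4;5;6;7;8]));
Entry [::0;2;2;2;0;2;2;2;0;2;2;2;0;0;0] [::2;2;1;2;2;2] (BrE 0 3 (5,[::0;1;2;3;4;5;6;7;8]) (23,[::0;1;2;3;4;5;6;7;8]));
Entry [::0;2;0;2;0;2;2;2;0;2;2;2;0;0;0] [::2;2;2;2;2;2] (Contra 0 3 5);
Entry [::0;2;1;0;0;2;2;2;0;2;2;2;0;0;0] [::2;2;2;2;2;2] (Contra 0 4 5);
Entry [::0;2;1;1;0;2;0;2;0;2;2;2;0;0;0] [::2;2;2;2;2;2] (Contra 1 3 5);
Entry [::0;2;1;1;0;2;1;0;0;2;2;2;0;0;0] [::2;2;2;2;2;2] (Contra 1 4 5);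
Entry [::0;0;1;1;0;2;1;1;0;2;2;2;0;0;0] [::2;2;2;2;2;2] (Leaf 6 [::(2,[::0;1;5]);(2,[::0;1;7]);(4,[::0;2;7]);(2,[::1;5;7]);(1,[::3;4;5]);(3,[::3;4;7]);(2,[::3;5;7]);(2,[::4;5;7]);(3,[::0;3;5;6;8]);(1,[::0;4;5;6;8]);(2,[::1;2;4;5;6;8]);(1,[::1;2;3;6;7;8]);(1,[::1;2;4;6;7;8]);(2,[::0;1;2;3;4;6;8])]);
Entry [::0;1;1;1;0;2;1;1;0;0;2;2;0;0;0] [::2;2;2;2;2;2] (Leaf 6 [::(1,[::0;1;5]);(3,[::0;1;7]);(2,[::0;5;7]);(2,[::1;5;7]);(4,[::2;3;7]);(2,[::3;4;5]);(2,[::3;4;7]);(2,[::4;5;7]);(3,[::0;3;5;6;8]);(1,[::1;3;5;6;8]);(2,[::1;2;4;5;6;8]);(1,[::0;2;4;6;7;8]);(1,[::1;2;4;6;7;8]);(2,[::0;1;2;3;4;6;8])]);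
Entry [::0;1;1;1;0;2;1;1;0;1;2;2;0;0;0] [::2;2;2;2;2;2] (Contra 0 2 3);
Entry [::0;1;1;1;0;2;1;1;0;2;2;2;0;0;0] [::2;2;2;2;2;2] (BrE 2 3 (30,[::0;1;2;3;4;5;6;7;8]) (31,[::0;1;2;3;4;5;6;7;8]));
Entry [::0;2;1;1;0;2;1;1;0;2;2;2;0;0;0] [::2;2;2;2;2;2] (BrE 0 2 (29,[::0;1;2;3;4;5;6;7;8]) (32,[::0;1;2;3;4;5;6;7;8]));
Entry [::0;2;1;1;0;2;1;2;0;2;2;2;0;0;0] [::2;2;2;2;2;2] (BrE 1 4 (28,[::0;1;2;3;4;5;6;7;8]) (33,[::0;1;2;3;4;5;6;7;8]));
Entry [::0;2;1;1;0;2;2;2;0;2;2;2;0;0;0] [::2;2;2;2;2;2] (BrE 1 3 (27,[::0;1;2;3;4;5;6;7;8]) (34,[::0;1;2;3;4;5;6;7;8]));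
Entry [::0;2;1;2;0;2;2;2;0;2;2;2;0;0;0] [::2;2;2;2;2;2] (BrE 0 4 (26,[::0;1;2;3;4;5;6;7;8]) (35,[::0;1;2;3;4;5;6;7;8]));
Entry [::0;2;2;2;0;2;2;2;0;2;2;2;0;0;0] [::2;2;2;2;2;2] (BrE 0 3 (25,[::0;1;2;3;4;5;6;7;8]) (36,[::0;1;2;3;4;5;6;7;8]));
Entry [::0;2;2;2;0;2;2;2;0;2;2;2;0;0;0] [::2;2;0;2;2;2] (BrU 2 (24,[::0;1;2;3;4;5;6;7;8]) (37,[::0;1;2;3;4;5;6;7;8]));
Entry [::0;2;2;2;0;2;2;2;0;2;2;2;0;0;0] [::2;2;0;2;0;2] (BrU 4 (4,[::0;1;2;3;4;5;6;7;8]) (38,[::0;1;2;3;4;5;6;7;8]));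
Entry [::0;2;2;2;0;2;2;2;0;2;2;2;0;0;0] [::2;0;0;2;0;2] (BrU 1 (3,[::0;1;2;3;4;5;6;7;8]) (39,[::0;1;2;3;4;5;6;7;8]));
Entry [::0;2;2;2;0;2;2;2;0;2;2;2;0;0;0] [::2;0;0;0;0;2] (BrU 3 (2,[::0;1;2;3;4;5;6;7;8]) (40,[::0;1;2;3;4;5;6;7;8]));
Entry [::0;2;2;2;0;2;2;2;0;2;2;2;0;0;0] [::2;0;0;0;0;0] (BrU 5 (1,[::0;1;2;3;4;5;6;7;8]) (41,[::0;1;2;3;4;5;6;7;8]));
Entry [::0;2;2;2;0;2;2;2;0;2;2;2;0;0;0] [::0;0;0;0;0;0] (BrU 0 (0,[::0;1;2;3;4;5;6;7;8]) (42,[::0;1;2;3;4;5;6;7;8]));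
Entry [::0;2;2;2;0;2;2;2;0;2;2;2;1;1;1] [::1;0;0;0;0;0] (Leaf 4 [::(3,[::0;1;5]);(2,[::3;4;5]);(4,[::0;6;7;8]);(1,[::1;3;6;7;8]);(1,[::3;5;6;7;8]);(1,[::4;5;6;7;8]);(1,[::0;1;2;3;4]);(1,[::1;2;4;6;7;8]);(1,[::2;3;5;6;7;8]);(1,[::1;2;3;4;6;7;8]);(1,[::1;2;4;5;6;7;8])]);
Entry [::0;2;2;2;0;2;2;2;0;2;2;2;1;1;1] [::2;0;0;0;0;1] (Leaf 2 [::(1,[::0;1;5]);(1,[::3;4;5]);(2,[::5;6;7;8]);(1,[::1;3;6;7;8]);(1,[::0;4;6;7;8]);(1,[::0;1;2;3;4;5]);(1,[::0;2;3;6;7;8]);(1,[::1;2;4;6;7;8])]);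
Entry [::0;2;2;2;0;2;2;2;0;2;2;2;1;1;1] [::2;0;0;1;0;2] (Leaf 8 [::(3,[::0;1;5]);(6,[::3;4;5]);(7,[::3;6;7;8]);(2,[::0;4;6;7;8]);(1,[::0;5;6;7;8]);(3,[::1;5;6;7;8]);(2,[::0;1;2;3;4]);(1,[::0;1;2;3;5]);(2,[::1;2;4;6;7;8]);(1,[::0;2;5;6;7;8]);(2,[::0;1;2;4;6;7;8]);(1,[::1;2;3;5;6;7;8]);(2,[::0;2;4;5;6;7;8])]);
Entry [::0;2;2;2;0;2;2;2;0;2;2;2;1;1;1] [::2;0;0;2;1;2] (Leaf 8 [::(3,[::0;1;5]);(6,[::3;4;5]);(7,[::4;6;7;8]);(2,[::0;3;6;7;8]);(2,[::1;3;6;7;8]);(1,[::0;5;6;7;8]);(1,[::1;5;6;7;8]);(2,[::0;1;2;3;4]);(1,[::0;1;2;4;5]);(3,[::0;2;5;6;7;8]);(2,[::0;1;2;3;6;7;8]);(2,[::1;2;3;5;6;7;8]);(1,[::1;2;4;5;6;7;8])]);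
Entry [::0;2;2;2;0;2;2;2;0;2;2;2;1;1;1] [::2;1;0;2;2;2] (Leaf 8 [::(6,[::0;1;5]);(3,[::3;4;5]);(7,[::1;6;7;8]);(2,[::0;3;6;7;8]);(1,[::3;5;6;7;8]);(3,[::4;5;6;7;8]);(2,[::0;1;2;3;4]);(1,[::1;2;3;4;5]);(2,[::0;2;4;6;7;8]);(1,[::2;3;5;6;7;8]);(2,[::0;2;3;4;6;7;8]);(2,[::0;2;3;5;6;7;8]);(1,[::1;2;4;5;6;7;8])]);
Entry [::0;2;0;2;0;2;0;2;0;2;2;2;1;1;1] [::2;2;1;2;2;2] (Contra 0 1 3);
Entry [::0;2;0;2;0;2;1;0;0;2;2;2;1;1;1] [::2;2;1;2;2;2] (Leaf 2 [::(1,[::0;1;5]);(1,[::0;3;7]);(1,[::1;4;7]);(1,[::3;4;5]);(1,[::0;1;3;4;6;8]);(1,[::1;2;3;5;6;7;8]);(1,[::0;2;4;5;6;7;8])]);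
Entry [::0;2;0;2;0;2;1;1;0;2;2;2;1;1;1] [::2;2;1;2;2;2] (Contra 1 3 4);
Entry [::0;2;0;2;0;2;1;2;0;2;2;2;1;1;1] [::2;2;1;2;2;2] (BrE 1 4 (50,[::0;1;2;3;4;5;6;7;8]) (51,[::0;1;2;3;4;5;6;7;8]));
Entry [::0;2;0;2;0;2;2;2;0;2;2;2;1;1;1] [::2;2;1;2;2;2] (BrE 1 3 (49,[::0;1;2;3;4;5;6;7;8]) (52,[::0;1;2;3;4;5;6;7;8]));
Entry [::0;2;1;0;0;2;2;0;0;2;2;2;1;1;1] [::2;2;1;2;2;2] (Contra 0 1 4);
Entry [::0;2;1;0;0;2;0;1;0;2;2;2;1;1;1] [::2;2;1;2;2;2] (Leaf 2 [::(1,[::0;1;5]);(1,[::0;4;7]);(1,[::1;3;7]);(1,[::3;4;5]);(1,[::0;3;5;6;7;8]);(1,[::0;1;2;3;4;6;8]);(1,[::1;2;4;5;6;7;8])]);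
Entry [::0;2;1;0;0;2;1;1;0;2;2;2;1;1;1] [::2;2;1;2;2;2] (Contra 1 3 4);
Entry [::0;2;1;0;0;2;2;1;0;2;2;2;1;1;1] [::2;2;1;2;2;2] (BrE 1 3 (55,[::0;1;2;3;4;5;6;7;8]) (56,[::0;1;2;3;4;5;6;7;8]));
Entry [::0;2;1;0;0;2;2;2;0;2;2;2;1;1;1] [::2;2;1;2;2;2] (BrE 1 4 (54,[::0;1;2;3;4;5;6;7;8]) (57,[::0;1;2;3;4;5;6;7;8]));
Entry [::0;2;1;1;0;2;2;2;0;2;2;2;1;1;1] [::2;2;1;2;2;2] (Contra 0 3 4);
Entry [::0;2;1;2;0;2;2;2;0;2;2;2;1;1;1] [::2;2;1;2;2;2] (BrE 0 4 (58,[::0;1;2;3;4;5;6;7;8]) (59,[::0;1;2;3;4;5;6;7;8]));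
Entry [::0;2;2;2;0;2;2;2;0;2;2;2;1;1;1] [::2;2;1;2;2;2] (BrE 0 3 (53,[::0;1;2;3;4;5;6;7;8]) (60,[::0;1;2;3;4;5;6;7;8]));
Entry [::0;2;2;2;0;2;2;2;0;0;2;2;1;1;1] [::2;2;2;2;2;2] (Leaf 16 [::(3,[::0;1;5]);(3,[::0;1;7]);(5,[::0;5;7]);(2,[::1;5;7]);(8,[::2;3;7]);(8,[::3;4;5]);(1,[::3;5;6;7;8]);(3,[::0;2;3;5;6;8]);(3,[::0;3;4;6;7;8]);(1,[::0;1;2;3;4;6;8]);(4,[::0;1;2;3;5;6;8]);(4,[::0;1;3;4;6;7;8]);(1,[::0;2;4;5;6;7;8]);(7,[::1;2;4;5;6;7;8])]);
Entry [::0;2;2;2;0;2;2;2;0;1;0;2;1;1;1] [::2;2;2;2;2;2] (Leaf 16 [::(5,[::0;1;5]);(2,[::0;1;7]);(3,[::0;5;7]);(3,[::1;5;7]);(8,[::2;4;7]);(8,[::3;4;5]);(1,[::4;5;6;7;8]);(3,[::0;2;4;5;6;8]);(3,[::1;2;4;5;6;8]);(1,[::0;1;2;3;4;6;8]);(1,[::0;1;2;4;5;6;8]);(7,[::0;1;3;4;6;7;8]);(4,[::0;2;3;5;6;7;8]);(4,[::1;2;3;5;6;7;8])]);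
Entry [::0;2;2;2;0;2;2;2;0;1;1;2;1;1;1] [::2;2;2;2;2;2] (Contra 2 3 4);
Entry [::0;2;2;2;0;2;2;2;0;1;2;2;1;1;1] [::2;2;2;2;2;2] (BrE 2 4 (63,[::0;1;2;3;4;5;6;7;8]) (64,[::0;1;2;3;4;5;6;7;8]));
Entry [::0;2;2;2;0;2;2;2;0;2;2;2;1;1;1] [::2;2;2;2;2;2] (BrE 2 3 (62,[::0;1;2;3;4;5;6;7;8]) (65,[::0;1;2;3;4;5;6;7;8]));
Entry [::0;2;2;2;0;2;2;2;0;2;2;2;1;1;1] [::2;2;0;2;2;2] (BrU 2 (61,[::0;1;2;3;4;5;6;7;8]) (66,[::0;1;2;3;4;5;6;7;8]));
Entry [::0;2;2;2;0;2;2;2;0;2;2;2;1;1;1] [::2;0;0;2;2;2] (BrU 1 (48,[::0;1;2;3;4;5;6;7;8]) (67,[::0;1;2;3;4;5;6;7;8]));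
Entry [::0;2;2;2;0;2;2;2;0;2;2;2;1;1;1] [::2;0;0;2;0;2] (BrU 4 (47,[::0;1;2;3;4;5;6;7;8]) (68,[::0;1;2;3;4;5;6;7;8]));
Entry [::0;2;2;2;0;2;2;2;0;2;2;2;1;1;1] [::2;0;0;0;0;2] (BrU 3 (46,[::0;1;2;3;4;5;6;7;8]) (69,[::0;1;2;3;4;5;6;7;8]));
Entry [::0;2;2;2;0;2;2;2;0;2;2;2;1;1;1] [::2;0;0;0;0;0] (BrU 5 (45,[::0;1;2;3;4;5;6;7;8]) (70,[::0;1;2;3;4;5;6;7;8]));
Entry [::0;2;2;2;0;2;2;2;0;2;2;2;1;1;1] [::0;0;0;0;0;0] (BrU 0 (44,[::0;1;2;3;4;5;6;7;8]) (71,[::0;1;2;3;4;5;6;7;8]));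
Entry [::1;2;2;2;1;2;2;2;1;2;2;2;1;1;1] [::1;0;0;0;0;0] (Leaf 4 [::(3,[::0;1;5]);(2,[::3;4;5]);(4,[::0;6;7;8]);(1,[::1;3;6;7;8]);(1,[::3;5;6;7;8]);(1,[::4;5;6;7;8]);(1,[::0;1;2;3;4]);(1,[::1;2;4;6;7;8]);(1,[::2;3;5;6;7;8]);(1,[::1;2;3;4;6;7;8]);(1,[::1;2;4;5;6;7;8])]);
Entry [::1;2;2;2;1;2;2;2;1;2;2;2;1;1;1] [::2;1;0;0;0;0] (Leaf 8 [::(6,[::0;1;5]);(3,[::3;4;5]);(7,[::1;6;7;8]);(2,[::0;3;6;7;8]);(2,[::0;4;6;7;8]);(1,[::3;5;6;7;8]);(1,[::4;5;6;7;8]);(2,[::0;1;2;3;4]);(1,[::1;2;3;4;5]);(3,[::2;3;5;6;7;8]);(2,[::0;2;3;4;6;7;8]);(2,[::0;2;4;5;6;7;8]);(1,[::1;2;4;5;6;7;8])]);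
Entry [::1;2;2;2;1;2;2;2;1;2;2;2;1;1;1] [::2;2;0;1;0;0] (Leaf 8 [::(3,[::0;1;5]);(6,[::3;4;5]);(8,[::3;6;7;8]);(1,[::0;4;6;7;8]);(1,[::1;4;6;7;8]);(2,[::0;5;6;7;8]);(2,[::1;5;6;7;8]);(2,[::0;1;2;3;4]);(1,[::0;1;2;3;5]);(1,[::0;2;4;6;7;8]);(1,[::1;2;4;6;7;8]);(2,[::1;2;5;6;7;8]);(2,[::0;1;2;4;6;7;8]);(2,[::0;2;4;5;6;7;8])]);
Entry [::1;2;2;2;1;2;2;2;1;2;2;2;1;1;1] [::2;2;0;2;1;0] (Leaf 8 [::(3,[::0;1;5]);(6,[::3;4;5]);(7,[::4;6;7;8]);(2,[::1;3;6;7;8]);(3,[::0;5;6;7;8]);(1,[::1;5;6;7;8]);(2,[::0;1;2;3;4]);(1,[::0;1;2;4;5]);(2,[::0;2;3;6;7;8]);(1,[::0;2;5;6;7;8]);(2,[::0;1;2;3;6;7;8]);(2,[::1;2;3;5;6;7;8]);(1,[::1;2;4;5;6;7;8])]);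
Entry [::1;2;2;2;1;2;2;2;1;2;2;2;1;1;1] [::2;2;0;2;2;1] (Leaf 2 [::(1,[::0;1;5]);(1,[::3;4;5]);(2,[::5;6;7;8]);(1,[::1;3;6;7;8]);(1,[::0;4;6;7;8]);(1,[::0;1;2;3;4;5]);(1,[::0;2;3;6;7;8]);(1,[::1;2;4;6;7;8])]);
Entry [::1;2;0;2;1;2;2;0;1;2;2;2;1;1;1] [::2;2;1;2;2;2] (Leaf 2 [::(1,[::0;1;5]);(1,[::0;3;7]);(1,[::1;4;7]);(1,[::3;4;5]);(1,[::0;1;3;4;6;8]);(1,[::1;2;3;5;6;7;8]);(1,[::0;2;4;5;6;7;8])]);
Entry [::1;2;0;2;1;2;2;1;1;2;2;2;1;1;1] [::2;2;1;2;2;2] (Contra 1 4 5);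
Entry [::1;2;0;2;1;2;2;2;1;2;2;2;1;1;1] [::2;2;1;2;2;2] (BrE 1 4 (78,[::0;1;2;3;4;5;6;7;8]) (79,[::0;1;2;3;4;5;6;7;8]));
Entry [::1;2;1;2;1;2;2;2;1;2;2;2;1;1;1] [::2;2;1;2;2;2] (Contra 0 3 5);
Entry [::1;2;2;2;1;2;2;2;1;2;2;2;1;1;1] [::2;2;1;2;2;2] (BrE 0 3 (80,[::0;1;2;3;4;5;6;7;8]) (81,[::0;1;2;3;4;5;6;7;8]));
Entry [::1;2;0;2;1;2;2;0;1;2;2;2;1;1;1] [::2;2;2;2;2;2] (Leaf 2 [::(1,[::0;1;5]);(1,[::0;3;7]);(1,[::1;4;7]);(1,[::3;4;5]);(1,[::0;1;3;4;6;8]);(1,[::1;2;3;5;6;7;8]);(1,[::0;2;4;5;6;7;8])]);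
Entry [::1;2;0;2;1;2;2;1;1;2;2;2;1;1;1] [::2;2;2;2;2;2] (Contra 1 4 5);
Entry [::1;2;0;2;1;2;2;2;1;2;2;2;1;1;1] [::2;2;2;2;2;2] (BrE 1 4 (83,[::0;1;2;3;4;5;6;7;8]) (84,[::0;1;2;3;4;5;6;7;8]));
Entry [::1;2;1;2;1;2;2;2;1;2;2;2;1;1;1] [::2;2;2;2;2;2] (Contra 0 3 5);
Entry [::1;2;2;2;1;2;2;2;1;2;2;2;1;1;1] [::2;2;2;2;2;2] (BrE 0 3 (85,[::0;1;2;3;4;5;6;7;8]) (86,[::0;1;2;3;4;5;6;7;8]));
Entry [::1;2;2;2;1;2;2;2;1;2;2;2;1;1;1] [::2;2;0;2;2;2] (BrU 2 (82,[::0;1;2;3;4;5;6;7;8]) (87,[::0;1;2;3;4;5;6;7;8]));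
Entry [::1;2;2;2;1;2;2;2;1;2;2;2;1;1;1] [::2;2;0;2;2;0] (BrU 5 (77,[::0;1;2;3;4;5;6;7;8]) (88,[::0;1;2;3;4;5;6;7;8]));
Entry [::1;2;2;2;1;2;2;2;1;2;2;2;1;1;1] [::2;2;0;2;0;0] (BrU 4 (76,[::0;1;2;3;4;5;6;7;8]) (89,[::0;1;2;3;4;5;6;7;8]));
Entry [::1;2;2;2;1;2;2;2;1;2;2;2;1;1;1] [::2;2;0;0;0;0] (BrU 3 (75,[::0;1;2;3;4;5;6;7;8]) (90,[::0;1;2;3;4;5;6;7;8]));
Entry [::1;2;2;2;1;2;2;2;1;2;2;2;1;1;1] [::2;0;0;0;0;0] (BrU 1 (74,[::0;1;2;3;4;5;6;7;8]) (91,[::0;1;2;3;4;5;6;7;8]));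
Entry [::1;2;2;2;1;2;2;2;1;2;2;2;1;1;1] [::0;0;0;0;0;0] (BrU 0 (73,[::0;1;2;3;4;5;6;7;8]) (92,[::0;1;2;3;4;5;6;7;8]));
Entry [::0;2;2;2;0;2;2;2;0;2;2;2;0;0;0] [::0;0;0;0;0;0] (Same (43,[::0;1;2;3;4;5;6;7;8]));
Entry [::0;2;2;2;0;2;2;2;0;2;2;2;1;1;1] [::0;0;0;0;0;0] (Same (72,[::0;1;2;3;4;5;6;7;8]));
Entry [::1;2;2;2;1;2;2;2;1;2;2;2;0;0;0] [::0;0;0;0;0;0] (Same (72,[::3;4;2;0;1;5;6;7;8]));
Entry [::1;2;2;2;1;2;2;2;1;2;2;2;1;1;1] [::0;0;0;0;0;0] (Same (93,[::0;1;2;3;4;5;6;7;8]))]%N.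
Lemma table_D_ok : check_table [:: [:: 0; 1; 2]; [:: 3; 4; 5]]%N table_D.
Proof. by vm_compute. Qed.
Lemma table_S_ok : check_table [:: [:: 0; 1; 5]; [:: 3; 4; 5]]%N table_S.
Proof. by vm_compute. Qed.

(** * Soundness of the certificate checker *)

Section Soundness.
Variables (R : realFieldType) (T : finType).
Variables (y : T -> T -> R) (yW : weighting y) (c : rel T) (cs : symmetric c).
Variable ts : seq (seq nat).
Implicit Types f : nat -> T.

Let ysym := let: And3 h _ _ := yW in h.
Let ydiag := let: And3 _ h _ := yW in h.
Let yge0 := let: And3 _ _ h := yW in h.

Definition im f (s : seq nat) : {set T} := [set x in map f s].

(** What holds in every state of a table; the knowledge that distinguishes the states is in
    [fits]. *)
Record placed f : Prop := Placed {
  f_uniq : uniq (map f (iota 0 9));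
  f_zero : [/\ y (f 6) (f 7) = 0, y (f 6) (f 8) = 0 & y (f 7) (f 8) = 0];
  f_col : [/\ c (f 6) (f 7), c (f 7) (f 8) & ~~ c (f 6) (f 8)];
  f_tri : forall i j k, (i < 6)%N -> (j < 6)%N -> (k < 6)%N ->
    tri c (f i) (f j) (f k) -> istri ts i j k;
  f_cov : covers c y (im f (iota 0 9));
  f_five : fives y (im f (iota 0 9)) (79 / 75) }.

Record fits f (kc pt : seq nat) : Prop := Fits {
  fit_col : forall i j (b : bool), (i < 9)%N -> (j < 9)%N -> i != j ->
    ecol kc pt i j = b -> c (f i) (f j) = b;
  fit_pay : forall k, (k < 6)%N -> nth 0%N pt k = 1%N ->
    1 <= y (f k) (f 6) + y (f k) (f 7) + y (f k) (f 8);
  fit_free : forall k, (k < 6)%N -> nth 0%N pt k = 2%N ->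
    c (f k) (f 6) || c (f k) (f 8) }.

Definition sound kc pt := forall f, placed f -> fits f kc pt ->
  433 / 75 <= wt y (im f (iota 0 9)).

Lemma f_inj f i j : uniq (map f (iota 0 9)) -> (i < 9)%N -> (j < 9)%N ->
  (f i == f j) = (i == j).
Proof.
move=> fu i9 j9; apply/eqP/eqP => [fij|->//].
have := nth_uniq (f 0%N) _ _ fu; rewrite size_map size_iota => /(_ i j i9 j9).
by rewrite !(nth_map 0%N) ?size_iota // !nth_iota // fij eqxx => /esym/eqP.
Qed.

Lemma uniq_im f s : placed f -> uniq s -> all (fun i => (i < 9)%N) s -> uniq (map f s).
Proof.
move=> Hf us /allP s9; rewrite map_inj_in_uniq // => i j /s9 i9 /s9 j9 /eqP.
by rewrite (f_inj (f_uniq Hf)) // => /eqP.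
Qed.

Lemma card_im f s : placed f -> uniq s -> all (fun i => (i < 9)%N) s -> #|im f s| = size s.
Proof.
by move=> Hf us s9; rewrite /im cardsE (card_uniqP _) ?size_map // uniq_im.
Qed.

Lemma im_sub f s : all (fun i => (i < 9)%N) s -> im f s \subset im f (iota 0 9).
Proof.
move=> /allP s9; apply/subsetP => x; rewrite !in_set => /mapP[i /s9 i9 ->].
by apply: map_f; rewrite mem_iota.
Qed.

Lemma wt_im f s : placed f -> uniq s -> all (fun i => (i < 9)%N) s ->
  wt y (im f s) = (\sum_(i <- s) \sum_(j <- s) y (f i) (f j)) / 2.
Proof.
move=> Hf us s9; have ufs := uniq_im Hf us s9.
rewrite /wt; congr (_ / 2).
have E (g : T -> R) : \sum_(x in im f s) g x = \sum_(i <- s) g (f i).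
  rewrite -(big_map f xpredT) big_uniq //=; apply: eq_bigl => x; by rewrite !inE.
by rewrite E; apply: eq_bigr => i _; exact: E.
Qed.

Lemma sum_iota9 (g : nat -> R) s : uniq s -> all (fun i => (i < 9)%N) s ->
  \sum_(i <- s) g i = \sum_(i <- iota 0 9) (i \in s)%:R * g i.
Proof.
move=> us /allP s9.
rewrite [RHS](eq_bigr (fun i => if i \in s then g i else 0)) => [|i _]; last first.
  by case: ifP; rewrite ?mul1r ?mul0r.
rewrite -big_mkcond -big_filter; apply: perm_big; apply: uniq_perm => //.
  by rewrite filter_uniq // iota_uniq.
by move=> i; rewrite mem_filter mem_iota; case si: (i \in s) => //=; rewrite s9.
Qed.

Lemma okc_le f kc pt vs : placed f -> fits f kc pt -> okc kc pt vs ->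
  (rhs vs)%:R / 75 <= wt y (im f vs).
Proof.
move=> Hf Hs /and3P[us s9 H].
have vsub := im_sub f s9; have card := card_im Hf us s9.
have cv := coversS vsub (f_cov Hf).
have H5 : fives y (im f vs) 1.
  move=> K KS K5; apply: le_trans (f_five Hf _ K5); first by lra.
  exact: subset_trans KS vsub.
move: H; case: (vs) us s9 vsub card cv H5 => [|i [|j [|k [|l vs']]]] us s9 vsub card cv H5 //=.
- case/and3P => e2 /eqP eij /eqP eik.
  rewrite wt_im // !big_cons !big_nil !ydiag /rhs /=.
  rewrite (ysym (f j) (f i)) (ysym (f k) (f i)) (ysym (f k) (f j)).
  move: us s9; rewrite /= !inE negb_or !andbT => /andP[/andP[ij ik] jk] /and3P[i9 j9 k9].
  have [b eb] : exists b : bool, ecol kc pt i j = b.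
    by move: e2; case: (ecol kc pt i j) => [|[|]] // _; [exists false|exists true].
  have := fit_col Hs i9 j9 ij eb.
  have := fit_col Hs i9 k9 ik; rewrite -eij => /(_ b eb).
  have := fit_col Hs j9 k9 jk; rewrite -eik => /(_ b eb) c1 c2 c3.
  have : 1 <= y (f i) (f j) + y (f i) (f k) + y (f j) (f k).
    apply: (f_cov Hf).
    + by rewrite in_set map_f // mem_iota.
    + by rewrite in_set map_f // mem_iota.
    + by rewrite in_set map_f // mem_iota.
    by rewrite /tri !(f_inj (f_uniq Hf)) // ij ik jk c1 c2 c3 !eqxx.
  lra.
- case: vs' us s9 vsub card cv H5 => [|m vs''] us s9 vsub card cv H5.
    case/and5P => i6 /eqP pi /eqP ej /eqP ek /eqP el.
    have := fit_pay Hs i6 pi; have [z1 z2 z3] := f_zero Hf.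
    rewrite wt_im // !big_cons !big_nil !ydiag /rhs /= ej ek el z1 z2 z3.
    rewrite (ysym (f 7) (f 6)) (ysym (f 8) (f 6)) (ysym (f 8) (f 7)) z1 z2 z3.
    rewrite (ysym (f 6) (f i)) (ysym (f 7) (f i)) (ysym (f 8) (f i)).
    lra.
  move=> /= H9; rewrite /rhs /=; move: card H9 => /=.
  case: (size vs'') => [|[|[|[|]]]] //= card _.
  + by apply: (f_five Hf).
  + by have := six_ge2 yW cs cv H5 card; lra.
  + by have := seven_ge3 yW cs cv H5 card; lra.
  + by have := eight_ge4 yW cs cv H5 card; lra.
Qed.

(** The weighted sum of the inequalities is at least 433 q / 75. Regrouped by pairs it is at most
    [q] times the total weight, since a pair loaded more than [q] times has weight 0. *)
Lemma leaf_sound kc pt q l : check_leaf kc pt q l -> sound kc pt.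
Proof.
move=> /and4P[q0 /allP Hok /allP Hload Hr] f Hf Hs.
pose I := iota 0 9.
have u9 : all (fun i => (i < 9)%N) I by apply/allP => i; rewrite mem_iota.
rewrite wt_im // -/I.
have lb : (433 * q)%:R / 75 <= \sum_(p <- l) p.1%:R * wt y (im f p.2).
  apply: (@le_trans _ _ ((sumn [seq p.1 * rhs p.2 | p <- l])%N%:R / 75)).
    by rewrite ler_pM2r ?invr_gt0 ?ltr0n // ler_nat.
  rewrite sumnE big_map natr_sum mulr_suml big_seq [leRHS]big_seq.
  apply: ler_sum => p pl; rewrite natrM -mulrA; apply: ler_wpM2l => //.
  by apply: okc_le Hf Hs _; apply: Hok.
have ub : \sum_(p <- l) p.1%:R * wt y (im f p.2) =
    (\sum_(i <- I) \sum_(j <- I) (load l i j)%:R * y (f i) (f j)) / 2.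
  transitivity (\sum_(p <- l) (\sum_(i <- I) \sum_(j <- I)
     (if (i \in p.2) && (j \in p.2) then p.1 else 0%N)%:R * y (f i) (f j)) / 2).
    rewrite big_seq [RHS]big_seq; apply: eq_bigr => p /Hok /and3P[us s9 _].
    rewrite wt_im // mulrA; congr (_ / 2).
    rewrite (sum_iota9 _ us s9) mulr_sumr; apply: eq_bigr => i _.
    rewrite (sum_iota9 _ us s9) mulr_sumr mulr_sumr; apply: eq_bigr => j _.
    by case: (i \in p.2); case: (j \in p.2); rewrite /= ?(mul1r, mul0r, mulr0).
  rewrite -mulr_suml; congr (_ / 2); rewrite exchange_big /=; apply: eq_bigr => i _.
  rewrite exchange_big /=; apply: eq_bigr => j _.
  by rewrite -mulr_suml /load sumnE big_map natr_sum.
have : \sum_(i <- I) \sum_(j <- I) (load l i j)%:R * y (f i) (f j) <=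
   q%:R * \sum_(i <- I) \sum_(j <- I) y (f i) (f j).
  rewrite mulr_sumr big_seq [leRHS]big_seq; apply: ler_sum => i iI.
  rewrite mulr_sumr big_seq [leRHS]big_seq; apply: ler_sum => j jI.
  have := allP (Hload i iI) j jI => /or3P[/eqP->|/andP[i5 j5]|lq].
  - by rewrite ydiag !mulr0.
  - have -> : y (f i) (f j) = 0; last by rewrite !mulr0.
    have [z1 z2 z3] := f_zero Hf.
    move: i5 j5 iI jI; rewrite !mem_iota /=.
    by case: i => [|[|[|[|[|[|[|[|[|]]]]]]]]] //; case: j => [|[|[|[|[|[|[|[|[|]]]]]]]]] // *;
      rewrite ?ydiag // ysym.
  - by apply: ler_wpM2r => //; rewrite ler_nat.
move: lb; rewrite ub natrM.
have q0' : 0 < q%:R :> R by rewrite ltr0n.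
set A := \sum_(i <- I) _; set B := \sum_(i <- I) _ => h1 h2.
rewrite -(ler_pM2l q0'); lra.
Qed.

End Soundness.

Section Table.
Variables (R : realFieldType) (T : finType).
Variables (y : T -> T -> R) (yW : weighting y) (c : rel T) (cs : symmetric c).
Variable ts : seq (seq nat).
Implicit Types f : nat -> T.
Let sound := sound y c ts.
Let placed := placed y c ts.
Let ysym := let: And3 h _ _ := yW in h.

Lemma ecolC kc pt i j : ecol kc pt i j = ecol kc pt j i.
Proof. by rewrite /ecol; case: (ltngtP i j) => // ->. Qed.

(** The relabelled placement [f \o pn] has the same image and fits the earlier entry. *)
Lemma ref_sound es n r kc pt : check_ref ts es n r kc pt ->
  (forall m, (m < n)%N -> sound (kcol (nth e0 es m)) (pats (nth e0 es m))) ->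
  sound kc pt.
Proof.
case: r => m p; rewrite /check_ref => /and5P[mn pp p6 /eqP p7 /and3P[Hts Hcol Hpt]] IH f Hf Hs.
set e := nth e0 es m in Hcol Hpt.
set pn := nth 0%N p in p6 p7 Hts Hcol Hpt.
have sp : size p = 9%N by rewrite (perm_size pp) size_iota.
have up : uniq p by rewrite (perm_uniq pp) iota_uniq.
have p9 i : (i < 9)%N -> (pn i < 9)%N.
  move=> i9; have : pn i \in p by rewrite mem_nth ?sp.
  by rewrite (perm_mem pp) mem_iota.
have pinj i j : (i < 9)%N -> (j < 9)%N -> i != j -> pn i != pn j.
  by move=> i9 j9 ij; rewrite nth_uniq ?sp.
have p6' i : (i < 6)%N -> (pn i < 6)%N.
  by move=> i6; move/allP: p6 => /(_ i); rewrite mem_iota => /(_ i6).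
have pE : [seq pn i | i <- iota 0 9] = p.
  apply: (@eq_from_nth _ 0%N); first by rewrite size_map size_iota sp.
  move=> i; rewrite size_map size_iota => i9.
  by rewrite (nth_map 0%N) ?size_iota // nth_iota.
have mE : map (f \o pn) (iota 0 9) = map f p by rewrite map_comp pE.
have imE : im (f \o pn) (iota 0 9) = im f (iota 0 9).
  by apply/setP => x; rewrite /im mE !in_set (perm_mem (perm_map f pp)).
have p68 : (pn 6 = 6 /\ pn 8 = 8)%N \/ (pn 6 = 8 /\ pn 8 = 6)%N.
  have inj i : (i < 6)%N -> pn i != pn 6 /\ pn i != pn 8.
    by move=> i6; split; apply: pinj => //; lia.
  (* p permutes {0..5}, so it can only swap or fix 6 and 8 *)
  have surj j : (j < 6)%N -> exists2 i, (i < 6)%N & pn i = j.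
    have us : uniq [seq pn i | i <- iota 0 6].
      rewrite map_inj_in_uniq ?iota_uniq // => a b; rewrite !mem_iota => a6 b6 /eqP pab.
      apply/eqP; apply: contraTT pab => ab; apply: pinj => //; lia.
    have sub : {subset [seq pn i | i <- iota 0 6] <= iota 0 6}.
      by move=> k /mapP[i]; rewrite !mem_iota => i6 ->; apply: p6'.
    have [|_ /(_ j) E] := uniq_min_size us sub; first by rewrite size_map !size_iota.
    move=> j6; move: E; rewrite mem_iota j6 => /mapP[i]; rewrite mem_iota => i6 ->.
    by exists i.
  have big k : (k < 9)%N -> (5 < k)%N -> (5 < pn k)%N.
    move=> k9 k5; rewrite ltnNge; apply/negP => pk; have [i i6 E] := surj (pn k) pk.
    have : pn i != pn k by apply: pinj => //; lia.
    by rewrite E eqxx.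
  have := big 6%N isT isT; have := big 8%N isT isT; have := p9 6%N isT; have := p9 8%N isT.
  have := pinj 6%N 8%N isT isT isT; have := pinj 6%N 7%N isT isT isT; have := pinj 8%N 7%N isT isT isT.
  rewrite p7; move: (pn 6) (pn 8) => a b; lia.
have Hf' : placed (f \o pn).
  have [z1 z2 z3] := f_zero Hf; have [c1 c2 c3] := f_col Hf.
  split.
  - by rewrite mE (perm_uniq (perm_map f pp)); exact: f_uniq Hf.
  - by case: p68 => -[/= -> ->]; rewrite p7; split; rewrite // ysym.
  - by case: p68 => -[/= -> ->]; rewrite p7; split; rewrite // cs.
  - move=> i j k i6 j6 k6 /= /(f_tri Hf (p6' _ i6) (p6' _ j6) (p6' _ k6)).
    case/hasP => t tts /and3P[ti tj tk].
    have /hasP[t' t'ts /allP Ht] := allP Hts t tts.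
    apply/hasP; exists t' => //.
    have H a : (a < 6)%N -> pn a \in t -> a \in t'.
      by move=> a6 at'; have := Ht a; rewrite mem_iota a6 at' => /(_ isT).
    by rewrite !H.
  - by rewrite imE; exact: f_cov Hf.
  - by rewrite imE; exact: f_five Hf.
rewrite -imE; apply: (IH m mn) => //; rewrite -/e; split.
- have Hlt i j (b : bool) : (i < j)%N -> (j < 9)%N -> ecol (kcol e) (pats e) i j = b ->
     c (f (pn i)) (f (pn j)) = b.
    move=> ij j9 eb; have i9 : (i < 9)%N by lia.
    have := allP Hcol i; rewrite mem_iota i9 => /(_ isT)/allP/(_ j).
    rewrite mem_iota j9 ij eb => /(_ isT) /= /orP[|/eqP E]; first by case: (b).
    apply: (fit_col Hs) => //; rewrite ?p9 ?pinj //; lia.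
  move=> i j b i9 j9; rewrite neq_ltn => /orP[ij|ji] eb; first exact: Hlt.
  by rewrite /= cs; apply: Hlt => //; rewrite ecolC.
- move=> k k6 pk; have := allP Hpt k; rewrite mem_iota k6 => /(_ isT)/andP[+ _].
  rewrite pk /= => /eqP /(fit_pay Hs (p6' _ k6)).
  by case: p68 => -[/= -> ->]; rewrite p7 //; lra.
- move=> k k6 pk; have := allP Hpt k; rewrite mem_iota k6 => /(_ isT)/andP[_ +].
  rewrite pk /= => /eqP /(fit_free Hs (p6' _ k6)).
  by case: p68 => -[/= -> ->] //; rewrite orbC.
Qed.

(** If the edge to 7 is red, a red edge to 6 or 8 closes a red triangle over 67 or 78, and two blue
    ones close a blue triangle over 68. If it is blue, only two blue edges to 6 and 8 do so. The
    closing pair has weight 0, so the vertex alone pays for the triangle. *)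
Lemma free_or_pay f k : placed f -> (k < 6)%N ->
  1 <= y (f k) (f 6) + y (f k) (f 7) + y (f k) (f 8) \/
  ~~ c (f k) (f 7) /\ (c (f k) (f 6) || c (f k) (f 8)).
Proof.
move=> Hf k6; have k9 : (k < 9)%N by lia.
have [z1 z2 z3] := f_zero Hf; have [c1 c2 c3] := f_col Hf.
have inS i : (i < 9)%N -> f i \in im f (iota 0 9).
  by move=> i9; rewrite in_set map_f // mem_iota.
have yge0 : forall a b, 0 <= y a b by case: yW.
have cov i j : (5 < i < 9)%N -> (5 < j < 9)%N -> i != j ->
   c (f k) (f i) = c (f k) (f j) -> c (f k) (f i) = c (f i) (f j) -> y (f i) (f j) = 0 ->
   1 <= y (f k) (f i) + y (f k) (f j).
  move=> /andP[i5 i9] /andP[j5 j9] ij e1 e2 e3.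
  have := f_cov Hf (inS k k9) (inS i i9) (inS j j9); rewrite e3 addr0; apply.
  rewrite /tri !(f_inj (f_uniq Hf)) // ij -e1 -e2 !eqxx /= andbT; apply/andP; lia.
have z k' : 0 <= y (f k) (f k') by [].
move: (z 6%N) (z 7%N) (z 8%N) => y6 y7 y8.
case c7 : (c (f k) (f 7)).
  left; case c6 : (c (f k) (f 6)).
    by have := cov 6%N 7%N isT isT isT; rewrite c6 c7 c1 => /(_ erefl erefl z1); lra.
  case c8 : (c (f k) (f 8)).
    by have := cov 7%N 8%N isT isT isT; rewrite c8 c7 c2 => /(_ erefl erefl z3); lra.
  by have := cov 6%N 8%N isT isT isT; rewrite c6 c8 (negbTE c3) => /(_ erefl erefl z2); lra.
case c6 : (c (f k) (f 6)); first by right.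
case c8 : (c (f k) (f 8)); first by right.
left; by have := cov 6%N 8%N isT isT isT; rewrite c6 c8 (negbTE c3) => /(_ erefl erefl z2); lra.
Qed.

Lemma kidx_inj i j i' j' : (i < j < 6)%N -> (i' < j' < 6)%N ->
  kidx i j = kidx i' j' -> i = i' /\ j = j'.
Proof.
case: i => [|[|[|[|[|[|//]]]]]]; case: i' => [|[|[|[|[|[|//]]]]]]; rewrite /kidx /=; lia.
Qed.

Lemma ecol_set_pat kc pt k p i j : (k < 6)%N -> i != j ->
  ecol kc (set_nth 0%N pt k p) i j =
  if (i == k) && (5 < j)%N then qcol p j else
  if (j == k) && (5 < i)%N then qcol p i else ecol kc pt i j.
Proof.
move=> k6; have H i' j' : (i' < j')%N -> ecol_lt kc (set_nth 0%N pt k p) i' j' =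
    if (i' == k) && (5 < j')%N then qcol p j' else ecol_lt kc pt i' j'.
  move=> ij; rewrite /ecol_lt; case: ltnP => j6; first by rewrite andbF.
  rewrite andbT; case: ltnP => i6.
    by rewrite nth_set_nth /=; case: eqP.
  by case: eqP => // ik; lia.
rewrite neq_ltn => /orP[ij|ji].
  rewrite /ecol ij H //; case: ifP => // _; case: eqP => // jk.
  by have -> : (5 < i)%N = false by lia.
have nij : (i < j)%N = false by lia.
have -> : (i == k) && (5 < j)%N = false by lia.
by rewrite /ecol nij H.
Qed.

(* Refining the pattern of vertex k preserves fitness once the colours of the
   edges from k to the zero triangle agree with the new pattern. *)
Lemma fits_set_pat f kc pt k p : fits y c f kc pt -> (k < 6)%N ->
  (forall j (b : bool), (5 < j < 9)%N -> qcol p j = b -> c (f k) (f j) = b) ->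
  (p = 1%N -> 1 <= y (f k) (f 6) + y (f k) (f 7) + y (f k) (f 8)) ->
  (p = 2%N -> c (f k) (f 6) || c (f k) (f 8)) ->
  fits y c f kc (set_nth 0%N pt k p).
Proof.
move=> Hs k6 Hc H1 H2; split.
- move=> i j b i9 j9 ij; rewrite ecol_set_pat //.
  case: ifP => [/andP[/eqP-> j5]|_]; first by apply: Hc; rewrite j5.
  case: ifP => [/andP[/eqP-> i5]|_]; last exact: (fit_col Hs).
  by rewrite cs; apply: Hc; rewrite i5.
- move=> k' k'6; rewrite nth_set_nth /=; case: eqP => [-> //|_].
  exact: (fit_pay Hs).
- move=> k' k'6; rewrite nth_set_nth /=; case: eqP => [-> //|_].
  exact: (fit_free Hs).
Qed.

Lemma fits_set_edge f kc pt i j (b : bool) : fits y c f kc pt -> (i < j < 6)%N ->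
  c (f i) (f j) = b -> fits y c f (set_nth 2%N kc (kidx i j) b) pt.
Proof.
move=> Hs ij cb; split; [|exact: (fit_pay Hs)|exact: (fit_free Hs)].
have Hlt i' j' (b' : bool) : (i' < j')%N -> (j' < 9)%N ->
    ecol (set_nth 2%N kc (kidx i j) b) pt i' j' = b' -> c (f i') (f j') = b'.
  move=> ij' j'9; rewrite /ecol ij' /ecol_lt; case: ltnP => j'6.
    rewrite nth_set_nth /=; case: eqP => [E|_ eb].
      have [||-> ->] := kidx_inj _ _ E; rewrite ?ij' //.
      by rewrite cb; case: (b); case: (b').
    by apply: (fit_col Hs) => //; rewrite ?(ltn_trans ij') ?neq_ltn ?ij' // /ecol ij' /ecol_lt j'6.
  move=> eb; apply: (fit_col Hs) => //; rewrite ?(ltn_trans ij') ?neq_ltn ?ij' //.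
  by rewrite /ecol ij' /ecol_lt ltnNge j'6.
move=> i' j' b' i9 j9; rewrite neq_ltn => /orP[l|l]; first exact: Hlt.
by rewrite ecolC cs; exact: Hlt.
Qed.

(** References lead only to earlier entries, so strong induction on the index applies. *)
Lemma table_sound es : check_table ts es ->
  forall n, (n < size es)%N -> sound (kcol (nth e0 es n)) (pats (nth e0 es n)).
Proof.
move=> /allP Ht n; elim/ltn_ind: n => n IH nes.
have {}IH m : (m < n)%N -> sound (kcol (nth e0 es m)) (pats (nth e0 es m)).
  by move=> mn; apply: IH => //; apply: ltn_trans nes.
have := Ht n; rewrite mem_iota nes => /(_ isT); rewrite /check_entry.
set e := nth e0 es n; case: (how e).
- by move=> q l; apply: leaf_sound.
- move=> i j k /and5P[ij jk k6 e2 /and3P[/eqP eij /eqP eik nts]] f Hf Hs.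
  have [b eb] : exists b : bool, ecol (kcol e) (pats e) i j = b.
    by move: e2; case: (ecol _ _ i j) => [|[|]] // _; [exists false|exists true].
  have i9 : (i < 9)%N by lia. have j9 : (j < 9)%N by lia. have k9 : (k < 9)%N by lia.
  have ijN : i != j by lia. have ikN : i != k by lia. have jkN : j != k by lia.
  have := fit_col Hs i9 j9 ijN eb.
  have := fit_col Hs i9 k9 ikN; rewrite -eij => /(_ b eb).
  have := fit_col Hs j9 k9 jkN; rewrite -eik => /(_ b eb) c1 c2 c3.
  case/negP: nts; apply: (f_tri Hf); [lia|lia|lia|].
  by rewrite /tri !(f_inj (f_uniq Hf)) // ijN ikN jkN c1 c2 c3 !eqxx.
- move=> k r1 r2 /and4P[k6 _ ck1 ck2] f Hf Hs.
  case: (free_or_pay Hf k6) => [pay|[c7 fr]].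
    apply: (ref_sound ck1 IH Hf); apply: fits_set_pat => // j b; by case: b.
  apply: (ref_sound ck2 IH Hf); apply: fits_set_pat => // j b /= _.
  by case: eqP => [-> |_]; case: b => // _; apply: negbTE.
- move=> k r1 r2 r3 /and5P[k6 /eqP pk ck1 ck2 ck3] f Hf Hs.
  have fr := fit_free Hs k6 pk.
  have k9 : (k < 9)%N by lia.
  have c7 : c (f k) (f 7) = false.
    apply: (fit_col Hs) => //; first by lia.
    by rewrite /ecol /ecol_lt k6 pk (_ : (k < 7)%N) //; lia.
  have Q (p : nat) j b : (5 < j < 9)%N -> [/\ qcol p 6 = c (f k) (f 6), qcol p 7 = 0%N & qcol p 8 = c (f k) (f 8)] ->
     qcol p j = nat_of_bool b -> c (f k) (f j) = b.
    move=> j9 [q6 q7 q8]; have [|[|]] : j = 6%N \/ j = 7%N \/ j = 8%N by lia.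
    + by move=> ->; rewrite q6; case: (c _ _); case: (b).
    + by move=> ->; rewrite q7 c7; case: (b).
    + by move=> ->; rewrite q8; case: (c _ _); case: (b).
  case c6 : (c (f k) (f 6)); case c8 : (c (f k) (f 8)).
  + apply: (ref_sound ck1 IH Hf); apply: fits_set_pat => // j b j9.
    by apply: Q j9 _; rewrite c6 c8.
  + apply: (ref_sound ck2 IH Hf); apply: fits_set_pat => // j b j9.
    by apply: Q j9 _; rewrite c6 c8.
  + apply: (ref_sound ck3 IH Hf); apply: fits_set_pat => // j b j9.
    by apply: Q j9 _; rewrite c6 c8.
  + by move: fr; rewrite c6 c8.
- move=> i j r1 r2 /and4P[ij j6 ck1 ck2] f Hf Hs.
  case cij : (c (f i) (f j)).
    apply: (ref_sound ck2 IH Hf); apply: (fits_set_edge (b := true)) => //; by rewrite ij.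
  apply: (ref_sound ck1 IH Hf); apply: (fits_set_edge (b := false)) => //; by rewrite ij.
- by move=> r ck; apply: (ref_sound ck IH).
Qed.

End Table.

(** A root may know nothing but the colours [b1] and [b2] of its two triangles, so every placement
    with these colours fits it. *)
Definition root_ok (t1 t2 : seq nat) (es : seq entry) n (b1 b2 : bool) :=
  let e := nth e0 es n in
  [&& check_table [:: t1; t2] es, (n < size es)%N,
      all (fun k => nth 0%N (pats e) k == 0%N) (iota 0 6)
    & all (fun i => all (fun j => let x := ecol (kcol e) (pats e) i j in
        [|| i == j, x == 2%N, [&& i \in t1, j \in t1 & x == b1]
                    | [&& i \in t2, j \in t2 & x == b2]]) (iota 0 9)) (iota 0 9)].

Lemma root_D (b1 b2 : bool) : root_ok [:: 0; 1; 2]%N [:: 3; 4; 5]%N table_D (159 + 2 * b1 + b2) b1 b2.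
Proof. by rewrite /root_ok table_D_ok; case: b1; case: b2; vm_compute. Qed.

Lemma root_S (b1 b2 : bool) : root_ok [:: 0; 1; 5]%N [:: 3; 4; 5]%N table_S (94 + 2 * b1 + b2) b1 b2.
Proof. by rewrite /root_ok table_S_ok; case: b1; case: b2; vm_compute. Qed.

(** * Monochromatic triangles in a six-set of low costs *)

Section TriangleSets.
Variables (R : realFieldType) (T : finType).
Variables (y : T -> T -> R) (yW : weighting y).
Implicit Types (c : rel T) (A B K : {set T}).

Let ysym := let: And3 h _ _ := yW in h.
Let ydiag := let: And3 _ h _ := yW in h.
Let yge0 := let: And3 _ _ h := yW in h.

Definition triset c A := exists x u v, A = [set x; u; v] /\ tri c x u v.

Lemma triset_col c (cs : symmetric c) A : triset c A ->
  exists b : bool, forall x z, x \in A -> z \in A -> x != z -> c x z = b.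
Proof.
case=> x [u [v [-> /and5P[xu xv uv /eqP c1 /eqP c2]]]]; exists (c x u).
have e : (c u x = c x u) * (c v x = c x u) * (c v u = c x u) * (c x v = c x u) * (c u v = c x u).
  by rewrite (cs u x) (cs v x) (cs v u) -c1 -c2.
by move=> p q; rewrite !inE -!orbA => /or3P[]/eqP-> /or3P[]/eqP->; rewrite ?eqxx ?e.
Qed.

Lemma triset_edge c (cs : symmetric c) A x z : triset c A -> x \in A -> z \in A -> x != z ->
  exists v, A = [set x; z; v] /\ tri c x z v.
Proof.
case=> p [q [r [-> t]]].
have t1 : tri c q p r by rewrite triCl.
have t2 : tri c p r q by rewrite triCr.
have t3 : tri c r p q by rewrite triCl.
have t4 : tri c q r p by rewrite triCr.
have t5 : tri c r q p by rewrite triCl.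
rewrite !inE -!orbA => /or3P[]/eqP-> /or3P[]/eqP->; rewrite ?eqxx // => _;
  [exists r|exists q|exists r|exists p|exists q|exists p]; split=> //;
  apply/setP => w; rewrite !inE; by case: (w == p); case: (w == q); case: (w == r).
Qed.

Lemma triset_vertex c (cs : symmetric c) A x : triset c A -> x \in A ->
  exists u v, A = [set u; v; x] /\ tri c u v x.
Proof.
move=> tA xA; have [z zA xz] : exists2 z, z \in A & x != z.
  case: tA xA => p [q [r [-> /and5P[pq pr qr _ _]]]].
  rewrite !inE -!orbA => /or3P[]/eqP->; [exists q|exists p|exists p]; rewrite ?inE ?eqxx ?orbT //.
  by rewrite eq_sym.
  by rewrite eq_sym.
have [v [-> t]] := triset_edge cs tA xA zA xz.
exists z, v; split; last by rewrite (triCr cs) (triCl cs).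
by apply/setP => w; rewrite !inE; case: (w == x); case: (w == z); case: (w == v).
Qed.

Lemma wt_triple c x u v : tri c x u v -> wt y [set x; u; v] = y x u + y x v + y u v.
Proof.
move=> /and5P[xu xv uv _ _].
have -> : [set x; u; v] = x |: (u |: [set v]).
  by apply/setP => w; rewrite !inE orbA.
rewrite !wt_setU1 // ?inE ?negb_or ?xu ?xv ?uv // wt_set1 // /cost.
by rewrite big_set1 big_setU1 ?inE ?uv // big_set1 /=; ring.
Qed.

Lemma triset_wt c A K : triset c A -> A \subset K -> covers c y K -> 1 <= wt y A.
Proof.
case=> x [u [v [-> t]]] /subsetP AK cv; rewrite (wt_triple t).
by apply: cv => //; apply: AK; rewrite !inE eqxx ?orbT.
Qed.

Section LowDegree.
Variables (c : rel T) (cs : symmetric c) (K : {set T}).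
Hypothesis (cv : covers c y K) (low : forall x, x \in K -> cost y K x < 1).

Lemma triset_share A B x z : triset c A -> triset c B -> A \subset K -> B \subset K ->
  x != z -> x \in A -> z \in A -> x \in B -> z \in B -> A = B.
Proof.
move=> tA tB /subsetP AK /subsetP BK xz xA zA xB zB.
have [v [EA t1]] := triset_edge cs tA xA zA xz.
have [v' [EB t2]] := triset_edge cs tB xB zB xz.
have [vv'|vv'] := eqVneq v v'; first by rewrite EA EB vv'.
have vK : v \in K by apply: AK; rewrite EA !inE eqxx orbT.
have vK' : v' \in K by apply: BK; rewrite EB !inE eqxx orbT.
have h := two_tri_share_edge yW cv (AK _ xA) (AK _ zA) vK vK' vv' t1 t2.
have h1 := low (AK _ xA); have h2 := low (AK _ zA).
exfalso; clear EA EB; lra.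
Qed.

(** By [triset_share] distinct triangles have no common pair, so their weights add up. A six-set
    lighter than 3 therefore has at most two. *)
Lemma three_trisets A B C : triset c A -> triset c B -> triset c C ->
  A \subset K -> B \subset K -> C \subset K -> A != B -> A != C -> B != C -> 3 <= wt y K.
Proof.
move=> tA tB tC AK BK CK /eqP AB /eqP AC /eqP BC.
have E (X : {set T}) : X \subset K -> wt y X =
    (\sum_(x in K) \sum_(z in K) ((x \in X) && (z \in X))%:R * y x z) / 2.
  move=> XK; rewrite /wt; congr (_ / 2).
  have H (g : T -> R) : \sum_(x in X) g x = \sum_(x in K) (x \in X)%:R * g x.
    rewrite big_mkcond [RHS]big_mkcond; apply: eq_bigr => x _.
    case xX: (x \in X); first by rewrite (subsetP XK) // mul1r.
    by case: ifP; rewrite ?mul0r.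
  rewrite H; apply: eq_bigr => x _; rewrite H mulr_sumr; apply: eq_bigr => z _.
  by case: (x \in X); case: (z \in X); rewrite /= ?(mul1r, mul0r).
have le : wt y A + wt y B + wt y C <= wt y K.
  rewrite (E A) // (E B) // (E C) // /wt -!mulrDl ler_pM2r ?invr_gt0 ?ltr0n // -!big_split /=.
  apply: ler_sum => x xK; rewrite -!big_split /=; apply: ler_sum => z zK.
  have [->|xz] := eqVneq x z; first by rewrite ydiag !mulr0 !addr0.
  rewrite -!mulrDl -[leRHS]mul1r; apply: ler_wpM2r => //.
  have := @triset_share A B x z tA tB AK BK xz; have := @triset_share A C x z tA tC AK CK xz.
  have := @triset_share B C x z tB tC BK CK xz.
  case: (x \in A); case: (z \in A); case: (x \in B); case: (z \in B);
   case: (x \in C); case: (z \in C) => //= h1 h2 h3; rewrite ?addr0 ?add0r //;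
   by [case: AB; apply: h3|case: AC; apply: h2|case: BC; apply: h1].
have := triset_wt tA AK cv; have := triset_wt tB BK cv; have := triset_wt tC CK cv.
lra.
Qed.

(** Goodman's bound gives 12 ordered triples, while a single triangle accounts for only 6. *)
Lemma two_trisets : #|K| = 6%N -> exists A B,
  [/\ triset c A, triset c B, A \subset K, B \subset K & A != B].
Proof.
move=> K6; have := goodman cs K; rewrite K6 /=.
have -> : (3 * (6 * ((5 * 5) %/ 4)) = 108)%N by [].
have -> : (6 * (5 * 4) = 120)%N by [].
move=> H; have {}H : (12 <= ntri c K)%N by move: (ntri c K) H => m; lia.
have find (P : T -> T -> T -> bool) :
    (forall x u v, x \in K -> u \in K -> v \in K -> tri c x u v -> P x u v) \/
    exists x u v, [/\ x \in K, u \in K, v \in K, tri c x u v & ~~ P x u v].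
  have [/existsP[x /existsP[u /existsP[v /and5P[? ? ? ? ?]]]]|N] :=
    boolP [exists x, exists u, exists v, [&& x \in K, u \in K, v \in K, tri c x u v & ~~ P x u v]].
    by right; exists x, u, v.
  left=> x u v xK uK vK t; apply: contraR N => nP.
  apply/existsP; exists x; apply/existsP; exists u; apply/existsP; exists v.
  by rewrite xK uK vK t nP.
have [N|[x [u [v [xK uK vK t _]]]]] := find (fun _ _ _ => false).
  suff : ntri c K = 0%N by move=> E; rewrite E in H.
  rewrite /ntri big1 // => x xK; rewrite big1 // => u uK; rewrite big1 // => v vK.
  by case t: (tri c x u v) => //; have := N _ _ _ xK uK vK t.
pose A := [set x; u; v].
have tA : triset c A by exists x, u, v.
have sub p q r : p \in K -> q \in K -> r \in K -> [set p; q; r] \subset K.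
  by move=> pK qK rK; apply/subsetP => w; rewrite !inE -orbA => /or3P[]/eqP->.
have AK : A \subset K by exact: sub.
have [N|[p [q [r [pK qK rK t' nA]]]]] := find (fun p q r => [&& p \in A, q \in A & r \in A]).
  have cA : #|A| = 3%N.
    by have /and5P[xu xv uv _ _] := t; rewrite /A -setUA cardsU1 cards2 !inE negb_or xu xv uv.
  have := sum_distinct A; rewrite cA /= => sd.
  suff : (ntri c K <= 6)%N by move=> E; have := leq_trans H E.
  rewrite -[6%N]sd /ntri [leqRHS]big_mkcond [leqLHS]big_mkcond; apply: leq_sum => p _.
  case pK: (p \in K); last by case: ifP.
  rewrite [leqLHS]big_mkcond; case pA: (p \in A); last first.
    rewrite big1 // => q _; case qK: (q \in K) => //; rewrite big1 // => r rK.
    by case t': (tri c p q r) => //; have := N _ _ _ pK qK rK t'; rewrite pA.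
  rewrite [leqRHS]big_mkcond; apply: leq_sum => q _.
  case qK: (q \in K); last by case: ifP.
  rewrite [leqLHS]big_mkcond; case qA: (q \in A); last first.
    rewrite big1 // => r _; case rK: (r \in K) => //.
    by case t': (tri c p q r) => //; have := N _ _ _ pK qK rK t'; rewrite qA andbF.
  rewrite [leqRHS]big_mkcond; apply: leq_sum => r _.
  case rK: (r \in K); last by case: ifP.
  case t': (tri c p q r); last by case: ifP.
  have /and3P[_ _ ->] := N _ _ _ pK qK rK t'.
  by have /and5P[-> -> -> _ _] := t'.
exists A, [set p; q; r]; split=> //; first by exists p, q, r.
  exact: sub.
apply: contraNneq nA => ->; by rewrite !inE !eqxx ?orbT.
Qed.

End LowDegree.
End TriangleSets.

(** * A sparse six-set beside a zero triangle *)

Section Core.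
Variables (R : realFieldType) (T : finType).
Variables (y : T -> T -> R) (yW : weighting y).
Implicit Types (c : rel T) (A B K : {set T}) (f : nat -> T).

(** Since [wt y K < 3], the triangles [A] and [B] are the only monochromatic ones in [K], as the
    tables require; the root for their two colours then gives the bound. *)
Lemma core_table c (cs : symmetric c) t1 t2 es (idx : bool -> bool -> nat) f K A B :
  (forall b1 b2, root_ok t1 t2 es (idx b1 b2) b1 b2) ->
  all (fun i => (i < 6)%N) t1 -> all (fun i => (i < 6)%N) t2 ->
  A = im f t1 -> B = im f t2 -> K = im f (iota 0 6) ->
  uniq (map f (iota 0 9)) ->
  [/\ y (f 6) (f 7) = 0, y (f 6) (f 8) = 0 & y (f 7) (f 8) = 0] ->
  [/\ c (f 6) (f 7), c (f 7) (f 8) & ~~ c (f 6) (f 8)] ->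
  triset c A -> triset c B -> A != B -> 
  (forall x, x \in K -> cost y K x < 1) -> wt y K < 3 ->
  covers c y (im f (iota 0 9)) -> fives y (im f (iota 0 9)) (79 / 75) ->
  433 / 75 <= wt y (im f (iota 0 9)).
Proof.
move=> Hroot /allP t16 /allP t26 EA EB EK uf fz fc tA tB AB low K3 cv H5.
have sub s : {in s, forall i, (i < 6)%N} -> im f s \subset K.
  move=> s6; rewrite EK; apply/subsetP => x; rewrite !in_set => /mapP[i /s6 i6 ->].
  by rewrite map_f // mem_iota.
have AK : A \subset K by rewrite EA; exact: sub.
have BK : B \subset K by rewrite EB; exact: sub.
have KW : K \subset im f (iota 0 9).
  rewrite EK; apply/subsetP => x; rewrite !in_set => /mapP[i]; rewrite mem_iota => i6 ->.
  by rewrite map_f // mem_iota; lia.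
have inim i s : (i < 6)%N -> {in s, forall j, (j < 6)%N} -> f i \in im f s -> i \in s.
  move=> i6 s6; rewrite in_set => /mapP[j js /eqP]; have j6 := s6 j js.
  by rewrite f_inj // => [/eqP->//||]; lia.
have Hf : placed y c [:: t1; t2] f.
  split=> // i j k i6 j6 k6 t.
  pose C := [set f i; f j; f k].
  have tC : triset c C by exists (f i), (f j), (f k).
  have CK : C \subset K.
    apply/subsetP => x; rewrite !inE -orbA => /or3P[]/eqP->; by rewrite EK in_set map_f // mem_iota.
  have : (C == A) || (C == B).
    apply: contraT; rewrite negb_or => /andP[CA CB].
    have := three_trisets yW cs (coversS KW cv) low tA tB tC AK BK CK AB.
    by rewrite eq_sym CA eq_sym CB => /(_ isT isT); rewrite leNgt K3.
  have Ci : f i \in C by rewrite !inE eqxx.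
  have Cj : f j \in C by rewrite !inE eqxx !orbT.
  have Ck : f k \in C by rewrite !inE eqxx !orbT.
  case/orP=> /eqP E; rewrite E ?EA ?EB in Ci Cj Ck; apply/hasP.
    by exists t1; rewrite ?inE ?eqxx // !inim.
  by exists t2; rewrite ?inE ?eqxx ?orbT // !inim.
have [b1 Hb1] := triset_col cs tA; have [b2 Hb2] := triset_col cs tB.
have /and4P[tab nes /allP p0 /allP Hr] := Hroot b1 b2.
apply: (table_sound yW cs tab nes Hf); split.
- move=> i j b i9 j9 ij eb.
  have := Hr i; rewrite mem_iota => /(_ i9)/allP/(_ j); rewrite mem_iota => /(_ j9).
  rewrite eb (negbTE ij) /= => /or3P[|/and3P[i1 j1 /eqP bb]|/and3P[i1 j1 /eqP bb]].
  + by case: (b).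
  + rewrite Hb1 ?EA ?in_set ?map_f ?f_inj //; first by move: bb; case: (b); case: (b1).
  + rewrite Hb2 ?EB ?in_set ?map_f ?f_inj //; first by move: bb; case: (b); case: (b2).
- by move=> k k6; have := p0 k; rewrite mem_iota k6 => /(_ isT)/eqP ->.
- by move=> k k6; have := p0 k; rewrite mem_iota k6 => /(_ isT)/eqP ->.
Qed.

Lemma core_triangle_norm c (cs : symmetric c) K a b d :
  #|K| = 6%N -> (forall x, x \in K -> cost y K x < 1) -> wt y K < 3 ->
  #|K :|: [set a; b; d]| = 9%N ->
  covers c y (K :|: [set a; b; d]) -> fives y (K :|: [set a; b; d]) (79 / 75) ->
  y a b = 0 -> y a d = 0 -> y b d = 0 -> c a b -> c b d -> ~~ c a d ->
  433 / 75 <= wt y (K :|: [set a; b; d]).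
Proof.
move=> K6 low K3 W9 cv H5 z1 z2 z3 c1 c2 c3.
have cvK := coversS (subsetUl _ _) cv.
have [A [B [tA tB AK BK AB]]] := two_trisets cs K6.
have imE s f : f =1 nth a s -> size s = 9%N -> [set x in s] = K :|: [set a; b; d] ->
  uniq (map f (iota 0 9)) /\ im f (iota 0 9) = K :|: [set a; b; d].
  move=> fE ss E.
  have mE : map f (iota 0 9) = s.
    apply: (@eq_from_nth _ a); rewrite ?size_map ?size_iota // => i i9.
    by rewrite (nth_map 0%N) ?size_iota // nth_iota.
  rewrite /im mE E; split=> //.
  by apply/card_uniqP; rewrite ss -W9 -E cardsE.
have cvW := cv.
have [/set0Pn[x /setIP[xA xB]]|] := boolP (A :&: B != set0).
  have [p [q [EA t1]]] := triset_vertex cs tA xA.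
  have [r [s [EB t2]]] := triset_vertex cs tB xB.
  have card3 (u v w : T) : tri c u v w -> #|[set u; v; w]| = 3%N.
    by move=> /and5P[uv uw vw _ _]; rewrite -setUA cardsU1 cards2 !inE negb_or uv uw vw.
  have AB1 : A :&: B = [set x].
    apply/setP => z; rewrite !inE; apply/andP/eqP => [[zA zB]|->//].
    apply/eqP; apply: contraNT AB => zx; apply/eqP.
    exact: (triset_share yW cs cvK low tA tB AK BK zx).
  have cAB : #|A :|: B| = 5%N by rewrite cardsU AB1 cards1 EA EB !card3.
  have ABK : A :|: B \subset K by rewrite subUset AK.
  have : (0 < #|K :\: (A :|: B)|)%N by rewrite cardsD (setIidPr ABK) K6 cAB.
  case/card_gt0P => w; rewrite !inE negb_or => /andP[/andP[wA wB] wK].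
  have EK : K = [set p; q; w; r; s; x].
    have -> : [set p; q; w; r; s; x] = w |: (A :|: B).
      rewrite EA EB; apply/setP => z; rewrite !inE.
      by case: (z == p); case: (z == q); case: (z == w); case: (z == r); case: (z == s); case: (z == x).
    apply/esym/eqP; rewrite eqEcard subUset sub1set wK ABK cardsU1 !inE negb_or wA wB cAB K6 //.
  (* The common vertex [x] takes position 5 and the vertex [w] outside both triangles position 2, as
     in [table_S]. *)
  pose f := nth a [:: p; q; w; r; s; x; a; b; d].
  have [|uf imf] := @imE [:: p; q; w; r; s; x; a; b; d] f (fun=> erefl) erefl.
    by rewrite EK; apply/setP => z; rewrite !inE !orbA.
  rewrite -imf; apply: (@core_table c cs _ _ _ _ f K A B root_S) => //.
  - by rewrite EA; apply/setP => z; rewrite !inE !orbA.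
  - by rewrite EB; apply/setP => z; rewrite !inE !orbA.
  - by rewrite EK; apply/setP => z; rewrite !inE !orbA.
  - by rewrite imf.
  - by rewrite imf.
rewrite negbK setI_eq0 => dAB.
have [p [q [r [EA t1]]]] := tA; have [s [t [u [EB t2]]]] := tB.
have card3 (u' v w : T) : tri c u' v w -> #|[set u'; v; w]| = 3%N.
  by move=> /and5P[uv uw vw _ _]; rewrite -setUA cardsU1 cards2 !inE negb_or uv uw vw.
have ABK : A :|: B \subset K by rewrite subUset AK.
have EK : K = [set p; q; r; s; t; u].
  have -> : [set p; q; r; s; t; u] = A :|: B.
    by rewrite EA EB; apply/setP => z; rewrite !inE !orbA.
  apply/esym/eqP; rewrite eqEcard ABK K6.
  have /eqP := leq_card_setU A B; move: dAB; rewrite -(leq_card_setU A B) => /eqP ->.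
  by rewrite EA EB !card3.
pose f := nth a [:: p; q; r; s; t; u; a; b; d].
have [|uf imf] := @imE [:: p; q; r; s; t; u; a; b; d] f (fun=> erefl) erefl.
  by rewrite EK; apply/setP => z; rewrite !inE !orbA.
rewrite -imf; apply: (@core_table c cs _ _ _ _ f K A B root_D) => //.
- by rewrite EA; apply/setP => z; rewrite !inE !orbA.
- by rewrite EB; apply/setP => z; rewrite !inE !orbA.
- by rewrite EK; apply/setP => z; rewrite !inE !orbA.
- by rewrite imf.
- by rewrite imf.
Qed.

Lemma core_triangle c (cs : symmetric c) K a b d :
  #|K| = 6%N -> (forall x, x \in K -> cost y K x < 1) -> wt y K < 3 ->
  #|K :|: [set a; b; d]| = 9%N ->
  covers c y (K :|: [set a; b; d]) -> fives y (K :|: [set a; b; d]) (79 / 75) ->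
  a != b -> a != d -> b != d ->
  y a b = 0 -> y a d = 0 -> y b d = 0 ->
  433 / 75 <= wt y (K :|: [set a; b; d]).
Proof.
move=> K6 low K3 W9 cv H5 ab ad bd z1 z2 z3.
have [ysym _ _] := yW.
(* Exactly one of the three vertices has its two edges of the triangle in one
   colour; up to swapping the colours it is the middle one and both are red. *)
have wlog_col c' : symmetric c' -> covers c' y (K :|: [set a; b; d]) ->
   (c' a b && c' b d && ~~ c' a d) || (c' a b && c' a d && ~~ c' b d) ||
   (c' a d && c' b d && ~~ c' a b) -> 433 / 75 <= wt y (K :|: [set a; b; d]).
  move=> cs' cv' /orP[/orP[|]|] /andP[/andP[h1 h2] h3].
  - exact: (core_triangle_norm cs').
  - have E : [set a; b; d] = [set b; a; d] by rewrite (setUC [set a]).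
    rewrite E in W9 cv' H5 *; apply: (core_triangle_norm cs') => //; [by rewrite ysym|by rewrite cs'].
  - have E : [set a; b; d] = [set a; d; b] by rewrite setUAC.
    rewrite E in W9 cv' H5 *; apply: (core_triangle_norm cs') => //; [by rewrite ysym|by rewrite cs'].
pose nc : rel T := fun x z => ~~ c x z.
have ncs : symmetric nc by move=> x z; rewrite /nc cs.
have ncv : covers nc y (K :|: [set a; b; d]).
  move=> x u v xS uS vS t; apply: cv => //; move: t; rewrite /tri /nc.
  by case: (c x u); case: (c x v); case: (c u v).
have nt : ~~ tri c a b d.
  apply/negP => /(cv _ _ _); rewrite !inE !eqxx !orbT z1 z2 z3 => /(_ isT isT isT).
  by rewrite !addr0 ler10.
move: nt (wlog_col c cs cv) (wlog_col nc ncs ncv); rewrite /tri /nc ab ad bd /=.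
by case: (c a b); case: (c a d); case: (c b d) => //= _ h1 h2; (exact: h1 || exact: h2).
Qed.

End Core.

(** * The lower bound recursion *)

Section Recursion.
Variables (R : realFieldType) (T : finType).

(* The increment [n'.+2 + 58 / 75] is the gain from removing a six-set [K] beside
   the weight-0 triangle [Q]: 433/75 for [K] and [Q] together, and 1 for each of
   the [n'.+4.+2 - 9] other vertices. *)
Fixpoint gbound (n : nat) : R :=
  match n with
  | n'.+4.+2 => match n' with
                | 0 => 2 | 1 => 3 | 2 => 4 | 3 => 26 / 5
                | _ => gbound n' + n'.+2%:R + 58 / 75
                end
  | 5 => 1
  | _ => 0
  end.

Lemma gboundE n : (4 <= n)%N -> gbound n.+4.+2 = gbound n + n.+2%:R + 58 / 75.
Proof. by case: n => [|[|[|[|n]]]]. Qed.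

(** Used when a five-set is removed in place of a six-set: the remainder then has one vertex
    more. *)
Lemma gbound_diff n : (4 <= n)%N -> gbound n + 1 <= gbound n.+1.
Proof.
elim/ltn_ind: n => n IH; case: n IH => [|[|[|[|[|[|[|[|[|[|n]]]]]]]]]] IH // _; try by rewrite /=; lra.
have H : gbound n.+4 + 1 <= gbound n.+4.+1 by apply: IH; lia.
rewrite (gboundE (n := n.+4)) // (gboundE (n := n.+4.+1)) //.
have E : n.+4.+1.+2%:R = n.+4.+2%:R + 1 :> R by rewrite natr1.
move: E H; lra.
Qed.

Variables (y : T -> T -> R) (yW : weighting y) (c : rel T) (cs : symmetric c).
Implicit Types S K Q L : {set T}.

Lemma remove_part S Q L : Q \subset S -> L \subset S :\: Q -> wt y Q = 0 ->
  (forall x, x \in S :\: Q -> x \notin L -> 1 <= cost y L x) ->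
  wt y (S :\: L) + wt y (L :|: Q) + (#|S| - #|Q| - #|L|)%:R <= wt y S.
Proof.
move=> QS LO Q0 H.
have LS : L \subset S by apply: subset_trans LO (subsetDl _ _).
have dLQ : [disjoint L & Q].
  by apply: disjointWl LO _; rewrite -setI_eq0 setIDAC setIC setDIl setDv set0I.
have QL : Q \subset S :\: L.
  by rewrite subsetD QS disjoint_sym.
rewrite (wt_setD yW LS) (wt_setU yW dLQ) Q0 addr0 (sum_costC yW L Q).
rewrite [\sum_(x in S :\: L) _](big_setID Q) /= (setIidPr QL).
have : (#|S| - #|Q| - #|L|)%:R <= \sum_(x in (S :\: L) :\: Q) cost y L x.
  apply: (@le_trans _ _ (\sum_(x in (S :\: L) :\: Q) 1)).
    rewrite sumr_const; rewrite ler_nat.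
    by rewrite cardsD (setIidPr QL) cardsD (setIidPr LS); lia.
  by apply: ler_sum => x; rewrite !inE => /and3P[xQ xL xS]; apply: H; rewrite // inE xQ.
lra.
Qed.

Variables (a b d : T).
Hypotheses (ab : a != b) (ad : a != d) (bd : b != d).
Hypotheses (zab : y a b = 0) (zad : y a d = 0) (zbd : y b d = 0).
Let Q := [set a; b; d].

Lemma cardQ : #|Q| = 3%N.
Proof. by rewrite /Q -setUA cardsU1 cards2 !inE negb_or ab ad bd. Qed.

Lemma wtQ : wt y Q = 0.
Proof.
have -> : Q = a |: (b |: [set d]) by apply/setP => w; rewrite !inE orbA.
rewrite !(wt_setU1 yW) // ?inE ?negb_or ?ab ?ad ?bd // wt_set1 // /cost.
by rewrite big_set1 big_setU1 ?inE ?bd // big_set1 /= zab zad zbd !addr0.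
Qed.

(** Deleting any [x] outside [Q] leaves weight at least 4, so [4 + cost y S x <= wt y S]. Over the
    six such vertices the costs sum to [wt y (S :\: Q) + wt y S], whose first term is at least 2.
    Thus 24 + 2 <= 5 [wt y S]. *)
Lemma nine_ge S : covers c y S -> fives y S 1 -> Q \subset S -> #|S| = 9%N ->
  26 / 5 <= wt y S.
Proof.
move=> cv H5 QS S9; have OS : S :\: Q \subset S by exact: subsetDl.
have O6 : #|S :\: Q| = 6%N by rewrite cardsD (setIidPr QS) S9 cardQ.
have O2 : 2 <= wt y (S :\: Q).
  by apply: (six_ge2 yW cs (coversS OS cv)) => //; exact: fivesS H5.
have H : \sum_(x in S :\: Q) (4 + cost y S x) <= \sum_(x in S :\: Q) wt y S.
  apply: ler_sum => x; rewrite inE => /andP[_ xS]; rewrite (wt_setD1 yW xS) lerD2r.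
  have sub := subsetDl S [set x].
  apply: (eight_ge4 yW cs (coversS sub cv)) => //; first exact: fivesS H5.
  by move: S9; rewrite (cardsD1 x) xS => -[].
have E : \sum_(x in S :\: Q) cost y S x = wt y (S :\: Q) + wt y S.
  have dOQ : [disjoint S :\: Q & Q].
    by rewrite -setI_eq0 setIDAC setIC setDIl setDv set0I.
  have SE : S = (S :\: Q) :|: Q by rewrite -{1}(setID S Q) (setIidPr QS) setUC.
  rewrite [in RHS]SE (wt_setU yW dOQ) wtQ addr0.
  rewrite (eq_bigr (fun x => cost y (S :\: Q) x + cost y Q x)) => [|x _]; last first.
    by rewrite {1}SE cost_setU.
  rewrite big_split /= sum_cost //.
  have -> : (S :\: Q :|: Q) :\: Q = S :\: Q by rewrite -SE.
  lra.
move: H; rewrite big_split /= E !sumr_const O6.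
move: O2; set u := wt y (S :\: Q); set v := wt y S; lra.
Qed.

(** Compare a lightest six-set [K] and a lightest five-set [L] outside [Q]. If
    [wt y K < 1 + wt y L], no vertex of [K] costs 1 or more, because deleting it would leave less
    than [wt y L]; so [K] is sparse and [core_triangle] applies. Otherwise each vertex outside [L]
    and [Q] has cost at least 1 towards [L], and [L] is removed instead. *)
Lemma zero_triangle_bound S : covers c y S -> fives y S (79 / 75) -> Q \subset S ->
  gbound #|S| <= wt y S.
Proof.
move: {2}#|S| (erefl #|S|) => N; elim/ltn_ind: N S => N IH S SN cv H5' QS.
have H5 : fives y S 1 by move=> K KS K5; apply: le_trans (H5' K KS K5); lra.
have [N4|N5] := leqP #|S| 4.
  have := wt_ge0 yW S; move: N4; case: #|S| => [|[|[|[|[|]]]]] //.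
have [N9|N10] := leqP #|S| 9.
  case E : #|S| N5 N9 => [|[|[|[|[|[|[|[|[|[|]]]]]]]]]] // _ _.
  - by apply: H5.
  - by apply: (six_ge2 yW cs).
  - by apply: (seven_ge3 yW cs).
  - by apply: (eight_ge4 yW cs).
  - by apply: nine_ge.
pose O := S :\: Q.
have OS : O \subset S by exact: subsetDl.
have cO : #|O| = (#|S| - 3)%N by rewrite cardsD (setIidPr QS) cardQ.
have gE : gbound #|S| = gbound (#|S| - 6) + (#|S| - 9)%:R + 433 / 75.
  rewrite {1}(_ : #|S| = (#|S| - 6).+4.+2); last by lia.
  rewrite gboundE; last by lia.
  have -> : (#|S| - 6).+2 = ((#|S| - 9) + 5)%N by lia.
  by rewrite natrD; lra.
have QK K : K \subset O -> Q \subset S :\: K.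
  move=> KO; rewrite subsetD QS disjoint_sym.
  by apply: disjointWl KO _; rewrite -setI_eq0 setIDAC setIC setDIl setDv set0I.
have dK K : K \subset O -> #|K :|: Q| = (#|K| + 3)%N.
  move=> KO; rewrite cardsU cardQ; have -> : K :&: Q = set0; last by rewrite cards0 subn0.
  apply/eqP; rewrite setI_eq0; apply: disjointWl KO _.
  by rewrite -setI_eq0 setIDAC setIC setDIl setDv set0I.
have KQS K : K \subset O -> K :|: Q \subset S.
  by move=> KO; rewrite subUset QS andbT; exact: subset_trans OS.
have rec K : K \subset O -> (0 < #|K|)%N -> gbound (#|S| - #|K|) <= wt y (S :\: K).
  move=> KO K0; have KS := subset_trans KO OS.
  have cK : #|S :\: K| = (#|S| - #|K|)%N by rewrite cardsD (setIidPr KS).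
  rewrite -cK; apply: (IH #|S :\: K|) => //; last exact: QK.
  - by rewrite cK -SN; have := subset_leq_card KS; lia.
  - exact: coversS (subsetDl _ _) cv.
  - exact: fivesS (subsetDl _ _) H5'.
have [K [KO K6 Kmin]] := @min_set R T y O 6 ltac:(lia).
have [L [LO L5 Lmin]] := @min_set R T y O 5 ltac:(lia).
have [KL|LK] := ltP (wt y K) (1 + wt y L).
  have low x : x \in K -> cost y K x < 1.
    move=> xK; have := wt_setD1 yW xK; have : wt y L <= wt y (K :\ x).
      apply: Lmin; first exact: subset_trans (subsetDl _ _) KO.
      by move: K6; rewrite (cardsD1 x) xK => -[].
    lra.
  have K3 : wt y K < 3.
    have : \sum_(x in K) cost y K x < \sum_(x in K) 1.
      apply: ltr_sum => //; have : (0 < #|K|)%N by rewrite K6.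
      by case/card_gt0P => x xK; apply/hasP; exists x => //; rewrite mem_index_enum.
    rewrite sum_cost // sumr_const K6; lra.
  have := @remove_part S Q K QS KO wtQ _.
  have cost1 x : x \in O -> x \notin K -> 1 <= cost y K x.
    apply: (min_six_cost yW cs (coversS OS cv)) => //.
    by move=> K' K'O; rewrite K6; apply: Kmin.
  move=> /(_ cost1); rewrite cardQ K6.
  have -> : (#|S| - 3 - 6 = #|S| - 9)%N by lia.
  have := rec K KO; rewrite K6 => /(_ isT).
  have := core_triangle yW cs K6 low K3 _ (coversS (KQS K KO) cv) (fivesS (KQS K KO) H5') ab ad bd zab zad zbd.
  rewrite dK // K6 => /(_ erefl); rewrite -/Q gE; lra.
(* With n = [#|S|], removing [L] gains 4 for [L] with [Q], n - 8 for the other vertices, and 1 from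
   [gbound_diff]: n - 3 in all, more than n - 9 + 433/75. *)
have := @remove_part S Q L QS LO wtQ _.
have cost1 x : x \in O -> x \notin L -> 1 <= cost y L x.
  move=> xO xL; have := wt_setU1 yW xL; have : wt y K <= wt y (x |: L).
    by apply: Kmin; rewrite ?subUset ?sub1set ?xO // cardsU1 xL L5.
  lra.
move=> /(_ cost1); rewrite cardQ L5.
have -> : (#|S| - 3 - 5 = (#|S| - 9) + 1)%N by lia.
have := rec L LO; rewrite L5 => /(_ isT).
have := eight_ge4 yW cs (coversS (KQS L LO) cv) (fivesS (KQS L LO) H5).
rewrite dK // L5 => /(_ erefl); rewrite gE natrD.
have := @gbound_diff (#|S| - 6) ltac:(lia).
have -> : (#|S| - 6).+1 = (#|S| - 5)%N by lia.
lra.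
Qed.

End Recursion.

(** * Optimal packings and covers *)

Section Optimum.
Variables (R : realFieldType) (T : finType).
Implicit Types (S A e : {set T}) (c : rel T).

Lemma sum_pairs (F : {set T} -> R) S :
  \sum_(x in S) \sum_(z in S | z != x) F [set x; z] =
  2 * \sum_(e : {set T} | (#|e| == 2) && (e \subset S)) F e.
Proof.
have inner x e : x \in S -> (#|e| == 2) && (e \subset S) ->
    \sum_(z in S | z != x) (e == [set x; z])%:R = (x \in e)%:R :> R.
  move=> xS /andP[/cards2P[p [q [pq ->]]] /subsetP eS].
  have pS : p \in S by apply: eS; rewrite !inE eqxx.
  have qS : q \in S by apply: eS; rewrite !inE eqxx orbT.
  have one u v : u \in S -> v \in S -> u != v ->
     \sum_(z in S | z != u) ([set u; v] == [set u; z])%:R = 1 :> R.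
    move=> uS vS uv; rewrite (bigD1 v) /=; last by rewrite vS eq_sym.
    rewrite eqxx big1 ?addr0 // => z /andP[/andP[zS zu] zv].
    case: eqP => // /setP/(_ z); rewrite !inE eqxx orbT (negbTE zu) (negbTE zv).
    by [].
  rewrite !inE; have [->|xp] := eqVneq x p; first by rewrite one.
  have [->|xq] := eqVneq x q; first by rewrite setUC one // eq_sym.
  rewrite big1 // => z _; case: eqP => // /setP/(_ x); rewrite !inE eqxx.
  by rewrite (negbTE xp) (negbTE xq).
have ex x z : x \in S -> (z \in S) && (z != x) -> F [set x; z] =
    \sum_(e : {set T} | (#|e| == 2) && (e \subset S)) (e == [set x; z])%:R * F e.
  move=> xS /andP[zS zx]; rewrite (bigD1 [set x; z]) /=; last first.
    by rewrite cards2 (eq_sym x) zx subUset !sub1set xS zS.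
  by rewrite eqxx mul1r big1 ?addr0 // => e /andP[_ /negbTE ->]; rewrite mul0r.
under eq_bigr => x xS do under eq_bigr => z zS do rewrite (ex x z xS zS).
under eq_bigr => x xS do rewrite exchange_big /=.
rewrite exchange_big /= mulr_sumr; apply: eq_bigr => e eP.
under eq_bigr => x xS do rewrite -mulr_suml (inner x e xS eP).
rewrite -mulr_suml; congr (_ * _).
have /andP[/eqP e2 /subsetP eS] := eP.
have -> : 2 = #|e|%:R :> R by rewrite e2.
rewrite -natr_sum -sum1_card big_mkcond [in RHS]big_mkcond /=.
congr (_%:R); apply: eq_bigr => x _; case xe: (x \in e); first by rewrite eS.
by case: ifP.
Qed.

Definition monoset c S A : bool := (A \subset S) &&
  [exists x, exists u, exists v, (A == [set x; u; v]) && tri c x u v].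

Lemma monosetP c S A : reflect (A \subset S /\ triset c A) (monoset c S A).
Proof.
apply: (iffP andP) => -[AS].
  case/existsP=> x /existsP[u /existsP[v /andP[/eqP E t]]]; split=> //; by exists x, u, v.
case=> x [u [v [E t]]]; split=> //.
by apply/existsP; exists x; apply/existsP; exists u; apply/existsP; exists v; rewrite E eqxx t.
Qed.

Lemma card_triset c A : triset c A -> #|A| = 3%N.
Proof.
case=> x [u [v [-> /and5P[xu xv uv _ _]]]].
by rewrite -setUA cardsU1 cards2 !inE negb_or xu xv uv.
Qed.

Definition tload c S (w : {set T} -> R) x z : R :=
  \sum_(A | [&& monoset c S A, x \in A & z \in A]) w A.

(** A fractional packing [w] and a cover [y] of equal value, linked by complementary slackness. [w]
    is defined on all sets, but only its values on monochromatic triangles inside [S] count. *)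
Record optimal c S (w : {set T} -> R) (y : T -> T -> R) : Prop := Optimal {
  opt_weighting : weighting y;
  opt_covers : covers c y S;
  opt_ge0 : forall A, 0 <= w A;
  opt_load : forall x z, x \in S -> z \in S -> x != z -> tload c S w x z <= 1;
  opt_tight : forall A, monoset c S A -> 0 < w A -> wt y A = 1;
  opt_sat : forall x z, x \in S -> z \in S -> 0 < y x z -> tload c S w x z = 1;
  opt_val : wt y S = \sum_(A | monoset c S A) w A }.

Lemma sum_tload c S w :
  \sum_(x in S) \sum_(z in S | z != x) tload c S w x z =
  6 * \sum_(A | monoset c S A) w A.
Proof.
rewrite /tload.
under eq_bigr => x _ do under eq_bigr => z _ do rewrite big_mkcondr /=.
under eq_bigr => x _ do rewrite exchange_big /=.
rewrite exchange_big /= mulr_sumr; apply: eq_bigr => A /monosetP[/subsetP AS tA].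
transitivity (\sum_(x in A) \sum_(z in A | z != x) w A).
  rewrite big_mkcond [RHS]big_mkcond; apply: eq_bigr => x _.
  case xA: (x \in A); last by case: ifP => // _; rewrite big1.
  rewrite AS //= big_mkcond [RHS]big_mkcond; apply: eq_bigr => z _.
  case zA: (z \in A); first by rewrite AS.
  by case: ifP.
have E x : x \in A -> \sum_(z in A | z != x) w A = 2 * w A.
  move=> xA; rewrite (eq_bigl (mem (A :\ x))) => [|z]; last by rewrite !inE andbC.
  rewrite sumr_const; have := card_triset tA; rewrite (cardsD1 x) xA add1n => -[->].
  by rewrite mulr_natl.
rewrite (eq_bigr _ E) sumr_const (card_triset tA) -mulrnAl; congr (_ * _).
by rewrite -mulr_natr; ring.
Qed.

Lemma wt_pairs (Y : {set T} -> R) (y : T -> T -> R) A :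
  (forall x z, x \in A -> z \in A -> y x z = if x != z then Y [set x; z] else 0) ->
  wt y A = \sum_(e : {set T} | (#|e| == 2) && (e \subset A)) Y e.
Proof.
move=> H; rewrite /wt [X in X / 2](_ : _ = 2 * \sum_(e : {set T} | (#|e| == 2) && (e \subset A)) Y e).
  by rewrite mulrAC divff ?mul1r // pnatr_eq0.
rewrite -sum_pairs.
apply: eq_bigr => x xA; rewrite [RHS]big_mkcondr /=; apply: eq_bigr => z zA.
by rewrite H // eq_sym.
Qed.

(** Rows and columns of the program are indexed by all sets; those that are not triangles, or not
    pairs, get coefficients 0. The constant weight 1 is a feasible cover. *)
Lemma optimum_exists c (cs : symmetric c) S : exists w y, optimal c S w y.
Proof.
pose a (A e : {set T}) : R := [&& monoset c S A, #|e| == 2 & e \subset A]%:R.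
pose cc A : R := (monoset c S A)%:R.
pose bb (e : {set T}) : R := ((#|e| == 2) && (e \subset S))%:R.
have sumb (Y : {set T} -> R) :
   \sum_e bb e * Y e = \sum_(e : {set T} | (#|e| == 2) && (e \subset S)) Y e.
  rewrite [RHS]big_mkcond; apply: eq_bigr => e _; rewrite /bb.
  by case: ifP; rewrite ?mul1r ?mul0r.
have suma (Y : {set T} -> R) A : monoset c S A ->
   \sum_e a A e * Y e = \sum_(e : {set T} | (#|e| == 2) && (e \subset A)) Y e.
  move=> mA; rewrite [RHS]big_mkcond; apply: eq_bigr => e _; rewrite /a mA /=.
  by case: ifP; rewrite ?mul1r ?mul0r.
have [||w [Y [w0 Y0 Hw HY le]]] := @lp_duality R _ _ a cc bb.
- by move=> e; rewrite /bb ler0n.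
- exists (fun=> 1) => // A; rewrite /cc; case mA: (monoset c S A); last first.
    by apply: sumr_ge0 => e _; rewrite mulr1 /a ler0n.
  rewrite suma //.
  have /monosetP[_ [x [u [v [-> /and5P[xu _ _ _ _]]]]]] := mA.
  rewrite (bigD1 [set x; u]) /=; last by rewrite cards2 xu subsetUl.
  by rewrite lerDl; apply: sumr_ge0.
have [val tight sat] := complementary_slackness w0 Y0 Hw HY le.
(* The dual solution is arbitrary on singletons and on sets not inside [S], so it is cut off
   there. *)
pose y x z : R := if [&& x != z, x \in S & z \in S] then Y [set x; z] else 0.
have yE A : A \subset S ->
    wt y A = \sum_(e : {set T} | (#|e| == 2) && (e \subset A)) Y e.
  move=> /subsetP AS; apply: wt_pairs => x z /AS xS /AS zS.
  by rewrite /y xS zS !andbT.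
have loadE x z : x \in S -> z \in S -> x != z ->
    \sum_A a A [set x; z] * w A = tload c S w x z.
  move=> xS zS xz; rewrite /tload [RHS]big_mkcond; apply: eq_bigr => A _.
  rewrite /a cards2 xz /= subUset !sub1set.
  by case: ifP; rewrite ?mul1r ?mul0r.
have bE x z : x \in S -> z \in S -> x != z -> bb [set x; z] = 1.
  by move=> xS zS xz; rewrite /bb cards2 xz subUset !sub1set xS zS.
have yW : weighting y.
  split=> [x z|x|x z]; rewrite /y.
  - by rewrite setUC eq_sym [(x \in S) && _]andbC.
  - by rewrite eqxx.
  - by case: ifP.
exists w, y; split=> //.
- move=> x u v xS uS vS t.
  have mA : monoset c S [set x; u; v].
    apply/monosetP; split; last by exists x, u, v.
    by rewrite !subUset !sub1set xS uS vS.
  have := HY [set x; u; v]; rewrite /cc mA suma // -yE; last by case/monosetP: mA.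
  by rewrite (wt_triple yW t).
- by move=> x z xS zS xz; rewrite -loadE // -(bE x z xS zS xz).
- move=> A mA wA; rewrite yE; last by case/monosetP: mA.
  by rewrite -suma // tight // /cc mA.
- move=> x z xS zS; rewrite {1}/y; case: ifP => [/and3P[xz _ _] yp|_]; last by rewrite ltxx.
  by rewrite -loadE // sat // bE.
- rewrite yE // -sumb val [RHS]big_mkcond; apply: eq_bigr => A _; rewrite /cc.
  by case: ifP; rewrite ?mul1r ?mul0r.
Qed.

End Optimum.

(** * Triangle-free graphs *)

Section TriangleFree.
Variables (R : realFieldType) (T : finType) (S : {set T}) (e : rel T).
Hypotheses (es : symmetric e)
  (tf : forall x u v, x \in S -> u \in S -> v \in S -> e x u -> e x v -> e u v -> False).

Definition nbh x := [set z in S | e x z].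
Definition dg x : R := #|nbh x|%:R.

Lemma nbh_disjoint x z : x \in S -> z \in S -> e x z -> [disjoint nbh x & nbh z].
Proof.
move=> xS zS exz; rewrite -setI_eq0; apply/eqP/setP => w; rewrite !inE.
by apply/negP => /andP[/andP[wS xw] /andP[_ zw]]; exact: (tf xS zS wS).
Qed.

Lemma dg_edge x z : x \in S -> z \in S -> e x z -> dg x + dg z <= #|S|%:R.
Proof.
move=> xS zS exz; rewrite /dg -natrD ler_nat.
have := nbh_disjoint xS zS exz; rewrite -(leq_card_setU (nbh x) (nbh z)) => /eqP <-.
by apply: subset_leq_card; rewrite subUset; apply/andP; split; apply/subsetP => w;
  rewrite inE => /andP[].
Qed.

Lemma sum_sqr_ge (f : T -> R) :
  (\sum_(x in S) f x) * (\sum_(x in S) f x) <= #|S|%:R * \sum_(x in S) f x * f x.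
Proof.
have : 0 <= \sum_(x in S) \sum_(z in S) (f x - f z) * (f x - f z).
  by apply: sumr_ge0 => x _; apply: sumr_ge0 => z _; rewrite -expr2 sqr_ge0.
rewrite (eq_bigr (fun x => #|S|%:R * (f x * f x) + \sum_(z in S) f z * f z
    - 2 * (f x * \sum_(z in S) f z))) => [|x _].
  rewrite sumrB big_split /= -mulr_sumr -mulr_sumr -mulr_suml sumr_const -mulr_natl.
  lra.
rewrite mulr_natl -sumr_const mulr_sumr mulr_sumr -big_split -sumrB /=.
by apply: eq_bigr => z _; ring.
Qed.

(** Summing the degrees of the ends over all edges counts each degree as often as its own value. The
    parameter [s] serves two uses: n for Mantel's bound and n - 2 for the search of a nearly
    spanning edge. *)
Lemma heavy_edge (s : R) :
  (forall x z, x \in S -> z \in S -> e x z -> dg x + dg z <= s) ->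
  2 * \sum_(x in S) dg x * dg x <= s * \sum_(x in S) dg x.
Proof.
move=> H.
have dgE x : dg x = \sum_(z in S) (e x z)%:R.
  rewrite /dg -sum1_card natr_sum big_mkcond [RHS]big_mkcond; apply: eq_bigr => z _.
  by rewrite inE; case: (z \in S); case: (e x z).
have <- : \sum_(x in S) \sum_(z in S) (e x z)%:R * (dg x + dg z) =
    2 * \sum_(x in S) dg x * dg x.
  under eq_bigr => x _ do under eq_bigr => z _ do rewrite mulrDr.
  under eq_bigr => x _ do rewrite big_split /= -mulr_suml -dgE.
  rewrite big_split /= [X in _ + X]exchange_big /=.
  under [X in _ + X]eq_bigr => x _ do
    under eq_bigr => z _ do rewrite es.
  under [X in _ + X]eq_bigr => x _ do rewrite -mulr_suml -dgE.
  ring.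
rewrite mulr_sumr; apply: ler_sum => x xS; rewrite {2}dgE mulr_sumr.
apply: ler_sum => z zS; case exz: (e x z); last by rewrite mul0r mulr0.
by rewrite mul1r mulr1; exact: H.
Qed.

(** [heavy_edge] with [s] equal to n bounds the sum of squared degrees from above, Cauchy-Schwarz
    from below. The degree sum is twice the number of edges. *)
Lemma mantel : 2 * \sum_(x in S) dg x <= #|S|%:R * #|S|%:R.
Proof.
have := heavy_edge dg_edge; have := sum_sqr_ge dg.
have m0 : 0 <= \sum_(x in S) dg x by apply: sumr_ge0 => x _; rewrite ler0n.
move: m0; set m := \sum_(x in S) dg x; set q := \sum_(x in S) _; set n : R := #|S|%:R.
have n0 : 0 <= n by rewrite ler0n.
move=> m0 h1 h2; rewrite leNgt; apply/negP => h3.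
have h4 : 2 * (m * m) <= n * (n * m).
  by apply: (@le_trans _ _ (n * (2 * q))); [lra|apply: ler_wpM2l].
have mp : 0 < m by move: (mulr_ge0 n0 n0); lra.
have : (n * n) * m < (2 * m) * m by rewrite ltr_pM2r.
lra.
Qed.

End TriangleFree.

(** * Numerical bounds *)

Section Psi.
Variable R : realFieldType.

(* [n(n-5)/10] satisfies [f (n+5) = f n + n]; [n(n-2)/12] is a third of the number
   of pairs outside a triangle-free graph with [n^2/4] edges. *)
Definition psi (n : nat) : R :=
  Num.min (n%:R * (n%:R - 5) / 10) (n%:R * (n%:R - 2) / 12).

Lemma psi_le1 n : psi n <= n%:R * (n%:R - 5) / 10.
Proof. by rewrite /psi ge_min lexx. Qed.

Lemma psi_le2 n : psi n <= n%:R * (n%:R - 2) / 12.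
Proof. by rewrite /psi ge_min lexx orbT. Qed.

Lemma psi_le0 n : (n <= 5)%N -> psi n <= 0.
Proof.
rewrite -(ler_nat R) => n5; apply: le_trans (psi_le1 _) _.
have : 0 <= n%:R :> R by rewrite ler0n.
nra.
Qed.

Lemma psi_ge20 n : (20 <= n)%N -> psi n = n%:R * (n%:R - 2) / 12.
Proof.
rewrite -(ler_nat R) => n20; rewrite /psi; apply/min_idPr; nra.
Qed.

Lemma psi_step n : psi n.+4.+1 <= psi n + n%:R.
Proof.
have n0 : 0 <= n%:R :> R by rewrite ler0n.
have E : n.+4.+1%:R = n%:R + 5 :> R by rewrite -natrD addnC.
rewrite [psi n]/psi; case: (leP (n%:R * (n%:R - 5) / 10) (n%:R * (n%:R - 2) / 12 : R)) => h.
  by apply: le_trans (psi_le1 _) _; rewrite E; lra.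
apply: le_trans (psi_le2 _) _; rewrite E; move: n0 h E; set x := n%:R => n0 h _.
have : 20 < x by rewrite ltNge; apply/negP => x20; nra.
lra.
Qed.

(** Here 71/75 is 2 - 79/75. Up to n = 19 the loss 4n/75 compared with [psi_step] is at most 79/75;
    from n = 20 on [psi] is n(n-2)/12, and that increases only by 5n/6 + 5/4. *)
Lemma psi_step_gap n : (1 <= n)%N ->
  psi n.+4.+1 <= psi n + n%:R * (71 / 75) + 79 / 75.
Proof.
move=> n1; have E : n.+4.+1%:R = n%:R + 5 :> R by rewrite -natrD addnC.
have [n19|n20] := leqP n 19.
  have := psi_step n; move: n19; rewrite -(ler_nat R); lra.
rewrite (psi_ge20 n20); apply: le_trans (psi_le2 _) _; rewrite E.
move: n20; rewrite -(ler_nat R); lra.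
Qed.

(** Over six steps n(n-2)/12 grows by n + 2 and [gbound] by 58/75 more. So the deficits at 4 to 9,
    the largest being 2/3 at 4, never exceed 58/75, and from 10 on there are none. *)
Lemma gbound_beta n : (4 <= n)%N -> n%:R * (n%:R - 2) / 12 <= gbound R n + 58 / 75.
Proof.
elim/ltn_ind: n => n IH; case: n IH => [|[|[|[|[|[|[|[|[|[|n]]]]]]]]]] IH // _; try by rewrite /=; lra.
rewrite (gboundE _ (n := n.+4)) //.
have := IH n.+4; have -> : n.+4.+4.+2%:R = n.+4%:R + 6 :> R by rewrite -natrD addnC.
have -> : n.+4.+2%:R = n.+4%:R + 2 :> R by rewrite -natrD addnC.
set x := n.+4%:R; move=> /(_ _ isT) H; have : x * (x - 2) / 12 <= gbound R n.+4 + 58 / 75.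
  by apply: H; lia.
lra.
Qed.

Lemma psi_gbound n : psi n <= gbound R n.
Proof.
case: n => [|[|[|[|[|[|[|[|[|[|n]]]]]]]]]]; try by apply: le_trans (psi_le1 _) _; rewrite /=; lra.
apply: le_trans (psi_le2 _) _.
rewrite (gboundE _ (n := n.+4)) //; have := @gbound_beta n.+4 isT.
have -> : n.+4.+4.+2%:R = n.+4%:R + 6 :> R by rewrite -natrD addnC.
have -> : n.+4.+2%:R = n.+4%:R + 2 :> R by rewrite -natrD addnC.
lra.
Qed.

(** Over six steps n(n-1)/12 grows by n + 5/2, less than the n + 2 + 58/75 of [gbound]; it remains
    to compute the values at 26 to 31. The closest is 58.52 against 58.5 at 27. *)
Lemma gbound_gt n : (26 <= n)%N -> n%:R * (n%:R - 1) / 12 < gbound R n.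
Proof.
elim/ltn_ind: n => n IH n26; have [n32|n32] := ltnP n 32.
  move: n26 n32; do 26 (case: n IH => [//|n] IH); rewrite !ltnS => _.
  case: n IH => [|[|[|[|[|[|//]]]]]] _ _; rewrite /=; lra.
have [m mE] : exists m, n = m.+4.+2 by exists (n - 6)%N; lia.
rewrite mE in IH n26 n32 *; have := IH m ltac:(lia) ltac:(lia).
rewrite gboundE; last by lia.
have -> : m.+4.+2%:R = m%:R + 6 :> R by rewrite -natrD addnC.
have -> : m.+2%:R = m%:R + 2 :> R by rewrite -natrD addnC.
lra.
Qed.

End Psi.

(** * Lower bounds for the weight of a cover *)

Section LowerBound.
Variables (R : realFieldType) (T : finType).
Implicit Types (S K A : {set T}) (c : rel T) (y : T -> T -> R) (w : {set T} -> R).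

Definition zeropair y : rel T := fun x z => (x != z) && (y x z == 0).

Lemma zero_sym y : weighting y -> symmetric (zeropair y).
Proof. by case=> ys _ _ x z; rewrite /zeropair eq_sym ys. Qed.

Lemma weak_duality c S w y y' : optimal c S w y -> weighting y' -> covers c y' S ->
  wt y S <= wt y' S.
Proof.
move=> Ho yW cv; have [_ _ yge0] := yW.
rewrite (opt_val Ho).
have -> : wt y' S = (\sum_(x in S) \sum_(z in S) y' x z) / 2 by [].
rewrite ler_pdivlMr ?ltr0n // mulr_suml.
apply: (@le_trans _ _ (\sum_(A | monoset c S A) \sum_(x in S) \sum_(z in S)
    w A * ((x \in A) && (z \in A))%:R * y' x z)).
  apply: ler_sum => A /monosetP[AS tA].
  have -> : \sum_(x in S) \sum_(z in S) w A * ((x \in A) && (z \in A))%:R * y' x z =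
      w A * (wt y' A * 2).
    rewrite /wt divfK ?pnatr_eq0 // mulr_sumr [RHS]big_mkcond [LHS]big_mkcond.
    apply: eq_bigr => x _; case xA: (x \in A); last first.
      by case: ifP => // _; rewrite big1 // => z _; rewrite mulr0 mul0r.
    rewrite (subsetP AS) // mulr_sumr [RHS]big_mkcond [LHS]big_mkcond.
    apply: eq_bigr => z _; case zA: (z \in A); last by case: ifP; rewrite // mulr0 mul0r.
    by rewrite (subsetP AS) // mulr1.
  apply: ler_wpM2l; first exact: (opt_ge0 Ho).
  by have := triset_wt yW tA AS cv; lra.
rewrite exchange_big /=; apply: ler_sum => x xS.
rewrite exchange_big /=; apply: ler_sum => z zS.
have [->|xz] := eqVneq x z.
  have [_ y0 _] := yW; rewrite y0 big1 // => A _; exact: mulr0.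
rewrite -mulr_suml -[leRHS]mul1r; apply: ler_wpM2r => //.
apply: le_trans (opt_load Ho xS zS xz); rewrite /tload [leRHS]big_mkcondr /=.
by apply: ler_sum => A _; case: ifP; rewrite ?mulr1 ?mulr0.
Qed.

(** The left side counts the ordered pairs of positive weight, each of which has load 1; the total
    load of ordered pairs is six times the value of the packing. *)
Lemma saturation c S w y : optimal c S w y ->
  #|S|%:R * (#|S|%:R - 1) - \sum_(x in S) dg R S (zeropair y) x <= 6 * wt y S.
Proof.
move=> Ho; have [_ yd yge0] := opt_weighting Ho.
rewrite (opt_val Ho) -sum_tload.
rewrite (_ : #|S|%:R * _ = \sum_(x in S) (#|S|%:R - 1)); last first.
  by rewrite sumr_const mulr_natl.
rewrite -sumrB; apply: ler_sum => x xS.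
apply: (@le_trans _ _ (\sum_(z in S | z != x) (~~ zeropair y x z)%:R)).
  rewrite lerBlDr.
  have -> : dg R S (zeropair y) x = \sum_(z in S | z != x) (zeropair y x z)%:R.
    rewrite /dg /nbh -sum1_card natr_sum big_mkcond [RHS]big_mkcond; apply: eq_bigr => z _.
    rewrite inE /zeropair (eq_sym x).
    by case: (z \in S); case: (z == x) => //=; case: (_ == _).
  rewrite -big_split /= (eq_bigr (fun=> 1)) => [|z _]; last by case: (zeropair y x z); rewrite /= ?addr0 ?add0r.
  rewrite (eq_bigl (mem (S :\ x))) => [|z]; last by rewrite !inE andbC.
  rewrite sumr_const (cardsD1 x S) xS natrD mulr1n; lra.
apply: ler_sum => z /andP[zS zx]; rewrite /zeropair eq_sym zx /=.
case: eqP => [_|/eqP yn] /=.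
  by apply: sumr_ge0 => A _; exact: (opt_ge0 Ho).
by rewrite (opt_sat Ho) // lt_def yn yge0.
Qed.

Lemma zero_triangle_or y S :
  (forall x u v, x \in S -> u \in S -> v \in S ->
     zeropair y x u -> zeropair y x v -> zeropair y u v -> False) \/
  exists a b d, [/\ [set a; b; d] \subset S, a != b, a != d & b != d] /\
    [/\ y a b = 0, y a d = 0 & y b d = 0].
Proof.
have [/existsP[a /existsP[b /existsP[d /and3P[aS bS /and4P[dS z1 z2 z3]]]]]|N] :=
  boolP [exists a, exists b, exists d, [&& a \in S, b \in S, d \in S,
    zeropair y a b, zeropair y a d & zeropair y b d]]; [right|left].
  exists a, b, d; move: z1 z2 z3 => /andP[ab /eqP ->] /andP[ad /eqP ->] /andP[bd /eqP ->].
  by rewrite !subUset !sub1set aS bS dS ab ad bd.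
move=> x u v xS uS vS h1 h2 h3; case/negP: N.
apply/existsP; exists x; apply/existsP; exists u; apply/existsP; exists v.
by rewrite xS uS vS h1 h2 h3.
Qed.

(** The cases are [wt y K] at most 1, below 79/75, or above, for a lightest five-set [K]. In the
    middle case [six_ge2] makes every other vertex pay [2 - wt y K]; the total decreases as [wt y K]
    grows, so its value at 79/75 is a lower bound. *)
Lemma small_five c (cs : symmetric c) y S : weighting y -> covers c y S ->
  (5 < #|S|)%N ->
  (forall K, K \subset S -> #|K| = 5%N -> psi R (#|S| - 5) <= wt y (S :\: K)) ->
  [\/ psi R (#|S| - 5) + (#|S| - 5)%:R <= wt y S,
      psi R (#|S| - 5) + (#|S| - 5)%:R * (71 / 75) + 79 / 75 <= wt y S |
      fives y S (79 / 75)].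
Proof.
move=> yW cv S5 IH.
have [K [KS K5 Kmin]] := @min_set R T y S 5 (ltnW S5).
have Hmin : min_wt y S K by move=> K' K'S; rewrite K5; apply: Kmin.
have cD : #|S :\: K| = (#|S| - 5)%N by rewrite cardsD (setIidPr KS) K5.
have IHK := IH K KS K5.
have sumc (r : R) : (forall x, x \in S -> x \notin K -> r <= cost y K x) ->
    (#|S| - 5)%:R * r <= \sum_(x in S :\: K) cost y K x.
  move=> H; rewrite -cD mulr_natl -sumr_const; apply: ler_sum => x.
  by rewrite inE => /andP[xK xS]; apply: H.
have E := wt_setD yW KS.
have [K1|K1] := leP (wt y K) 1.
  apply: Or31; have := wt_ge0 yW K.
  have := sumc 1 (fun x => min_five_cost yW cs cv Hmin KS K5 K1).
  move: E IHK; lra.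
have [K2|K2] := leP (79 / 75) (wt y K).
  by apply: Or33 => L LS L5; apply: le_trans K2 _; apply: Kmin.
apply: Or32.
have F1 : fives y S 1 by move=> L LS L5; apply: le_trans (ltW K1) _; apply: Kmin.
have := sumc (2 - wt y K) _; have H x : x \in S -> x \notin K -> 2 - wt y K <= cost y K x.
  move=> xS xK; have xKS : x |: K \subset S by rewrite subUset sub1set xS.
  have := six_ge2 yW cs (coversS xKS cv) (fivesS xKS F1).
  rewrite cardsU1 xK K5 => /(_ erefl); rewrite (wt_setU1 yW xK); lra.
move=> /(_ H); have : 1 <= (#|S| - 5)%:R :> R by rewrite ler1n; lia.
move: E IHK; set n := (#|S| - 5)%:R; set s := \sum_(x in _) _ => E IHK n1 h.
have : 0 <= (n - 1) * (79 / 75 - wt y K) by apply: mulr_ge0; lra.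
lra.
Qed.

Lemma lower_bound c (cs : symmetric c) S y : weighting y -> covers c y S ->
  psi R #|S| <= wt y S.
Proof.
move: {2}#|S| (erefl #|S|) => N; elim/ltn_ind: N S y => N IH S y0 SN yW0 cv0.
have [w [y Ho]] := @optimum_exists R T c cs S.
(* From here on the weighting is optimal on [S], so that [saturation] is available when the pairs of
   weight 0 are triangle-free. *)
apply: le_trans (weak_duality Ho yW0 cv0).
have yW := opt_weighting Ho; have cv := opt_covers Ho.
have [S5|S5] := leqP #|S| 5.
  exact: le_trans (psi_le0 _ S5) (wt_ge0 yW S).
have nE : (#|S| - 5).+4.+1 = #|S| by lia.
have [|h|h|F5] := small_five cs yW cv S5.
- move=> K KS K5; have cD : #|S :\: K| = (#|S| - 5)%N by rewrite cardsD (setIidPr KS) K5.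
  rewrite -cD; apply: (IH #|S :\: K|) => //; first by lia.
  exact: coversS (subsetDl _ _) cv.
- by apply: le_trans h; rewrite -{1}nE; apply: psi_step.
- apply: le_trans h; rewrite -{1}nE; apply: psi_step_gap; lia.
have [tf|[a [b [d [[QS ab ad bd] [z1 z2 z3]]]]]] := zero_triangle_or y S; last first.
  apply: le_trans (psi_gbound R #|S|) _.
  exact: (zero_triangle_bound yW cs ab ad bd z1 z2 z3).
apply: le_trans (psi_le2 _ _) _; clear SN.
have := saturation Ho; have := mantel R (zero_sym yW) tf; lra.
Qed.

(** With n = [#|S|] - 5 the value to beat is (n+5)(n+4)/12. The first outcome of [small_five]
    exceeds it as soon as n > 20, the second at n = 21 by 1/60; in the third, a zero triangle is
    excluded by [gbound_gt]. *)
Lemma zero_triangle_free c (cs : symmetric c) S w y : optimal c S w y ->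
  (26 <= #|S|)%N -> wt y S <= #|S|%:R * (#|S|%:R - 1) / 12 ->
  forall x u v, x \in S -> u \in S -> v \in S ->
     zeropair y x u -> zeropair y x v -> zeropair y u v -> False.
Proof.
move=> Ho S26 le.
have yW := opt_weighting Ho; have cv := opt_covers Ho.
have [|] := zero_triangle_or y S; first by [].
case=> a [b [d [[QS ab ad bd] [z1 z2 z3]]]].
have E : #|S|%:R = (#|S| - 5)%N%:R + 5 :> R by rewrite -natrD; congr (_%:R); lia.
have n21 : 21 <= (#|S| - 5)%N%:R :> R by rewrite ler_nat; lia.
have p20 : psi R (#|S| - 5) = _ := @psi_ge20 R (#|S| - 5) ltac:(lia).
have [||h|h|F5] := small_five cs yW cv _.
- by lia.
- move=> K KS K5; have cD : #|S :\: K| = (#|S| - 5)%N by rewrite cardsD (setIidPr KS) K5.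
  by rewrite -cD; apply: (lower_bound cs yW); exact: coversS (subsetDl _ _) cv.
- exfalso; move: h le; rewrite p20 E; move: n21; set n := (#|S| - 5)%N%:R; lra.
- exfalso; move: h le; rewrite p20 E; move: n21; set n := (#|S| - 5)%N%:R; lra.
exfalso; have := zero_triangle_bound yW cs ab ad bd z1 z2 z3 cv F5 QS.
by have := gbound_gt R S26; move: le; lra.
Qed.

End LowerBound.

(** * Dense triangle-free graphs are bipartite *)

Section Bipartite.
Variables (R : realFieldType) (T : finType) (e : rel T).
Hypotheses (es : symmetric e) (tf : forall x u v, e x u -> e x v -> e u v -> False).
Let S := [set: T].
Let n : R := #|S|%:R.
Let N x := nbh S e x.
Let d x := dg R S e x.
Let m := \sum_(x in S) d x.

Let tfS : forall x u v, x \in S -> u \in S -> v \in S -> e x u -> e x v -> e u v -> False.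
Proof. by move=> x u v _ _ _; exact: tf. Qed.

Let inN x z : (z \in N x) = e x z.
Proof. by rewrite !inE. Qed.

(** If the ends of every edge had degree sum at most n - 2, [heavy_edge] and Cauchy-Schwarz would
    give [2 * m <= n * (n - 2)], against the assumed density. *)
Lemma near_spanning_edge : (0 < #|S|)%N -> n * (n - 1) / 2 <= m -> 1 < n ->
  exists u v, e u v /\ (#|S| <= (#|N u| + #|N v|).+1)%N.
Proof.
move=> S0 hm n1.
have [/existsP[u /existsP[v /andP[uv h]]]|H] :=
    boolP [exists u, exists v, e u v && (#|S| <= (#|N u| + #|N v|).+1)%N].
  by exists u, v.
have hd x z : x \in S -> z \in S -> e x z -> d x + d z <= n - 2.
  move=> _ _ exz; have : (#|N x| + #|N z| + 2 <= #|S|)%N.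
    move: H; rewrite negb_exists => /forallP/(_ x); rewrite negb_exists => /forallP/(_ z).
    by rewrite exz /= -ltnNge; lia.
  by rewrite -(ler_nat R) !natrD /d /dg -/(N x) -/(N z) /n; lra.
have := heavy_edge es hd; have := @sum_sqr_ge R T S d; rewrite -/m -/n -/d.
set q := \sum_(x in S) _ => h1 h2.
have mp : 0 < m by apply: lt_le_trans hm; rewrite divr_gt0 // mulr_gt0; lra.
have : n * (2 * q) <= n * ((n - 2) * m) by apply: ler_wpM2l => //; lra.
move=> h3; have : (2 * m) * m <= (n * (n - 2)) * m by lra.
rewrite ler_pM2r //; lra.
Qed.

(* The neighbourhoods of the ends of a heavy edge are disjoint independent sets
   covering all vertices but at most one. *)
Lemma dense_triangle_free_bipartite : 5 < n -> n * (n - 1) / 2 <= m ->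
  exists s : T -> bool, forall x z, e x z -> s x != s z.
Proof.
move=> n5 hm; have S0 : (0 < #|S|)%N by rewrite -(ltr_nat R) -/n; lra.
have [u [v [uv hN]]] : exists u v, e u v /\ (#|S| <= (#|N u| + #|N v|).+1)%N.
  by apply: near_spanning_edge => //; lra.
pose A := N v; pose B := N u.
have dAB : [disjoint A & B].
  by apply: (nbh_disjoint tfS) => //; rewrite ?inE // es.
have indA x z : x \in A -> z \in A -> ~~ e x z.
  by rewrite !inN => vx vz; apply/negP; exact: (tf vx vz).
have indB x z : x \in B -> z \in B -> ~~ e x z.
  by rewrite !inN => vx vz; apply/negP; exact: (tf vx vz).
have cAB : #|A :|: B| = (#|A| + #|B|)%N by apply/eqP; rewrite (leq_card_setU A B).
have [/setP full|nfull] := eqVneq (A :|: B) S.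
  exists (mem A) => x z exz /=.
  have := full x; have := full z; rewrite !in_setU !in_setT.
  case xA: (x \in A); case zA: (z \in A) => //= zB xB.
    by have := indA x z xA zA; rewrite exz.
  by have := indB x z xB zB; rewrite exz.
have [p pN _] : exists2 p, p \notin A :|: B & True.
  have [/forallP h|] := boolP [forall p, p \in A :|: B].
    by exfalso; move/eqP: nfull; apply; apply/setP => z; rewrite h in_setT.
  by rewrite negb_forall => /existsP[p ?]; exists p.
have other x : x != p -> (x \in A) || (x \in B).
  move=> xp; rewrite -in_setU; apply: contraT => xN.
  have : (#|p |: (x |: (A :|: B))| <= #|S|)%N by apply: subset_leq_card; rewrite subsetT.
  have pxN : p \notin x |: (A :|: B) by rewrite in_setU1 negb_or eq_sym xp pN.
  rewrite cardsU1 pxN cardsU1 xN cAB; move: hN; rewrite -/A -/B; lia.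
have pA : p \notin A by apply: contra pN; rewrite in_setU => ->.
have pB : p \notin B by apply: contra pN; rewrite in_setU orbC => ->.
pose P := N p :&: A; pose Q := N p :&: B.
have [P0|/set0Pn[x0 x0P]] := eqVneq P set0.
  exists (fun x => x \in p |: A) => x z exz; rewrite !in_setU1.
  have pP w : e p w -> w \notin A.
    by move=> pw; apply/negP => wA; move/setP: P0 => /(_ w); rewrite !in_setI inN pw wA inE.
  have [xp|xp] := eqVneq x p; have [zp|zp] := eqVneq z p; rewrite /=.
  - by move: exz; rewrite xp zp => pp; case: (tf pp pp pp).
  - by rewrite -xp in pP; rewrite (negbTE (pP z exz)).
  - by rewrite es zp in exz; rewrite (negbTE (pP x exz)).
  have := other x xp; have := other z zp.
  case xA: (x \in A); case zA: (z \in A) => //= zB xB.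
    by have := indA x z xA zA; rewrite exz.
  by have := indB x z xB zB; rewrite exz.
have [Q0|/set0Pn[x1 x1Q]] := eqVneq Q set0.
  exists (fun x => x \in p |: B) => x z exz; rewrite !in_setU1.
  have pP w : e p w -> w \notin B.
    by move=> pw; apply/negP => wA; move/setP: Q0 => /(_ w); rewrite !in_setI inN pw wA inE.
  have [xp|xp] := eqVneq x p; have [zp|zp] := eqVneq z p; rewrite /=.
  - by move: exz; rewrite xp zp => pp; case: (tf pp pp pp).
  - by rewrite -xp in pP; rewrite (negbTE (pP z exz)).
  - by rewrite es zp in exz; rewrite (negbTE (pP x exz)).
  have := other x xp; have := other z zp; rewrite orbC [_ || (x \in B)]orbC.
  case xA: (x \in B); case zA: (z \in B) => //= zB xB.
    by have := indB x z xA zA; rewrite exz.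
  by have := indA x z xB zB; rewrite exz.
(* There are no edges between P and Q, so at most |A||B| - |P||Q| + |P| + |Q| in all. *)
exfalso; move: hm; apply/negP; rewrite -ltNge.
have p1 : 1 <= #|P|%:R :> R by rewrite ler1n; apply/card_gt0P; exists x0.
have q1 : 1 <= #|Q|%:R :> R by rewrite ler1n; apply/card_gt0P; exists x1.
(* A vertex of [X] has its neighbours in [Y]. If it is adjacent to [p], it gains [p] but loses all
   of [Y'], since a neighbour there would close a triangle with [p]. *)
have side (X Y X' Y' : {set T}) : (forall x, x != p -> (x \in X) || (x \in Y)) ->
    (forall x z, x \in X -> z \in X -> ~~ e x z) -> p \notin Y ->
    X' = N p :&: X -> Y' = N p :&: Y ->
    \sum_(x in X) d x <= #|X|%:R * #|Y|%:R - #|X'|%:R * (#|Y'|%:R - 1).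
  move=> XY indX pY X'E Y'E.
  have X'X : X' \subset X by rewrite X'E subsetIr.
  have Y'Y : Y' \subset Y by rewrite Y'E subsetIr.
  have -> : #|X'|%:R * (#|Y'|%:R - 1) = \sum_(x in X) (x \in X')%:R * (#|Y'|%:R - 1) :> R.
    rewrite -mulr_suml; congr (_ * _); rewrite -sum1_card natr_sum big_mkcond [RHS]big_mkcond.
    apply: eq_bigr => x _; case xX': (x \in X'); first by rewrite (subsetP X'X).
    by case: ifP.
  rewrite mulr_natl -sumr_const -sumrB; apply: ler_sum => x xX.
  case xX': (x \in X'); rewrite ?mul0r ?subr0 ?mul1r; last first.
    rewrite /d /dg ler_nat; apply: subset_leq_card; apply/subsetP => z; rewrite inN => xz.
    have zX : z \notin X by apply: contraL xz; exact: indX.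
    have := XY z; rewrite (negbTE zX); apply; apply: contraFneq xX' => zp.
    by rewrite X'E in_setI xX inN es -zp xz.
  have : (#|N x| <= #|p |: (Y :\: Y')|)%N.
    apply: subset_leq_card; apply/subsetP => z; rewrite inN => xz; rewrite !in_setU1 in_setD.
    have [//|zp] := eqVneq z p.
    have zX : z \notin X by apply: contraL xz; exact: indX.
    have := XY z zp; rewrite (negbTE zX) /= => -> /=; rewrite andbT.
    apply/negP; rewrite Y'E in_setI inN => /andP[pz _].
    by move: xX'; rewrite X'E in_setI inN => /andP[px _]; exact: (tf px pz).
  rewrite cardsU1 in_setD (negbTE pY) andbF cardsD (setIidPr Y'Y).
  rewrite addnBA ?subset_leq_card // => h.
  have : (#|N x| + #|Y'| <= 1 + #|Y|)%N.
    by rewrite addnC -leq_subRL // (leq_trans (subset_leq_card Y'Y)) // leq_addl.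
  rewrite -(ler_nat R) !natrD /d /dg -/(N x); lra.
have hA := side A B P Q other indA pB erefl erefl.
have hB := side B A Q P (fun x xp => etrans (orbC _ _) (other x xp)) indB pA erefl erefl.
have hp : d p = #|P|%:R + #|Q|%:R.
  rewrite -natrD /d /dg; congr (_%:R).
  rewrite -cardsUI; have -> : P :&: Q = set0.
    apply/eqP; rewrite setI_eq0; apply: disjointWl (subsetIr _ _) _.
    by apply: disjointWr (subsetIr _ _) dAB.
  rewrite cards0 addn0; apply: eq_card => z; rewrite in_setU !in_setI -andb_orr -in_setU.
  apply/idP/andP => [pz|[]//]; split=> //; rewrite in_setU; apply: other.
  by apply: contraTneq pz => ->; rewrite -/(N p) inN; apply/negP => pp; exact: (tf pp pp pp).
have SE : S = p |: (A :|: B).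
  apply/setP => z; rewrite !in_setU in_set1 in_setT; case: eqVneq => //= zp.
  by rewrite other.
have mE : m = #|P|%:R + #|Q|%:R + (\sum_(x in A) d x + \sum_(x in B) d x).
  by rewrite /m SE big_setU1 // hp (sum_setU _ dAB).
have nE : n = #|A|%:R + #|B|%:R + 1.
  by rewrite /n SE cardsU1 pN cAB addnC !natrD.
rewrite mE; move: hA hB nE n5; move: (\sum_(x in A) _) (\sum_(x in B) _) => sA sB.
move: p1 q1; set a : R := #|A|%:R; set b : R := #|B|%:R; set pp : R := #|P|%:R; set qq : R := #|Q|%:R.
move=> p1 q1 hA hB -> n5.
(* The degree sum is at most 2ab - 2(pp-1)(qq-1) + 2, hence at most (n-1)(n-1)/2 + 2. This is below
   n(n-1)/2 exactly when n > 5. *)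
have : 0 <= (pp - 1) * (qq - 1) by apply: mulr_ge0; lra.
have : 0 <= (a - b) * (a - b) by rewrite -expr2 sqr_ge0.
lra.
Qed.

End Bipartite.

(** * Inner edges of the bipartition *)

Section NearBipartite.
Variables (R : realFieldType) (T : finType) (c : rel T) (cs : symmetric c).
Variables (w : {set T} -> R) (y : T -> T -> R) (s : T -> bool).
Let S := [set: T].
Let n : R := #|S|%:R.
Hypothesis Ho : optimal c S w y.
Hypothesis n26 : 26 <= n.
Hypothesis val : wt y S <= n * (n - 1) / 12.
Hypothesis bip : forall x z, zeropair y x z -> s x != s z.
Implicit Types (A X : {set T}) (P : rel T).

Let yW : weighting y := opt_weighting Ho.
Let ysym x z : y x z = y z x. Proof. by case: yW. Qed.
Let yge0 x z : 0 <= y x z. Proof. by case: yW. Qed.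
Let cov x u v : tri c x u v -> 1 <= y x u + y x v + y u v.
Proof. by apply: (opt_covers Ho); rewrite in_setT. Qed.

Definition cross x z := s x != s z.
Definition inner x z := (x != z) && (s x == s z).
(** Ordered pairs are counted, so for a symmetric relation without loops this is twice the number of
    edges, and [cross_load] is likewise twice the load across. *)
Definition npairs P : R := \sum_(x in S) \sum_(z in S) (P x z)%:R.
Definition cross_load : R := \sum_(x in S) \sum_(z in S) (cross x z)%:R * tload c S w x z.

Lemma npairs_split P P' : npairs P = npairs [rel x z | P x z && P' x z] +
  npairs [rel x z | P x z && ~~ P' x z].
Proof.
rewrite /npairs -big_split; apply: eq_bigr => x _; rewrite -big_split; apply: eq_bigr => z _ /=.
by case: (P x z); case: (P' x z); rewrite /= ?addr0 ?add0r.
Qed.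

Lemma inner_sat x z : inner x z -> 0 < y x z.
Proof.
move=> /andP[xz /eqP sxz]; rewrite lt_def yge0 andbT; apply/negP => /eqP y0.
by have := @bip x z; rewrite /zeropair xz y0 eqxx sxz eqxx => /(_ isT).
Qed.

Lemma sat_load x z : 0 < y x z -> tload c S w x z = 1.
Proof. by apply: (opt_sat Ho); rewrite in_setT. Qed.

Lemma tload_ge0 x z : 0 <= tload c S w x z.
Proof. by apply: sumr_ge0 => A _; exact: (opt_ge0 Ho). Qed.

Lemma npairs_cross : npairs cross = 2 * #|[set x | s x]|%:R * #|[set x | ~~ s x]|%:R.
Proof.
set A := [set x | s x]; set B := [set x | ~~ s x].
have E x : \sum_(z in S) (cross x z)%:R = (x \in A)%:R * #|B|%:R + (x \in B)%:R * #|A|%:R :> R.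
  have cE X : #|X|%:R = \sum_(z in S) (z \in X)%:R :> R.
    by rewrite -sum1_card natr_sum big_mkcond /=; apply: eq_big => [z|z _]; rewrite ?in_setT //; case: ifP.
  rewrite !cE !mulr_sumr -big_split; apply: eq_bigr => z _; rewrite !inE /cross.
  by case: (s x); case: (s z); rewrite /= ?(mul0r, mul1r, addr0, add0r).
have cE X : #|X|%:R = \sum_(z in S) (z \in X)%:R :> R.
  by rewrite -sum1_card natr_sum big_mkcond /=; apply: eq_big => [z|z _]; rewrite ?in_setT //; case: ifP.
rewrite /npairs (eq_bigr _ (fun x _ => E x)) big_split /= -!mulr_suml -!cE; ring.
Qed.

Lemma npairs_inner : npairs inner = n * (n - 1) - npairs cross.
Proof.
have -> : n * (n - 1) = npairs (fun x z => x != z).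
  rewrite /npairs mulr_natl -sumr_const; apply: eq_bigr => x xS.
  have E : (\sum_(z in S) (x != z)%:R : R) + 1 = n.
    rewrite (bigD1 x) //= eqxx add0r (eq_bigr (fun=> 1)) => [|z /andP[_ zx]]; last by rewrite eq_sym zx.
    rewrite (eq_bigl (mem (S :\ x))) => [|z]; last by rewrite !inE andbC.
    by rewrite sumr_const /n (cardsD1 x S) xS natrD addrC.
  by rewrite -E addrK.
apply/eqP; rewrite eq_sym subr_eq; apply/eqP.
rewrite (npairs_split (fun x z => x != z) (fun x z => s x == s z)); congr (_ + _).
apply: eq_bigr => x _; apply: eq_bigr => z _; rewrite /cross /=.
by have [->|] := eqVneq x z; rewrite ?eqxx.
Qed.

Let sizes : #|[set x | s x]|%:R + #|[set x | ~~ s x]|%:R = n.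
Proof.
rewrite -natrD /n; congr (_%:R); rewrite -cardsUI.
have -> : [set x | s x] :&: [set x | ~~ s x] = set0.
  by apply/setP => z; rewrite !inE; case: (s z).
by rewrite cards0 addn0; apply: eq_card => z; rewrite !inE; case: (s z).
Qed.

(** The total load of ordered pairs is [6 * wt y S], at most n(n-1)/2, and every inner pair has load
    1. *)
Lemma cross_load_le : cross_load <= npairs cross - n * (n - 1) / 2.
Proof.
have E : \sum_(x in S) \sum_(z in S | z != x) tload c S w x z = npairs inner + cross_load.
  rewrite /npairs /cross_load -big_split; apply: eq_bigr => x _ /=.
  rewrite -big_split big_mkcondr; apply: eq_bigr => z _ /=; rewrite eq_sym.
  have := @inner_sat x z; rewrite /inner /cross.
  have [->|xz] := eqVneq x z; first by rewrite eqxx /= mul0r addr0.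
  case: eqP => //= _ h; last by rewrite mul1r add0r.
  by rewrite mul0r addr0; apply: sat_load; apply: h.
have := sum_tload c S w; rewrite -(opt_val Ho) E npairs_inner; move: val; lra.
Qed.

Lemma cross_load_le2 : cross_load <= n / 2.
Proof.
have := cross_load_le; rewrite npairs_cross; move: sizes.
set a := #|_|%:R; set b := #|_|%:R => ab.
have : 0 <= (a - b) * (a - b) by rewrite -expr2 sqr_ge0.
rewrite -ab; lra.
Qed.

(* A non-constant two-colouring of the vertices of a triangle cuts two of its
   three edges; so the load of the uncut edges is at most half of the cross load. *)
Lemma npairs_le P : (forall x z, P x z -> inner x z) ->
  (forall A x z, monoset c S A -> 0 < w A -> x \in A -> z \in A -> P x z ->
     exists2 v, v \in A & s v != s x) ->
  npairs P <= cross_load / 2.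
Proof.
move=> Pin HP; rewrite ler_pdivlMr // mulrC.
pose cnt (Q : rel T) A : R := \sum_(x in A) \sum_(z in A) (Q x z)%:R.
have swap (Q : rel T) : \sum_(x in S) \sum_(z in S) (Q x z)%:R * tload c S w x z =
    \sum_(A | monoset c S A) w A * cnt Q A.
  rewrite /tload; under eq_bigr => x _ do under eq_bigr => z _ do rewrite mulr_sumr big_mkcondr /=.
  under eq_bigr => x _ do rewrite exchange_big /=.
  rewrite exchange_big /=; apply: eq_bigr => A _; rewrite /cnt mulr_sumr.
  rewrite [RHS]big_mkcond; apply: eq_big => [x|x _]; first by rewrite in_setT.
  case xA: (x \in A); last by rewrite big1.
  rewrite mulr_sumr [RHS]big_mkcond; apply: eq_big => [z|z _]; first by rewrite in_setT.
  by case: (z \in A); rewrite // mulrC.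
have -> : npairs P = \sum_(A | monoset c S A) w A * cnt P A.
  rewrite -swap; apply: eq_bigr => x _; apply: eq_bigr => z _.
  case Pxz: (P x z); last by rewrite mul0r.
  by rewrite sat_load ?mulr1 //; apply: inner_sat; apply: Pin.
rewrite /cross_load swap mulr_sumr; apply: ler_sum => A mA; rewrite mulrCA.
have [w0|wN] := eqVneq (w A) 0; first by rewrite w0 !mul0r.
apply: ler_wpM2l; first exact: (opt_ge0 Ho).
have wp : 0 < w A by rewrite lt_def wN (opt_ge0 Ho).
have [/existsP[x /existsP[z /and3P[xA zA Pxz]]]|N] :=
    boolP [exists x, exists z, [&& x \in A, z \in A & P x z]]; last first.
  rewrite /cnt big1 ?mulr0 => [|x xA].
    by apply: sumr_ge0 => x _; apply: sumr_ge0 => z _; rewrite ler0n.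
  rewrite big1 // => z zA; case Pxz: (P x z) => //; case/negP: N.
  by apply/existsP; exists x; apply/existsP; exists z; rewrite xA zA Pxz.
have [v vA svx] := HP A x z mA wp xA zA Pxz.
have /monosetP[_ tA] := mA.
have [xz /eqP sxz] : x != z /\ s x == s z by apply/andP; exact: Pin.
have [v' [AE t]] := triset_edge cs tA xA zA xz.
have vE : v' = v.
  move: vA; rewrite AE !inE -orbA => /or3P[]/eqP E //; first by rewrite E eqxx in svx.
  by rewrite E -sxz eqxx in svx.
rewrite vE in AE t; have /and5P[_ xv zv _ _] := t.
have sum3 (f : T -> R) : \sum_(p in A) f p = f x + f z + f v.
  rewrite AE -setUA big_setU1 ?inE ?negb_or ?xz ?xv //=.
  by rewrite big_setU1 ?inE ?zv //= big_set1 addrA.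
have Pf p q : inner p q = false -> P p q = false.
  by move=> h; apply: contraFF h; exact: Pin.
have Pd p : P p p = false by apply: Pf; rewrite /inner eqxx.
have Pv p : s p = s x -> P p v = false /\ P v p = false.
  by move=> sp; split; apply: Pf; rewrite /inner sp ?(eq_sym (s x)) (negbTE svx) andbF.
have [px1 px2] := Pv x erefl; have [pz1 pz2] := Pv z (esym sxz).
rewrite /cnt !sum3 !Pd px1 px2 pz1 pz2 /cross -sxz !eqxx (eq_sym (s x)) svx /=.
by case: (P x z); case: (P z x); rewrite /=; lra.
Qed.

(* A tight triangle through a pair of weight at least 1 has weight 0 on its other
   two edges, which therefore join the two sides. *)
Definition heavy x z := inner x z && (1 <= y x z).

Lemma heavy_le : npairs heavy <= n / 4.
Proof.
apply: (@le_trans _ _ (cross_load / 2)); last by have := cross_load_le2; lra.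
apply: npairs_le => [x z /andP[]//|A x z mA wA xA zA /andP[ixz y1]].
have /monosetP[_ tA] := mA.
have [xz sxz] : x != z /\ s x == s z by apply/andP.
have [v [AE t]] := triset_edge cs tA xA zA xz.
exists v; first by rewrite AE !inE eqxx orbT.
have := opt_tight Ho mA wA; rewrite {1}AE (wt_triple yW t) => E.
have y0 : y x v = 0 by move: (yge0 x v) (yge0 z v); lra.
rewrite eq_sym; apply: bip; rewrite /zeropair y0 eqxx andbT.
by case/and5P: t.
Qed.

Lemma heavy_clique X : (forall x z, x \in X -> z \in X -> x != z -> heavy x z) ->
  #|X|%:R * (#|X|%:R - 1) <= n / 4.
Proof.
move=> HX; apply: le_trans heavy_le; rewrite /npairs.
rewrite (big_setID X) /= (setIidPr (subsetT X)) -[leLHS]addr0; apply: lerD; last first.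
  by apply: sumr_ge0 => x _; apply: sumr_ge0 => z _; rewrite ler0n.
rewrite mulr_natl -sumr_const; apply: ler_sum => x xX.
rewrite (big_setID X) /= (setIidPr (subsetT X)) -[leLHS]addr0; apply: lerD; last first.
  by apply: sumr_ge0 => z _; rewrite ler0n.
rewrite (bigD1 x) //= (eq_bigr (fun=> 1)) => [|z /andP[zX zx]]; last first.
  by rewrite HX // eq_sym.
rewrite (eq_bigl (mem (X :\ x))) => [|z]; last by rewrite !inE andbC.
rewrite sumr_const {1}(cardsD1 x X) xX natrD mulr1n.
have : 0 <= (heavy x x)%:R :> R by rewrite ler0n.
lra.
Qed.

(** Vertices of side [b] joined by weight 0 to the whole other side. A monochromatic triangle with
    one vertex on one side and two on the other, all its cross pairs meeting stars, leaves its full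
    weight to the inner pair. *)
Definition star (b : bool) : {set T} :=
  [set x | (s x == b) && [forall z, (s z != b) ==> (y x z == 0)]].

Lemma starP b x z : x \in star b -> s z != b -> y x z = 0.
Proof. by rewrite inE => /andP[_ /forallP/(_ z)/implyP h] /h/eqP. Qed.

Lemma star_side b x : x \in star b -> s x = b.
Proof. by rewrite inE => /andP[/eqP]. Qed.

Lemma missing_le : npairs [rel x z | cross x z && (y x z != 0)] <= cross_load.
Proof.
apply: ler_sum => x _; apply: ler_sum => z _ /=.
case: (cross x z); rewrite ?mul0r //= mul1r; case yN: (y x z != 0) => /=.
  by rewrite sat_load // lt_def yN yge0.
exact: tload_ge0.
Qed.

(** A vertex of the side outside the star has a cross pair of positive weight. Such pairs are
    saturated, so [cross_load] bounds their number. *)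
Lemma star_ge b : (n - 1) / 4 <= #|star b|%:R.
Proof.
pose side := [set x | s x == b].
pose miss x z := cross x z && (y x z != 0).
pose M (b' : bool) : R := \sum_(x in S) \sum_(z in S) ((s x == b') && miss x z)%:R.
have MM : M b = M (~~ b).
  rewrite /M exchange_big /=; apply: eq_bigr => x _; apply: eq_bigr => z _.
  rewrite /miss /cross (ysym z x); congr (_%:R).
  by case: (s x); case: (s z); case: (b); case: (y x z != 0).
have M2 : 2 * M b <= cross_load.
  apply: le_trans missing_le; have -> : 2 * M b = M b + M (~~ b) by rewrite -MM -mulr2n mulr_natl.
  rewrite /M -big_split; apply: ler_sum => x _; rewrite -big_split; apply: ler_sum => z _ /=.
  by rewrite /miss; case: (s x); case: (b); case: (cross x z); case: (y x z == 0); rewrite /= ?addr0 ?add0r.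
have le1 : #|side|%:R <= #|star b|%:R + M b.
  have cE X : #|X|%:R = \sum_(z in S) (z \in X)%:R :> R.
    by rewrite -sum1_card natr_sum big_mkcond /=; apply: eq_big => [z|z _]; rewrite ?in_setT //; case: ifP.
  rewrite !cE -big_split; apply: ler_sum => x _ /=.
  have p0 (b' : bool) : 0 <= \sum_(z in S) (b' && miss x z)%:R :> R.
    by apply: sumr_ge0 => z _; rewrite ler0n.
  rewrite !inE; case sxb: (s x == b); last by rewrite /= add0r (p0 false).
  case: (boolP [forall z, _]) => [_|] /=; first by rewrite lerDl (p0 true).
  rewrite negb_forall => /existsP[z]; rewrite negb_imply => /andP[szb yxz].
  rewrite add0r (bigD1 z) ?in_setT //= /miss /cross (eqP sxb) eq_sym szb yxz /= lerDl.
  by apply: sumr_ge0 => z' _; rewrite ler0n.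
have sb : #|side|%:R = #|[set x | s x]|%:R :> R \/ #|side|%:R = #|[set x | ~~ s x]|%:R :> R.
  by rewrite /side; case: (b); [left|right]; congr (_%:R); apply: eq_card => x; rewrite !inE ?eqb_id ?eqbF_neg.
have := cross_load_le; rewrite npairs_cross; move: le1 M2 sb sizes.
set a := #|[set x | s x]|%:R; set a' := #|[set x | ~~ s x]|%:R; set k := #|side|%:R => le1 M2 sb E cl.
(* The star has at least k - k(n-k) + n(n-1)/4 vertices, which is (n-1)/4 plus the square of k -
   (n-1)/2. *)
have : 0 <= (2 * k - (n - 1)) * (2 * k - (n - 1)) by rewrite -expr2 sqr_ge0.
have : a * a' = k * (n - k) by case: sb => kE; rewrite kE -E; ring.
lra.
Qed.

(* [A] is a triangle of positive weight, hence tight, inside one side: each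
   of its edges has weight below 1. *)
Definition inner_tri (k b : bool) A :=
  [/\ monoset c S A, 0 < w A, forall x z, x \in A -> z \in A -> x != z -> c x z = k
    & forall x, x \in A -> s x = b].

Lemma inner_tri_lt1 k b A x z : inner_tri k b A -> x \in A -> z \in A -> x != z -> y x z < 1.
Proof.
case=> mA wA _ sA xA zA xz; have /monosetP[_ tA] := mA.
have [v [AE t]] := triset_edge cs tA xA zA xz.
have vA : v \in A by rewrite AE !inE eqxx orbT.
have := opt_tight Ho mA wA; rewrite {1}AE (wt_triple yW t).
have /and5P[_ xv _ _ _] := t.
have : 0 < y x v by apply: inner_sat; rewrite /inner xv !sA // eqxx.
by move: (yge0 z v); lra.
Qed.

(** A star vertex sends at most one edge of colour [k] to [A]: two would form with an edge of [A] a
    triangle whose whole weight lies on that edge, which is lighter than 1. So some vertex of [A] is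
    joined to both [z] and [z'] in the other colour, and the pair [z], [z'] alone pays for the
    triangle. *)
Lemma star_heavy k b A z z' : inner_tri k b A -> z \in star (~~ b) -> z' \in star (~~ b) ->
  z != z' -> c z z' = ~~ k -> heavy z z'.
Proof.
move=> HA zS z'S zz' czz'; have [mA wA cA sA] := HA.
have /monosetP[_ [p [q [r [AE t]]]]] := mA; have /and5P[pq pr qr _ _] := t.
have pA : p \in A by rewrite AE !inE eqxx.
have qA : q \in A by rewrite AE !inE eqxx !orbT.
have rA : r \in A by rewrite AE !inE eqxx !orbT.
have ne x u : x \in A -> u \in star (~~ b) -> (x != u) * (y x u = 0).
  move=> xA uS; have su := star_side uS; have sx := sA x xA; split.
    by apply/eqP => E; move: sx; rewrite E su; case: (b).
  by rewrite ysym; apply: (starP uS); rewrite sx; case: (b).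
have one x x' u : x \in A -> x' \in A -> x != x' -> u \in star (~~ b) -> c x u = k -> c x' u = k -> False.
  move=> xA x'A xx' uS cx cx'; have := inner_tri_lt1 HA xA x'A xx'.
  have : 1 <= y x x' + y x u + y x' u.
    by apply: cov; rewrite /tri xx' !(ne _ u _ uS).1 // (cA x x') // cx cx' !eqxx.
  by rewrite (ne x u xA uS).2 (ne x' u x'A uS).2 !addr0 leNgt => /negP.
have two x : x \in A -> c x z = ~~ k -> c x z' = ~~ k -> heavy z z'.
  move=> xA cx cx'; have := @cov x z z'; rewrite /tri (ne x z xA zS).1 (ne x z' xA z'S).1 (ne x z xA zS).2 (ne x z' xA z'S).2.
  rewrite zz' cx cx' czz' !eqxx !add0r => /(_ isT) y1.
  by rewrite /heavy /inner zz' (star_side zS) (star_side z'S) eqxx y1.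
have := @one p q z pA qA pq zS; have := @one p r z pA rA pr zS; have := @one q r z qA rA qr zS.
have := @one p q z' pA qA pq z'S; have := @one p r z' pA rA pr z'S; have := @one q r z' qA rA qr z'S.
have := two p pA; have := two q qA; have := two r rA.
case: (c p z); case: (c q z); case: (c r z); case: (c p z'); case: (c q z'); case: (c r z'); case: (k) => /=;
  intuition.
Qed.

(** For n >= 26 the first bound exceeds 3, so [k] is at least 4. A clique of three would still be
    possible at n = 25, since 6 <= 25/4. *)
Lemma no_large_clique (k : nat) : (n - 1) / 8 <= k%:R -> k%:R * (k%:R - 1) <= n / 4 -> False.
Proof.
move=> h1 h2; have k4 : 4 <= k%:R :> R.
  have : 3 < k%:R :> R by move: n26; lra.
  by rewrite ltr_nat -(ler_nat R).
have : 0 <= (k%:R - 4) * (k%:R - (n - 1) / 8) by apply: mulr_ge0; lra.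
by move: n26; nra.
Qed.

(** Half of a star is already too large for a heavy clique. If both triangles lie on one side, every
    pair of the opposite star is heavy by [star_heavy]. If not, then red pairs in [star b] and blue
    ones in [star (~~ b)] are heavy, and by the triangles across so are all pairs within [X x] and
    within [Y z]. Thus each vertex of [star b] has red edges to less than half of the other star,
    and each vertex of that star has blue edges to less than half of [star b]: too few for all pairs
    between the stars. *)
Lemma no_two_inner_tri b b' A A' : inner_tri true b A -> inner_tri false b' A' -> False.
Proof.
move=> HA HA'.
(* By [star_ge] half of a star has at least (n-1)/8 vertices. *)
have big b0 X : #|star b0|%:R <= 2 * #|X|%:R :> R ->
   #|X|%:R * (#|X|%:R - 1) <= n / 4 -> False.
  by move=> h; apply: no_large_clique; have := star_ge b0; lra.
have [bb|bb] := eqVneq b b'.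
  apply: (big (~~ b) (star (~~ b))).
    by rewrite mulr_natl mulr2n lerDl ler0n.
  apply: heavy_clique => x z xS zS xz; case cxz: (c x z).
    by rewrite -bb in HA'; exact: (star_heavy HA').
  exact: (star_heavy HA).
have b'E : b' = ~~ b by move: bb; case: (b); case: (b').
rewrite b'E in HA'.
pose X x := [set z in star (~~ b) | c x z].
pose Y z := [set x in star b | ~~ c x z].
have clX x : x \in star b -> #|X x|%:R * (#|X x|%:R - 1) <= n / 4.
  move=> xS; apply: heavy_clique => z z' /setIdP[zS cz] /setIdP[z'S cz'] zz'; case czz: (c z z'); last exact: (star_heavy HA).
  have sx := star_side xS; have sz := star_side zS; have sz' := star_side z'S.
  have xz : x != z by apply/eqP => E; move: sx; rewrite E sz; case: (b).
  have xz' : x != z' by apply/eqP => E; move: sx; rewrite E sz'; case: (b).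
  have := @cov x z z'; rewrite /tri xz xz' zz' cz cz' czz !eqxx => /(_ isT).
  rewrite !(starP xS) ?sz ?sz' ?add0r; [|by case: (b)|by case: (b)] => y1.
  by rewrite /heavy /inner zz' sz sz' eqxx y1.
have clY z : z \in star (~~ b) -> #|Y z|%:R * (#|Y z|%:R - 1) <= n / 4.
  move=> zS; apply: heavy_clique => x x' /setIdP[xS /negbTE cx] /setIdP[x'S /negbTE cx'] xx'.
  have sz := star_side zS; have sx := star_side xS; have sx' := star_side x'S.
  case cxx: (c x x').
    by have := star_heavy HA'; rewrite negbK => /(_ x x'); apply.
  have xz : x != z by apply/eqP => E; move: sx; rewrite E sz; case: (b).
  have xz' : x' != z by apply/eqP => E; move: sx'; rewrite E sz; case: (b).
  have := @cov x x' z; rewrite /tri xx' xz xz' cx cx' cxx !eqxx => /(_ isT).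
  have -> : y x z = 0 by apply: (starP xS); rewrite sz; case: (b).
  have -> : y x' z = 0 by apply: (starP x'S); rewrite sz; case: (b).
  rewrite !addr0 => y1.
  by rewrite /heavy /inner xx' sx sx' eqxx y1.
have [/existsP[x /andP[xS h]]|NX] :=
    boolP [exists x, (x \in star b) && (#|star (~~ b)|%:R <= 2 * #|X x|%:R :> R)].
  exact: (big _ _ h (clX x xS)).
have [/existsP[z /andP[zS h]]|NY] :=
    boolP [exists z, (z \in star (~~ b)) && (#|star b|%:R <= 2 * #|Y z|%:R :> R)].
  exact: (big _ _ h (clY z zS)).
have lX x : x \in star b -> 2 * #|X x|%:R < #|star (~~ b)|%:R :> R.
  by move=> xS; move: NX; rewrite negb_exists => /forallP/(_ x); rewrite xS -ltNge.
have lY z : z \in star (~~ b) -> 2 * #|Y z|%:R < #|star b|%:R :> R.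
  by move=> zS; move: NY; rewrite negb_exists => /forallP/(_ z); rewrite zS -ltNge.
have sX : \sum_(x in star b) 2 * #|X x|%:R < \sum_(x in star b) #|star (~~ b)|%:R :> R.
  apply: ltr_sum => //; have : 0 < #|star b|%:R :> R by apply: lt_le_trans (star_ge b); move: n26; lra.
  by rewrite ltr0n => /card_gt0P[x xS]; apply/hasP; exists x; rewrite ?mem_index_enum.
have sY : \sum_(z in star (~~ b)) 2 * #|Y z|%:R <= \sum_(z in star (~~ b)) #|star b|%:R :> R.
  by apply: ler_sum => z zS; apply: ltW; apply: lY.
have E : \sum_(x in star b) #|X x|%:R + \sum_(z in star (~~ b)) #|Y z|%:R =
    #|star b|%:R * #|star (~~ b)|%:R :> R.
  have cX x : #|X x|%:R = \sum_(z in star (~~ b)) (c x z)%:R :> R.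
    rewrite -sum1_card natr_sum big_mkcond [RHS]big_mkcond; apply: eq_bigr => z _ /=.
    by rewrite /X in_set; case: (z \in star _); case: (c x z).
  have cY z : #|Y z|%:R = \sum_(x in star b) (~~ c x z)%:R :> R.
    rewrite -sum1_card natr_sum big_mkcond [RHS]big_mkcond; apply: eq_bigr => x _ /=.
    by rewrite /Y in_set; case: (x \in star _); case: (c x z).
  rewrite (eq_bigr _ (fun x _ => cX x)) [X in _ + X](eq_bigr _ (fun z _ => cY z)).
  rewrite [X in _ + X]exchange_big -big_split /= mulr_natl -sumr_const; apply: eq_bigr => x _.
  rewrite -big_split -sumr_const; apply: eq_bigr => z _ /=.
  by case: (c x z); rewrite /= ?addr0 ?add0r.
have sc X' (r : R) : \sum_(x in X') r = #|X'|%:R * r by rewrite sumr_const mulr_natl.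
move: sX sY E; rewrite -!mulr_sumr !sc; lra.
Qed.

Lemma few_inner_edges : exists k : bool,
  npairs [rel x z | inner x z && (c x z == k)] <= n / 4.
Proof.
have few k : (forall b A, ~ inner_tri k b A) ->
    npairs [rel x z | inner x z && (c x z == k)] <= n / 4.
  move=> Hk; apply: (@le_trans _ _ (cross_load / 2)); last by have := cross_load_le2; lra.
  apply: npairs_le => [x z /andP[]//|A x z mA wA xA zA /= /andP[ixz /eqP cxz]].
  apply/exists_inP; apply: contraT; rewrite negb_exists_in => /forall_inP H.
  case: (Hk (s x) A); split=> //; last by move=> v /H; rewrite negbK => /eqP.
  have /monosetP[_ tA] := mA; have [k' Hk'] := triset_col cs tA.
  have xz : x != z by case/andP: ixz.
  by move=> p q pA qA pq; rewrite Hk' // -(Hk' x z).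
have [H|/existsNP[b /existsNP[A /contrapT HA]]] := EM (forall b A, ~ inner_tri true b A).
  by exists true; exact: few.
have [H|/existsNP[b' /existsNP[A' /contrapT HA']]] := EM (forall b A, ~ inner_tri false b A).
  by exists false; exact: few.
by case: (no_two_inner_tri HA HA').
Qed.

End NearBipartite.

From mathcomp Require Import all_classical all_reals.

(** * From the optimum back to packings and edge removal *)

Section Link.
Variables (R : realType) (T : finType) (red : rel T).
Hypothesis red_simple : simple_graph red.
Implicit Types (F : rel T) (w : {set T} -> R).

Lemma blue_sym : symmetric (blue_of red).
Proof. by case: red_simple => _ rs x z; rewrite /blue_of eq_sym rs. Qed.

Lemma nu_star_ge F w : frac_tri_packing F w -> packing_value F w <= nu_star R F.
Proof.
move=> Hw; rewrite /nu_star; set E := [set _ | _]%classic.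
have HE : has_sup E.
  split; first by exists (packing_value F w); exists w.
  exists (#|triangles F|%:R) => v [w' [Hw' ->]].
  rewrite /packing_value -sumr_const; apply: ler_sum => t tF.
  by case: Hw' => /(_ t tF)/andP[].
by apply: (sup_upper_bound HE); exists w.
Qed.

Lemma set2_inj (x z p q : T) : x != z -> [set x; z] = [set p; q] ->
  (x = p /\ z = q) \/ (x = q /\ z = p).
Proof.
move=> xz E.
have : x \in [set p; q] by rewrite -E !inE eqxx.
have : z \in [set p; q] by rewrite -E !inE eqxx orbT.
by rewrite !inE => /orP[]/eqP zE /orP[]/eqP xE; rewrite xE zE ?eqxx in xz *; auto.
Qed.

Lemma mono_triangles A : monoset red [set: T] A =
  (A \in triangles red) || (A \in triangles (blue_of red)).
Proof.
have [ri rs] := red_simple.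
apply/monosetP/orP => [[_ [x [u [v [-> /and5P[xu xv uv /eqP c1 /eqP c2]]]]]]|].
  case rxu : (red x u); [left|right]; rewrite inE; apply/existsP; exists x;
    apply/existsP; exists u; apply/existsP; exists v; rewrite eqxx.
    by rewrite rxu -c2 -c1 rxu.
  by rewrite /blue_of xu xv uv rxu -c2 -c1 rxu.
rewrite !inE => -[|] /existsP[x /existsP[u /existsP[v /and4P[h1 h2 h3 /eqP ->]]]];
  split; rewrite ?finset.subsetT //; exists x, u, v; split => //.
  have ne p q : red p q -> p != q by move=> pq; apply: contraTneq pq => ->; rewrite ri.
  by rewrite /tri !ne // h1 h2 h3.
move: h1 h2 h3; rewrite /blue_of => /andP[h1 /negbTE r1] /andP[h2 /negbTE r2] /andP[h3 /negbTE r3].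
by rewrite /tri h1 h2 h3 r1 r2 r3.
Qed.

(** The upper bound 1 on a single triangle follows from the load of any of its edges. *)
Lemma optimal_packing F w y : optimal red [set: T] w y ->
  triangles F \subset monoset red [set: T] -> (forall x z, F x z -> x != z) ->
  frac_tri_packing F w.
Proof.
move=> Ho /fintype.subsetP sub Fne; split=> [t tF|e].
  rewrite (opt_ge0 Ho) /=; have mt : monoset red [set: T] t := sub t tF.
  have /monosetP[_ [x [u [v [E /and5P[xu _ _ _ _]]]]]] := mt.
  apply: le_trans (opt_load Ho (finset.in_setT x) (finset.in_setT u) xu).
  rewrite /tload (bigD1 t) /=; last by rewrite mt E !inE !eqxx orbT.
  by rewrite lerDl; apply: sumr_ge0 => A _; exact: (opt_ge0 Ho).
rewrite inE => /existsP[x /existsP[z /andP[/andP[xz _] /eqP ->]]].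
apply: le_trans (opt_load Ho (finset.in_setT x) (finset.in_setT z) xz).
rewrite /tload big_mkcond [leRHS]big_mkcond; apply: ler_sum => t _.
case: ifP => [/andP[tF]|_]; last by case: ifP => // _; exact: (opt_ge0 Ho).
have mt : monoset red [set: T] t := sub t tF.
by rewrite finset.subUset !finset.sub1set => xzt; rewrite mt xzt.
Qed.

(** One optimal [w] serves both colours: restricted to the red and to the blue triangles it is a
    packing of each graph, and the two values sum to at least the optimum. *)
Lemma optimal_le_pack w y : optimal red [set: T] w y -> 3 * wt y [set: T] <= pack R red.
Proof.
move=> Ho; rewrite /pack ler_pM2l // (opt_val Ho).
have [ri _] := red_simple.
have pr : frac_tri_packing red w.
  apply: (optimal_packing Ho) => [|x z xz].
    apply/fintype.subsetP => t tF; suff : monoset red [set: T] t by [].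
    by rewrite mono_triangles tF.
  by apply: contraTneq xz => ->; rewrite ri.
have pb : frac_tri_packing (blue_of red) w.
  apply: (optimal_packing Ho) => [|x z /andP[]//].
  apply/fintype.subsetP => t tF; suff : monoset red [set: T] t by [].
  by rewrite mono_triangles tF orbT.
apply: (@le_trans _ _ (packing_value red w + packing_value (blue_of red) w)); last first.
  by apply: lerD; apply: nu_star_ge.
rewrite /packing_value big_mkcond [X in _ <= X + _]big_mkcond [X in _ <= _ + X]big_mkcond.
rewrite -big_split; apply: ler_sum => A _ /=; rewrite mono_triangles.
have w0 := opt_ge0 Ho A.
by case: (A \in triangles red); case: (A \in triangles _); rewrite /= ?addr0 ?add0r // lerDl.
Qed.

(** The removed edges are those inside the sides, and [s] properly colours the rest. The factor 2
    turns ordered pairs into edges. *)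
Lemma inner_edges_close F (s : T -> bool) (r : R) :
  (forall x z, F x z -> x != z) -> symmetric F ->
  npairs R [rel x z | inner s x z && F x z] <= 2 * r -> close_to_bipartite r F.
Proof.
move=> Fne Fs le.
pose S := [set e in edges F | [exists x, exists z, (e == [set x; z]) && (s x == s z)]].
have SP x z : x != z -> ([set x; z] \in S) = inner s x z && F x z.
  move=> xz; rewrite /inner xz /=; apply/setIdP/andP => [[]|[/eqP sxz Fxz]]; last first.
    split; last by apply/existsP; exists x; apply/existsP; exists z; rewrite eqxx sxz eqxx.
    by rewrite inE; apply/existsP; exists x; apply/existsP; exists z; rewrite xz Fxz eqxx.
  rewrite inE => /existsP[p /existsP[q /andP[/andP[_ Fpq] /eqP /(set2_inj xz) E1]]].
  move=> /existsP[p' /existsP[q' /andP[/eqP /(set2_inj xz) E2 sp]]]; split.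
    by case: E2 sp => -[<- <-] //; rewrite eq_sym.
  by case: E1 Fpq => -[<- <-] //; rewrite Fs.
exists S; split; first by apply/fintype.subsetP => e /setIdP[].
split.
  suff : 2 * #|S|%:R <= 2 * r by rewrite ler_pM2l.
  apply: le_trans le; have -> : #|S|%:R = \sum_(e : {set T} | (#|e| == 2) && (e \subset [set: T])) (e \in S)%:R :> R.
    rewrite -sum1_card natr_sum big_mkcond [RHS]big_mkcond; apply: eq_bigr => e _.
    rewrite finset.subsetT andbT; case: ifP => [|_]; last by case: ifP.
    rewrite inE => /andP[+ _]; rewrite inE => /existsP[x /existsP[z /andP[/andP[xz _] /eqP ->]]].
    by rewrite cards2 xz.
  rewrite -sum_pairs; apply: ler_sum => x _; rewrite big_mkcondr /=; apply: ler_sum => z _.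
  rewrite eq_sym; have [->|xz] := eqVneq x z; first by rewrite ler0n.
  by rewrite /= SP.
exists s => x z /andP[Fxz]; rewrite SP ?Fne // Fxz andbT /inner Fne //=.
Qed.

End Link.

Theorem theorem2p6 (R : realType) (T : finType) (red : rel T) :
  simple_graph red ->
  (26 <= #|T|)%N ->
  pack R red <= (#|T|%:R * (#|T|%:R - 1)) / 4 ->
  close_to_bipartite (#|T|%:R / 8 : R) red \/
  close_to_bipartite (#|T|%:R / 8 : R) (blue_of red).
Proof.
move=> Hs T26 Hp; have [ri rs] := Hs.
have [w [y Ho]] := @optimum_exists R T red rs [set: T].
have nE : #|[set: T]|%:R = #|T|%:R :> R by rewrite cardsT.
have n26 : 26 <= #|[set: T]|%:R :> R by rewrite nE ler_nat.
have val : wt y [set: T] <= #|[set: T]|%:R * (#|[set: T]|%:R - 1) / 12.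
  by have := optimal_le_pack Hs Ho; rewrite nE; move: Hp; lra.
have zs := zero_sym (opt_weighting Ho).
have tf : forall x u v, zeropair y x u -> zeropair y x v -> zeropair y u v -> False.
  move=> x u v; apply: (zero_triangle_free rs Ho _ val); rewrite ?finset.in_setT //.
  by rewrite cardsT.
have [s bip] : exists s : T -> bool, forall x z, zeropair y x z -> s x != s z.
  apply: (@dense_triangle_free_bipartite R T (zeropair y) zs tf); first by lra.
  (* At most half of all pairs have positive weight, which is the density required of the zero
     pairs. *)
  by have := saturation Ho; move: val; lra.
have [k Hk] := few_inner_edges rs Ho n26 val bip.
have le F : (forall x z, x != z -> F x z = (red x z == k)) ->
    npairs R [rel x z | inner s x z && F x z] <= 2 * (#|T|%:R / 8).
  move=> FE; apply: (@le_trans _ _ (#|T|%:R / 4)); last by lra.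
  rewrite -nE; apply: le_trans Hk; apply: ler_sum => x _; apply: ler_sum => z _ /=.
  by rewrite /inner; case: (eqVneq x z) => //= xz; rewrite FE.
case: k Hk le => _ le; [left|right].
  apply: (inner_edges_close (s := s)) => //.
    by move=> x z; apply: contraTneq => ->; rewrite ri.
  by apply: le => x z _; case: (red x z).
apply: (inner_edges_close (s := s)).
- by move=> x z /andP[].
- exact: blue_sym.
- by apply: le => x z xz; rewrite /blue_of xz; case: (red x z).
Qed.
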